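(* Let $X$ be a topological space, $\mathcal{R}$ a sheaf of commutative rings on $X$ and $(\mathsf{P},\Phi,\ell)$ an $\mathcal{R}$-algebroid data on $X$. The following description defines a separated $\mathcal{R}$-linear prestack $\mathsf{A}_0$ on $X$: (i) for $U\subset X$ open, the objects of $\mathsf{A}_0(U)$ are those of $\mathsf{P}(U)$; (ii) for $p,p'\in\mathsf{A}_0(U)$, $\mathcal{H}om_{\mathsf{A}_0}(p',p)=\Phi(p)\times^{\mathcal{E}nd_{\mathsf P}(p)}\mathcal{H}om_{\mathsf P}(p',p)$, i.e. morphisms $p'\to p$ are equivalence classes $[a,g]$ of pairs of $a\in\Phi(p)$ and $g\colon p'\to p$ in $\mathsf{P}$, for the relation $(a,\phi g)\sim(a\,\ell_p(\phi),g)$ for all $\phi\in\mathcal{E}nd_{\mathsf P}(p)$; (iii) the composition of $[a,g]\colon p'\to p$ and $[a',g']\colon p''\to p'$ is $[a,g]\circ[a',g']=[a\,\Phi(g)(a'),gg']$; (iv) for $[a,g],[a',g']\colon p'\to p$ and $r\in\mathcal{R}$, $r[a,g]=[ra,g]$ and $[a,g]+[a',g']=[a+a'\ell_p(g'g^{-1}),g]$; (v) the restriction functors are the natural ones. Moreover, the stack $\mathsf{A}$ associated with $\mathsf{A}_0$ is an $\mathcal{R}$-algebroid, endowed with a functor $J\colon\mathsf{P}\to\mathsf{A}$ such that $\mathcal{E}nd_{\mathsf A}(J(p))\simeq\Phi(p)$ for any $p\in\mathsf{P}$.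
   Context: A prestack $\mathsf{C}$ on $X$ is a lax presheaf of categories (restrictions compose up to coherent invertible transformations); it is separated if for all $p',p\in\mathsf{C}(U)$ the presheaf $V\mapsto\mathrm{Hom}_{\mathsf{C}(V)}(p'|_V,p|_V)$ is a sheaf, denoted $\mathcal{H}om_{\mathsf C}(p',p)$, with $\mathcal{E}nd_{\mathsf C}(p)=\mathcal{H}om_{\mathsf C}(p,p)$; a stack is a separated prestack satisfying descent. A gerbe is a stack of groupoids which is locally non-empty and in which any two objects are locally isomorphic. An $\mathcal{R}$-linear (pre)stack has $\mathcal{R}$-module structures on the morphism sheaves compatible with composition and restriction. An $\mathcal{R}$-algebroid is an $\mathcal{R}$-linear stack which is locally non-empty and in which any two objects are locally isomorphic. $\mathcal{R}\text{-}\mathsf{Alg}$ is the stack on $X$ of $\mathcal{R}$-algebras and $\mathcal{R}$-algebra homomorphisms. $\mathrm{Ad}(b)(a)=bab^{-1}$. The contracted product in (ii) is taken in the sense of sheaves. An $\mathcal{R}$-algebroid data is a triple $(\mathsf{P},\Phi,\ell)$ with $\mathsf{P}$ a gerbe, $\Phi\colon\mathsf{P}\to\mathcal{R}\text{-}\mathsf{Alg}$ a functor of prestacks, and $\ell$ a collection, for all open $U\subset X$ and $p\in\mathsf{P}(U)$, of group homomorphisms $\ell_p\colon\mathcal{E}nd_{\mathsf P}(p)\to\Phi(p)^\times$, compatible with restrictions, such that $\mathrm{Ad}\circ\ell_p$ equals the map $\Phi\colon\mathcal{E}nd_{\mathsf P}(p)\to\mathcal{A}ut_{\mathcal{R}\text{-}\mathsf{Alg}}(\Phi(p))$,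 and such that $\ell_p(g\phi'g^{-1})=\Phi(g)(\ell_{p'}(\phi'))$ for any $g\in\mathcal{H}om_{\mathsf P}(p',p)$ and $\phi'\in\mathcal{E}nd_{\mathsf P}(p')$. *)

(* Defs.v *)
From HB Require Import structures.
From Stdlib Require Import Relation_Operators.
From mathcomp Require Import all_boot all_order all_algebra.
From mathcomp Require Import boolp classical_sets topology.

Set Implicit Arguments.
Unset Strict Implicit.
Unset Printing Implicit Defensive.

Import GRing.Theory.

Local Open Scope classical_set_scope.
Local Open Scope ring_scope.

Record opens (X : topologicalType) := Opens {
  open_set :> set X;
  open_setP : open open_set }.

(* Transparent, so that chains of inclusions compose strictly (up to
   conversion). *)
Definition incl_refl (T : Type) (A : set T) : A `<=` A := fun x Ax => Ax.
Arguments incl_refl {T A} t _.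
Definition incl_trans (T : Type) (A B C : set T)
    (h : B `<=` A) (k : C `<=` B) : C `<=` A := fun x Cx => h x (k x Cx).
Arguments incl_trans {T A B C} h k t _.

Set Primitive Projections.
Record sub_open (X : topologicalType) (U : opens X) := SubOpen {
  sopen :> opens X;
  sincl : sopen `<=` U }.
Unset Primitive Projections.
Arguments sincl {X U} s t _.

Definition stop {X : topologicalType} (U : opens X) : sub_open U :=
  SubOpen incl_refl.

Definition widen {X : topologicalType} {U V : opens X} (h : V `<=` U)
    (W : sub_open V) : sub_open U :=
  SubOpen (incl_trans h (sincl W)).

(* [J] indexes the open subsets on which [S] is evaluated: it is either
   [opens X] or [sub_open U].  The empty family covers the empty open subset,
   so that a sheaf has exactly one section there. *)
Definition sheaf_axiom (X : topologicalType) (J : Type) (o : J -> opens X)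
    (S : J -> Type) (rs : forall V W : J, o W `<=` o V -> S V -> S W) : Prop :=
  forall (V : J) (I : Type) (C : I -> J) (CV : forall i, o (C i) `<=` o V),
  o V `<=` \bigcup_i o (C i) ->
  forall s : forall i, S (C i),
  (forall i j (W : J) (Wi : o W `<=` o (C i)) (Wj : o W `<=` o (C j)),
     rs _ _ Wi (s i) = rs _ _ Wj (s j)) ->
  exists! t : S V, forall i, rs _ _ (CV i) t = s i.

Record presheaf (X : topologicalType) (U : opens X) := Presheaf {
  psec :> sub_open U -> Type;
  psres : forall V W : sub_open U, W `<=` V -> psec V -> psec W;
  psres_id : forall (V : sub_open U) (h : V `<=` V) s, psres h s = s;
  psres_comp : forall (V W Z : sub_open U) (h : W `<=` V) (k : Z `<=` W)
    (l : Z `<=` V) s, psres k (psres h s) = psres l s }.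

Definition is_sheaf (X : topologicalType) (U : opens X) (F : presheaf U) :=
  sheaf_axiom (o := @sopen X U) (@psres X U F).

Record presheaf_map (X : topologicalType) (U : opens X) (F G : presheaf U) :=
  PresheafMap {
  pmap_fun :> forall V, F V -> G V;
  pmap_res : forall (V W : sub_open U) (h : W `<=` V) s,
    pmap_fun (psres h s) = psres h (pmap_fun s) }.

Definition associated_sheaf (X : topologicalType) (U : opens X)
    (F S : presheaf U) (eta : presheaf_map F S) : Prop :=
  is_sheaf S /\
  forall (T : presheaf U) (f : presheaf_map F T), is_sheaf T ->
  (exists f' : presheaf_map S T, forall V s, f' V (eta V s) = f V s) /\
  (forall f1 f2 : presheaf_map S T,
     (forall V s, f1 V (eta V s) = f2 V (eta V s)) ->
     forall V s, f1 V s = f2 V s).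

(* [comPzRingType] allows the zero ring, the ring of sections on the empty
   open subset. *)
Record ring_sheaf (X : topologicalType) := RingSheaf {
  rsec :> opens X -> comPzRingType;
  rres : forall U V : opens X, V `<=` U -> {rmorphism rsec U -> rsec V};
  rres_id : forall (U : opens X) (h : U `<=` U) r, rres h r = r;
  rres_comp : forall (U V W : opens X) (h : V `<=` U) (k : W `<=` V)
    (l : W `<=` U) r, rres k (rres h r) = rres l r;
  rres_sheaf : sheaf_axiom (o := id) (fun U V h => rres (U := U) (V := V) h) }.

Record category (O : Type) := Category {
  chom : O -> O -> Type;
  idm : forall x, chom x x;
  ccomp : forall x y z, chom y z -> chom x y -> chom x z;
  comp1m : forall x y (f : chom x y), ccomp (idm y) f = f;
  compm1 : forall x y (f : chom x y), ccomp f (idm x) = f;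
  compA : forall x y z t (f : chom z t) (g : chom y z) (h : chom x y),
    ccomp f (ccomp g h) = ccomp (ccomp f g) h }.
Arguments idm {O c}.
Arguments ccomp {O c x y z}.

Declare Scope cat_scope.
Delimit Scope cat_scope with cat.
Local Open Scope cat_scope.
Notation "f ∘ g" := (ccomp f g) (at level 40, left associativity) : cat_scope.

Record iso (O : Type) (C : category O) (x y : O) := Iso {
  fwd : chom C x y;
  bwd : chom C y x;
  fwdK : bwd ∘ fwd = idm x;
  bwdK : fwd ∘ bwd = idm y }.
Arguments Iso {O C x y}.

Definition is_iso (O : Type) (C : category O) (x y : O) (f : chom C x y) :=
  exists g : chom C y x, g ∘ f = idm x /\ f ∘ g = idm y.

(* Objects and restriction on objects are kept apart from the rest of the
   structure, in order to speak of prestacks having the same objects. *)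
Record obj_family (X : topologicalType) := ObjFamily {
  fob :> opens X -> Type;
  fres : forall U V : opens X, V `<=` U -> fob U -> fob V }.

Notation "p ↾ h" := (fres h p) (at level 20, left associativity) : cat_scope.

Record prestack_on (X : topologicalType) (B : obj_family X) := PrestackOn {
  pcat : forall U : opens X, category (B U);
  pres : forall (U V : opens X) (h : V `<=` U) (p' p : B U),
    chom (pcat U) p' p -> chom (pcat V) (p' ↾ h) (p ↾ h);
  pres_id : forall (U V : opens X) (h : V `<=` U) (p : B U),
    pres h (idm p) = idm (p ↾ h);
  pres_comp : forall (U V : opens X) (h : V `<=` U) (p'' p' p : B U)
    (f : chom (pcat U) p' p) (g : chom (pcat U) p'' p'),
    pres h (f ∘ g) = pres h f ∘ pres h g;
  punit : forall (U : opens X) (h : U `<=` U) (p : B U),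
    iso (pcat U) (p ↾ h) p;
  pcomp : forall (U V W : opens X) (h : V `<=` U) (k : W `<=` V)
    (l : W `<=` U) (p : B U), iso (pcat W) (p ↾ h ↾ k) (p ↾ l);
  punit_nat : forall (U : opens X) (h : U `<=` U) (p' p : B U)
    (f : chom (pcat U) p' p),
    fwd (punit h p) ∘ pres h f = f ∘ fwd (punit h p');
  pcomp_nat : forall (U V W : opens X) (h : V `<=` U) (k : W `<=` V)
    (l : W `<=` U) (p' p : B U) (f : chom (pcat U) p' p),
    fwd (pcomp h k l p) ∘ pres k (pres h f) = pres l f ∘ fwd (pcomp h k l p');
  pcomp_unitl : forall (U V : opens X) (h : U `<=` U) (k : V `<=` U)
    (p : B U), fwd (pcomp h k k p) = pres k (fwd (punit h p));
  pcomp_unitr : forall (U V : opens X) (h : V `<=` U) (k : V `<=` V)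
    (p : B U), fwd (pcomp h k h p) = fwd (punit k (p ↾ h));
  pcomp_assoc : forall (U V W Z : opens X) (h : V `<=` U) (k : W `<=` V)
    (m : Z `<=` W) (l : W `<=` U) (n : Z `<=` V) (q : Z `<=` U) (p : B U),
    fwd (pcomp l m q p) ∘ pres m (fwd (pcomp h k l p))
    = fwd (pcomp h n q p) ∘ fwd (pcomp k m n (p ↾ h)) }.

Record prestack (X : topologicalType) := Prestack {
  pbase :> obj_family X;
  pon :> prestack_on pbase }.

Notation "''Hom_' C ( p' , p )" := (chom (pcat C _) p' p)
  (at level 8, C at level 2, format "''Hom_' C ( p' ,  p )") : cat_scope.

(* The restriction to W of a morphism on V between the restrictions to V of
   two objects. *)
Definition lres (X : topologicalType) (C : prestack X) (U1 U2 V W : opens X)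
    (x : C U1) (y : C U2) (h1 : V `<=` U1) (h2 : V `<=` U2) (k : W `<=` V)
    (l1 : W `<=` U1) (l2 : W `<=` U2) (f : 'Hom_C(x ↾ h1, y ↾ h2)) :
    'Hom_C(x ↾ l1, y ↾ l2) :=
  fwd (pcomp C h2 k l2 y) ∘ pres k f ∘ bwd (pcomp C h1 k l1 x).

Section Prestacks.
Variable X : topologicalType.
Implicit Types (U V W Z : opens X) (C : prestack X).

Lemma fwdKf (O : Type) (C : category O) (x y z : O) (i : iso C x y)
  (f : chom C z x) : bwd i ∘ (fwd i ∘ f) = f.
Proof. by rewrite compA fwdK comp1m. Qed.

Lemma bwdKf (O : Type) (C : category O) (x y z : O) (i : iso C x y)
  (f : chom C z y) : fwd i ∘ (bwd i ∘ f) = f.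
Proof. by rewrite compA bwdK comp1m. Qed.

Lemma fwd_inj (O : Type) (C : category O) (x y z : O) (i : iso C x y)
  (f g : chom C z x) : fwd i ∘ f = fwd i ∘ g -> f = g.
Proof. by move=> e; rewrite -(fwdKf i f) e fwdKf. Qed.

Lemma fwd_epi (O : Type) (C : category O) (x y z : O) (i : iso C x y)
  (f g : chom C y z) : f ∘ fwd i = g ∘ fwd i -> f = g.
Proof. by move=> e; rewrite -[f]compm1 -[g]compm1 -(bwdK i) !compA e. Qed.

Lemma lres_fwd C U1 U2 V W (x : C U1) (y : C U2) (h1 : V `<=` U1)
    (h2 : V `<=` U2) (k : W `<=` V) (l1 : W `<=` U1) (l2 : W `<=` U2)
    (f : 'Hom_C(x ↾ h1, y ↾ h2)) :
  lres k l1 l2 f ∘ fwd (pcomp C h1 k l1 x) = fwd (pcomp C h2 k l2 y) ∘ pres k f.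
Proof. by rewrite /lres -compA fwdK compm1. Qed.

Lemma lres_id C U1 U2 V (x : C U1) (y : C U2) (h1 : V `<=` U1)
    (h2 : V `<=` U2) (k : V `<=` V) (f : 'Hom_C(x ↾ h1, y ↾ h2)) :
  lres k h1 h2 f = f.
Proof.
apply: (@fwd_epi _ _ _ _ _ (pcomp C h1 k h1 x)).
by rewrite lres_fwd !pcomp_unitr punit_nat.
Qed.

Lemma lres_comp C U1 U2 V W Z (x : C U1) (y : C U2) (h1 : V `<=` U1)
    (h2 : V `<=` U2) (k : W `<=` V) (l1 : W `<=` U1) (l2 : W `<=` U2)
    (m : Z `<=` W) (q1 : Z `<=` U1) (q2 : Z `<=` U2) (n : Z `<=` V)
    (f : 'Hom_C(x ↾ h1, y ↾ h2)) :
  lres m q1 q2 (lres k l1 l2 f) = lres n q1 q2 f.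
Proof.
apply: (@fwd_epi _ _ _ _ _ (pcomp C l1 m q1 x)); rewrite lres_fwd.
pose i := pcomp C h1 k l1 x.
have pi : pres m (fwd i) ∘ pres m (bwd i) = idm _.
  by rewrite -pres_comp bwdK pres_id.
suff e : fwd (pcomp C l2 m q2 y) ∘ pres m (lres k l1 l2 f) ∘ pres m (fwd i) =
    lres n q1 q2 f ∘ fwd (pcomp C l1 m q1 x) ∘ pres m (fwd i).
  by have := congr1 (fun g => g ∘ pres m (bwd i)) e; rewrite -!compA pi !compm1.
rewrite -compA -pres_comp lres_fwd pres_comp compA.
rewrite (pcomp_assoc C h2 k m l2 n q2).
rewrite -[RHS]compA (pcomp_assoc C h1 k m l1 n q1) [RHS]compA lres_fwd.
by rewrite -!compA pcomp_nat.
Qed.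

Definition hom_presheaf C U (p' p : C U) : presheaf U :=
  @Presheaf X U (fun V : sub_open U => 'Hom_C(p' ↾ sincl V, p ↾ sincl V))
    (fun (V W : sub_open U) k f => lres k (sincl W) (sincl W) f)
    (fun (V : sub_open U) k f => lres_id k f)
    (fun (V W Z : sub_open U) k m n f => lres_comp k _ _ m _ _ n f).

Definition separated_prestack C :=
  forall U (p' p : C U), is_sheaf (hom_presheaf p' p).

Definition meet_open U V : opens X :=
  Opens (openI (@open_setP X U) (@open_setP X V)).

Lemma incl_meetl U V : meet_open U V `<=` U.
Proof. by move=> x []. Qed.

Lemma incl_meetr U V : meet_open U V `<=` V.
Proof. by move=> x []. Qed.


Definition descent C :=
  forall U (I : Type) (V : I -> sub_open U), U `<=` \bigcup_i V i ->
  forall (p : forall i, C (V i))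
    (t : forall i j, iso (pcat C (meet_open (V i) (V j)))
       (p j ↾ @incl_meetr (V i) (V j)) (p i ↾ @incl_meetl (V i) (V j))),
  (forall i j k W (Wi : W `<=` V i) (Wj : W `<=` V j) (Wk : W `<=` V k)
     (Wij : W `<=` meet_open (V i) (V j)) (Wjk : W `<=` meet_open (V j) (V k))
     (Wik : W `<=` meet_open (V i) (V k)),
     lres Wij Wj Wi (fwd (t i j)) ∘ lres Wjk Wk Wj (fwd (t j k))
     = lres Wik Wk Wi (fwd (t i k))) ->
  exists (q : C U) (a : forall i, iso (pcat C (V i)) (q ↾ sincl (V i)) (p i)),
  forall i j (l : meet_open (V i) (V j) `<=` U),
    fwd (t i j) ∘ pres (@incl_meetr (V i) (V j)) (fwd (a j))
    = pres (@incl_meetl (V i) (V j)) (fwd (a i))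
      ∘ bwd (pcomp C (sincl (V i)) (@incl_meetl (V i) (V j)) l q)
      ∘ fwd (pcomp C (sincl (V j)) (@incl_meetr (V i) (V j)) l q).

Definition stack C := separated_prestack C /\ descent C.

Definition locally_nonempty C :=
  forall x : X, exists U : opens X, (U : set X) x /\ inhabited (C U).

Definition locally_isomorphic C :=
  forall U (p' p : C U) (x : X), (U : set X) x ->
  exists V : sub_open U, (V : set X) x /\
    inhabited (iso (pcat C V) (p' ↾ sincl V) (p ↾ sincl V)).

Definition groupoids C :=
  forall U (p' p : C U) (g : 'Hom_C(p', p)), is_iso g.

Definition gerbe C :=
  [/\ stack C, groupoids C, locally_nonempty C & locally_isomorphic C].

End Prestacks.

Record functor (X : topologicalType) (C D : prestack X) := Functor {
  fun_ob :> forall U : opens X, C U -> D U;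
  fun_hom : forall (U : opens X) (p' p : C U),
    'Hom_C(p', p) -> 'Hom_D(fun_ob p', fun_ob p);
  fun_id : forall (U : opens X) (p : C U), fun_hom (idm p) = idm (fun_ob p);
  fun_comp : forall (U : opens X) (p'' p' p : C U)
    (f : 'Hom_C(p', p)) (g : 'Hom_C(p'', p')),
    fun_hom (f ∘ g) = fun_hom f ∘ fun_hom g;
  fun_res : forall (U V : opens X) (h : V `<=` U) (p : C U),
    iso (pcat D V) (fun_ob (p ↾ h)) (fun_ob p ↾ h);
  fun_res_nat : forall (U V : opens X) (h : V `<=` U) (p' p : C U)
    (f : 'Hom_C(p', p)),
    fwd (fun_res h p) ∘ fun_hom (pres h f)
    = pres h (fun_hom f) ∘ fwd (fun_res h p');
  fun_res_unit : forall (U : opens X) (h : U `<=` U) (p : C U),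
    fwd (punit D h (fun_ob p)) ∘ fwd (fun_res h p)
    = fun_hom (fwd (punit C h p));
  fun_res_comp : forall (U V W : opens X) (h : V `<=` U) (k : W `<=` V)
    (l : W `<=` U) (p : C U),
    fwd (pcomp D h k l (fun_ob p)) ∘ pres k (fwd (fun_res h p))
      ∘ fwd (fun_res k (p ↾ h))
    = fwd (fun_res l p) ∘ fun_hom (fwd (pcomp C h k l p)) }.
Arguments fun_ob {X C D} _ U _.
Arguments fun_hom {X C D} _ {U p' p} _.
Arguments fun_res {X C D} _ {U V} h p.

(* The action of [F] on sections over V of the sheaf of morphisms p' -> p. *)
Definition fun_lhom (X : topologicalType) (C D : prestack X) (F : functor C D)
    (U V : opens X) (h : V `<=` U) (p' p : C U) (f : 'Hom_C(p' ↾ h, p ↾ h)) :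
    'Hom_D(F U p' ↾ h, F U p ↾ h) :=
  fwd (fun_res F h p) ∘ fun_hom F f ∘ bwd (fun_res F h p').

Record transf (X : topologicalType) (C D : prestack X) (F G : functor C D) :=
  Transf {
  tr_fun :> forall (U : opens X) (p : C U), 'Hom_D(F U p, G U p);
  tr_nat : forall (U : opens X) (p' p : C U) (f : 'Hom_C(p', p)),
    tr_fun p ∘ fun_hom F f = fun_hom G f ∘ tr_fun p';
  tr_res : forall (U V : opens X) (h : V `<=` U) (p : C U),
    fwd (fun_res G h p) ∘ tr_fun (p ↾ h)
    = pres h (tr_fun p) ∘ fwd (fun_res F h p) }.
Arguments tr_fun {X C D F G} _ U _.

Section Composition.
Variables (X : topologicalType) (B C D : prestack X).
Variables (G : functor C D) (F : functor B C).

Definition fun_iso (U : opens X) (p' p : C U) (i : iso (pcat C U) p' p) :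
  iso (pcat D U) (G U p') (G U p).
Proof.
exists (fun_hom G (fwd i)) (fun_hom G (bwd i)).
- by rewrite -fun_comp fwdK fun_id.
- by rewrite -fun_comp bwdK fun_id.
Defined.

Definition comp_iso (O : Type) (K : category O) (x y z : O)
  (i : iso K y z) (j : iso K x y) : iso K x z.
Proof.
exists (fwd i ∘ fwd j) (bwd j ∘ bwd i).
- by rewrite -compA fwdKf fwdK.
- by rewrite -compA bwdKf bwdK.
Defined.

Definition comp_functor : functor B D.
Proof.
exists (fun U p => G U (F U p)) (fun U p' p f => fun_hom G (fun_hom F f))
  (fun U V h p => comp_iso (fun_res G h (F U p)) (fun_iso (fun_res F h p))).
- by move=> U p; rewrite !fun_id.
- by move=> U p'' p' p f g; rewrite !fun_comp.
- move=> U V h p' p f /=.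
  by rewrite -compA -fun_comp fun_res_nat fun_comp compA fun_res_nat compA.
- move=> U h p /=.
  by rewrite compA fun_res_unit -fun_comp fun_res_unit.
- move=> U V W h k l p /=.
  rewrite pres_comp -[RHS]compA -fun_comp -fun_res_comp !fun_comp.
  rewrite ![in RHS]compA -fun_res_comp -!compA; congr (_ ∘ (_ ∘ _)).
  by rewrite !compA fun_res_nat.
Defined.

End Composition.

(* Composition with [i] is an equivalence, for every stack S, from the category
   of functors A -> S to that of functors A0 -> S. *)
Definition associated_stack (X : topologicalType) (A0 A : prestack X)
    (i : functor A0 A) : Prop :=
  stack A /\
  forall S : prestack X, stack S ->
  (forall G : functor A0 S, exists (F : functor A S)
     (t : transf (comp_functor F i) G), forall U p, is_iso (t U p)) /\
  (forall (F F' : functor A S)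
     (t : transf (comp_functor F i) (comp_functor F' i)),
     (exists t' : transf F F', forall U p, t' U (i U p) = t U p) /\
     (forall t1 t2 : transf F F',
        (forall U p, t1 U (i U p) = t U p) ->
        (forall U p, t2 U (i U p) = t U p) ->
        forall U p, t1 U p = t2 U p)).

Section Linear.
Variables (X : topologicalType) (R : ring_sheaf X) (C : prestack X).

Record linear_structure := LinearStructure {
  lmod : forall (U : opens X) (p' p : C U), GRing.Lmodule (R U) 'Hom_C(p', p);
  hom_lmod : forall (U : opens X) (p' p : C U), lmodType (R U) :=
    fun U p' p => GRing.Lmodule.Pack (lmod p' p);
  comp_addl : forall (U : opens X) (p'' p' p : C U) (f1 f2 : hom_lmod p' p)
    (g : hom_lmod p'' p'),
    (f1 + f2 : hom_lmod p' p) ∘ g = (f1 ∘ g : hom_lmod p'' p) + f2 ∘ g;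
  comp_addr : forall (U : opens X) (p'' p' p : C U) (f : hom_lmod p' p)
    (g1 g2 : hom_lmod p'' p'),
    f ∘ (g1 + g2 : hom_lmod p'' p') = (f ∘ g1 : hom_lmod p'' p) + f ∘ g2;
  comp_scalel : forall (U : opens X) (p'' p' p : C U) (r : R U)
    (f : hom_lmod p' p) (g : hom_lmod p'' p'),
    (r *: f : hom_lmod p' p) ∘ g = r *: (f ∘ g : hom_lmod p'' p);
  comp_scaler : forall (U : opens X) (p'' p' p : C U) (r : R U)
    (f : hom_lmod p' p) (g : hom_lmod p'' p'),
    f ∘ (r *: g : hom_lmod p'' p') = r *: (f ∘ g : hom_lmod p'' p);
  pres_add : forall (U V : opens X) (h : V `<=` U) (p' p : C U)
    (f g : hom_lmod p' p),
    pres h (f + g : hom_lmod p' p)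
    = (pres h f : hom_lmod (p' ↾ h) (p ↾ h)) + pres h g;
  pres_scale : forall (U V : opens X) (h : V `<=` U) (p' p : C U) (r : R U)
    (f : hom_lmod p' p),
    pres h (r *: f : hom_lmod p' p)
    = rres R h r *: (pres h f : hom_lmod (p' ↾ h) (p ↾ h)) }.

Definition algebroid (L : linear_structure) :=
  [/\ stack C, locally_nonempty C & locally_isomorphic C].

End Linear.
Arguments hom_lmod {X R C} L {U} p' p : rename.

Definition linear_functor (X : topologicalType) (R : ring_sheaf X)
    (C D : prestack X) (LC : linear_structure R C) (LD : linear_structure R D)
    (F : functor C D) : Prop :=
  (forall (U : opens X) (p' p : C U) (f g : hom_lmod LC p' p),
    fun_hom F (f + g : hom_lmod LC p' p)
    = (fun_hom F f : hom_lmod LD (F U p') (F U p)) + fun_hom F g) /\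
  (forall (U : opens X) (p' p : C U) (r : R U) (f : hom_lmod LC p' p),
    fun_hom F (r *: f : hom_lmod LC p' p)
    = r *: (fun_hom F f : hom_lmod LD (F U p') (F U p))).

Section Algebras.
Variables (X : topologicalType) (R : ring_sheaf X).

(* A sheaf of algebras over the restriction of [R] to [U], the algebra
   structure being a ring morphism with central image.  The library's [algType]
   is not used since it excludes the zero ring. *)
Record ralg (U : opens X) := RAlgebra {
  asec :> sub_open U -> pzRingType;
  astr : forall V : sub_open U, {rmorphism R V -> asec V};
  astrC : forall (V : sub_open U) (r : R V) (a : asec V),
    astr V r * a = a * astr V r;
  ares : forall V W : sub_open U, W `<=` V -> {rmorphism asec V -> asec W};
  ares_id : forall (V : sub_open U) (h : V `<=` V) a, ares h a = a;
  ares_comp : forall (V W Z : sub_open U) (h : W `<=` V) (k : Z `<=` W)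
    (l : Z `<=` V) a, ares k (ares h a) = ares l a;
  ares_str : forall (V W : sub_open U) (h : W `<=` V) (r : R V),
    ares h (astr V r) = astr W (rres R h r);
  ares_sheaf : sheaf_axiom (o := @sopen X U)
    (fun V W h => ares (V := V) (W := W) h) }.

Record ralg_hom (U : opens X) (A B : ralg U) := RAlgHom {
  amap :> forall V, A V -> B V;
  amapD : forall V, {morph @amap V : a b / a + b};
  amapM : forall V, {morph @amap V : a b / a * b};
  (* at r = 1, preservation of the unit *)
  amap_str : forall V r, amap (astr A V r) = astr B V r;
  amap_res : forall (V W : sub_open U) (h : W `<=` V) a,
    amap (ares A h a) = ares B h (amap a) }.
Arguments amap {U A B} _ V _.

Lemma ralg_hom_eq (U : opens X) (A B : ralg U) (f g : ralg_hom A B) :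
  (forall V a, f V a = g V a) -> f = g.
Proof.
case: f g => [f fD fM fs fr] [g gD gM gs gr] /= e.
have {}e : f = g.
  by apply: functional_extensionality_dep => V;
     apply: functional_extensionality_dep => a.
by subst g; congr RAlgHom; apply: Prop_irrelevance.
Qed.

Definition ralg_id (U : opens X) (A : ralg U) : ralg_hom A A.
Proof. by exists (fun V a => a). Defined.

Definition ralg_comp (U : opens X) (A B D : ralg U)
  (f : ralg_hom B D) (g : ralg_hom A B) : ralg_hom A D.
Proof.
exists (fun V a => f V (g V a)).
- by move=> V a b; rewrite !amapD.
- by move=> V a b; rewrite !amapM.
- by move=> V r; rewrite !amap_str.
- by move=> V W h a; rewrite !amap_res.
Defined.

Definition ralg_category (U : opens X) : category (ralg U).
Proof.
by exists (@ralg_hom U) (@ralg_id U) (@ralg_comp U) => *; exact: ralg_hom_eq.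
Defined.

Lemma sub_open_eq (U : opens X) (V W : sub_open U) :
  sopen V = sopen W -> V = W.
Proof.
case: V W => [V p] [W q] /= e; subst W.
by congr SubOpen; exact: Prop_irrelevance.
Qed.

Definition ralg_res (U V : opens X) (h : V `<=` U) (A : ralg U) : ralg V.
Proof.
exists (fun W => A (widen h W)) (fun W => astr A (widen h W))
  (fun W Z k => ares A (V := widen h W) (W := widen h Z) k).
- by move=> W r a; exact: astrC.
- by move=> W k a; exact: ares_id.
- move=> W Z T k m n a.
  exact: (@ares_comp U A (widen h W) (widen h Z) (widen h T) k m n a).
- by move=> W Z k r; exact: (@ares_str U A (widen h W) (widen h Z) k r).
- move=> W I C CV cov s sP.
  have sP' : forall i j (Z : sub_open U) (Zi : Z `<=` widen h (C i))
    (Zj : Z `<=` widen h (C j)), ares A Zi (s i) = ares A Zj (s j).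
    move=> i j Z Zi Zj; have [Z' e] : exists Z', Z = widen h Z'.
      exists (SubOpen (incl_trans (sincl (C i)) Zi)); exact: sub_open_eq.
    by move: Zi Zj; rewrite e => Zi Zj; exact: sP.
  exact: (@ares_sheaf U A (widen h W) I (fun i => widen h (C i)) CV cov s sP').
Defined.

Definition ralg_resm (U V : opens X) (h : V `<=` U) (A B : ralg U)
  (f : ralg_hom A B) : ralg_hom (ralg_res h A) (ralg_res h B).
Proof.
exists (fun W => f (widen h W)).
- by move=> W a b; exact: (@amapD U A B f (widen h W) a b).
- by move=> W a b; exact: (@amapM U A B f (widen h W) a b).
- by move=> W r; exact: (@amap_str U A B f (widen h W) r).
- by move=> W Z k a; exact: (@amap_res U A B f (widen h W) (widen h Z) k a).
Defined.

Definition ralg_family : obj_family X := ObjFamily ralg_res.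

Definition ralg_unit (U : opens X) (h : U `<=` U) (A : ralg U) :
  iso (ralg_category U) (ralg_res h A) A.
Proof.
pose f (W : sub_open U) : ralg_res h A W -> A W :=
  ares A (V := widen h W) (W := W) incl_refl.
pose g (W : sub_open U) : A W -> ralg_res h A W :=
  ares A (V := W) (W := widen h W) incl_refl.
unshelve eexists.
- exists f.
  + by move=> W a b; exact: rmorphD.
  + by move=> W a b; exact: rmorphM.
  + by move=> W r; rewrite /f /= (@ares_str U A (widen h W) W) rres_id.
  + by move=> W Z k a; rewrite /f /= !ares_comp.
- exists g.
  + by move=> W a b; exact: rmorphD.
  + by move=> W a b; exact: rmorphM.
  + by move=> W r; rewrite /g /= (@ares_str U A W (widen h W)) rres_id.
  + by move=> W Z k a; rewrite /g /= !ares_comp.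
- apply: ralg_hom_eq => W a.
  exact: etrans (@ares_comp U A (widen h W) W (widen h W) incl_refl incl_refl
    incl_refl a)
    (@ares_id U A (widen h W) _ a).
- apply: ralg_hom_eq => W a.
  exact: etrans (@ares_comp U A W (widen h W) W incl_refl incl_refl incl_refl a)
    (@ares_id U A W _ a).
Defined.

Definition ralg_assoc (U V W : opens X) (h : V `<=` U) (k : W `<=` V)
  (l : W `<=` U) (A : ralg U) :
  iso (ralg_category W) (ralg_res k (ralg_res h A)) (ralg_res l A).
Proof.
pose f (T : sub_open W) : ralg_res k (ralg_res h A) T -> ralg_res l A T :=
  ares A (V := (widen h (widen k T))) (W := (widen l T)) incl_refl.
pose g (T : sub_open W) : ralg_res l A T -> ralg_res k (ralg_res h A) T :=
  ares A (V := (widen l T)) (W := (widen h (widen k T))) incl_refl.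
unshelve eexists.
- exists f.
  + by move=> T a b; exact: rmorphD.
  + by move=> T a b; exact: rmorphM.
  + by move=> T r; rewrite /f /= (@ares_str U A (widen h (widen k T)) (widen l T))
    rres_id.
  + by move=> T Z m a; rewrite /f /= !ares_comp.
- exists g.
  + by move=> T a b; exact: rmorphD.
  + by move=> T a b; exact: rmorphM.
  + by move=> T r; rewrite /g /= (@ares_str U A (widen l T) (widen h (widen k T)))
    rres_id.
  + by move=> T Z m a; rewrite /g /= !ares_comp.
- apply: ralg_hom_eq => T a.
  exact: etrans (@ares_comp U A (widen h (widen k T)) (widen l T) (widen h (widen k T))
    incl_refl incl_refl incl_refl a)
    (@ares_id U A (widen h (widen k T)) _ a).
- apply: ralg_hom_eq => T a.
  exact: etrans (@ares_comp U A (widen l T) (widen h (widen k T)) (widen l T)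
    incl_refl incl_refl incl_refl a)
    (@ares_id U A (widen l T) _ a).
Defined.

Definition RAlg_on : prestack_on ralg_family.
Proof.
exists ralg_category ralg_resm ralg_unit ralg_assoc.
- by move=> *; exact: ralg_hom_eq.
- by move=> *; exact: ralg_hom_eq.
- by move=> U h A B f; apply: ralg_hom_eq => W a /=; rewrite amap_res.
- by move=> U V W h k l A B f; apply: ralg_hom_eq => T a /=; rewrite amap_res.
- by move=> U V h k A; exact: ralg_hom_eq.
- by move=> U V h k A; exact: ralg_hom_eq.
- move=> U V W Z h k m l n q A; apply: ralg_hom_eq => T a.
  pose T1 := widen h (widen k (widen m T)); pose T2 := widen q T.
  exact: etrans (@ares_comp U A T1 (widen l (widen m T)) T2 incl_refl incl_refl
      incl_refl a)
    (esym (@ares_comp U A T1 (widen h (widen n T)) T2 incl_refl incl_refl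
      incl_refl a)).
Defined.

Definition RAlg : prestack X := Prestack RAlg_on.

End Algebras.

Record unit_of (A : pzRingType) := UnitOf {
  uval : A;
  uinv : A;
  uvalV : uval * uinv = 1;
  uinvV : uinv * uval = 1 }.

Definition unit_map (A B : pzRingType) (f : {rmorphism A -> B})
  (u : unit_of A) : unit_of B.
Proof.
by exists (f (uval u)) (f (uinv u)); rewrite -rmorphM (uvalV, uinvV) rmorph1.
Defined.

Definition Ad (A : pzRingType) (b : unit_of A) (a : A) : A :=
  uval b * a * uinv b.

Section AlgebroidData.
Variables (X : topologicalType) (R : ring_sheaf X).

Section Functor.
Variables (P : prestack X) (Phi : functor P (RAlg R)).

Definition alg_of (U : opens X) (p : P U) : ralg R U := Phi U p.

Definition alg_map (U : opens X) (p' p : P U) (g : 'Hom_P(p', p)) :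
  ralg_hom (alg_of p') (alg_of p) := fun_hom Phi g.

(* For g a morphism over V between restrictions to V, the corresponding
   morphism between the restrictions to V of the sheaves of algebras. *)
Definition alg_lmap (U V : opens X) (h : V `<=` U) (p' p : P U)
    (g : 'Hom_P(p' ↾ h, p ↾ h)) :
  ralg_hom (ralg_res h (alg_of p')) (ralg_res h (alg_of p)) :=
  fun_lhom Phi g.

(* Phi(p|V) -> Phi(p)|V and its inverse. *)
Definition alg_out (U V : opens X) (h : V `<=` U) (p : P U) :
  ralg_hom (alg_of (p ↾ h)) (ralg_res h (alg_of p)) := fwd (fun_res Phi h p).

Definition alg_in (U V : opens X) (h : V `<=` U) (p : P U) :
  ralg_hom (ralg_res h (alg_of p)) (alg_of (p ↾ h)) := bwd (fun_res Phi h p).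

End Functor.

(* [ad_ell] is, for every p, a morphism from the sheaf of groups End(p) to the
   sheaf of invertible elements of Phi(p). *)
Record algebroid_data := AlgebroidData {
  ad_P : prestack X;
  ad_gerbe : gerbe ad_P;
  ad_Phi : functor ad_P (RAlg R);
  ad_ell : forall (U : opens X) (p : ad_P U) (V : sub_open U),
    hom_presheaf p p V -> unit_of (alg_of ad_Phi p V);
  ad_ell_mul : forall (U : opens X) (p : ad_P U) (V : sub_open U)
    (f g : hom_presheaf p p V),
    uval (ad_ell (f ∘ g)) = uval (ad_ell f) * uval (ad_ell g);
  ad_ell_res : forall (U : opens X) (p : ad_P U) (V W : sub_open U)
    (h : W `<=` V) (f : hom_presheaf p p V),
    ad_ell (psres h f) = unit_map (ares (alg_of ad_Phi p) h) (ad_ell f);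
  (* compatibility of the morphisms attached to p and to p|V *)
  ad_ell_pres : forall (U V : opens X) (h : V `<=` U) (p : ad_P U)
    (W : sub_open V) (f : hom_presheaf (p ↾ h) (p ↾ h) W),
    let c := pcomp ad_P h (sincl W) (sincl (widen h W)) p in
    uval (ad_ell (V := widen h W) (fwd c ∘ f ∘ bwd c))
    = alg_out ad_Phi h p W (uval (ad_ell f));
  ad_ell_Ad : forall (U : opens X) (p : ad_P U) (V : sub_open U)
    (f : hom_presheaf p p V) (W : sub_open V)
    (a : alg_of ad_Phi p (widen (sincl V) W)),
    alg_lmap ad_Phi f W a
    = Ad (unit_map (ares (alg_of ad_Phi p) (V := V) (W := widen (sincl V) W)
        (sincl W)) (ad_ell f)) a;
  ad_ell_conj : forall (U : opens X) (p' p : ad_P U) (V : sub_open U)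
    (g : iso (pcat ad_P V) (p' ↾ sincl V) (p ↾ sincl V))
    (f : hom_presheaf p' p' V),
    uval (ad_ell (V := V) (fwd g ∘ f ∘ bwd g))
    = alg_lmap ad_Phi (fwd g) (stop V) (uval (ad_ell f)) }.

End AlgebroidData.

Section ContractedProduct.
Variables (X : topologicalType) (R : ring_sheaf X) (D : algebroid_data R).
Notation P := (ad_P D).
Notation Phi := (ad_Phi D).
Variables (U : opens X) (p' p : P U).

Definition cp_pair (V : sub_open U) : Type :=
  alg_of Phi p V * hom_presheaf p' p V.

(* (a, phi g) ~ (a ell(phi), g) *)
Definition cp_rel (V : sub_open U) (x y : cp_pair V) : Prop :=
  exists phi : hom_presheaf p p V,
    x.2 = phi ∘ y.2 /\ y.1 = x.1 * uval (ad_ell phi).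

Definition cp_class (V : sub_open U) (x : cp_pair V) : set (cp_pair V) :=
  clos_refl_sym_trans _ (@cp_rel V) x.

Definition cp_sec (V : sub_open U) : Type :=
  {S : set (cp_pair V) | exists x, S = cp_class x}.

Definition cp_mk (V : sub_open U) (a : alg_of Phi p V)
    (g : hom_presheaf p' p V) : cp_sec V :=
  exist _ (cp_class (a, g)) (ex_intro _ (a, g) erefl).

Definition cp_pair_res (V W : sub_open U) (h : W `<=` V) (x : cp_pair V) :
  cp_pair W := (ares (alg_of Phi p) h x.1, psres h x.2).

Lemma cp_class_eq (V : sub_open U) (x y : cp_pair V) :
  clos_refl_sym_trans _ (@cp_rel V) x y -> cp_class x = cp_class y.
Proof.
move=> xy; apply/seteqP; split=> z /= h.
- exact: rst_trans (rst_sym _ _ _ _ xy) h.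
- exact: rst_trans xy h.
Qed.

Lemma lres_mul (V W : sub_open U) (h : W `<=` V) (q1 q2 q3 : P U)
  (f : hom_presheaf q2 q3 V) (g : hom_presheaf q1 q2 V) :
  psres h (f ∘ g : hom_presheaf q1 q3 V)
  = (psres h f : hom_presheaf q2 q3 W) ∘ (psres h g : hom_presheaf q1 q2 W).
Proof. by rewrite /= /lres pres_comp !compA -(compA _ (bwd _)) fwdK compm1. Qed.

Lemma cp_res_equiv (V W : sub_open U) (h : W `<=` V) (x y : cp_pair V) :
  clos_refl_sym_trans _ (@cp_rel V) x y ->
  clos_refl_sym_trans _ (@cp_rel W) (cp_pair_res h x) (cp_pair_res h y).
Proof.
elim=> [{}x {}y [phi [e1 e2]]|{}x|{}x {}y _|{}x {}y z _ xy _ yz].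
- apply: rst_step; exists (psres h phi); split.
    by rewrite /cp_pair_res e1 lres_mul.
  by rewrite /cp_pair_res /= e2 rmorphM ad_ell_res.
- exact: rst_refl.
- exact: rst_sym.
- exact: rst_trans xy yz.
Qed.

Lemma cp_res_class (V W : sub_open U) (h : W `<=` V) (x : cp_pair V) :
  [set z | exists2 y, cp_class x y & cp_class (cp_pair_res h y) z]
  = cp_class (cp_pair_res h x).
Proof.
apply/seteqP; split=> z /=.
  by move=> [y xy]; apply: rst_trans; exact: cp_res_equiv.
by move=> xz; exists x => //; exact: rst_refl.
Qed.

Definition cp_res (V W : sub_open U) (h : W `<=` V) (S : cp_sec V) : cp_sec W.
Proof.
exists [set z | exists2 y, sval S y & cp_class (cp_pair_res h y) z].
by case: S => S [x /= ->]; exists (cp_pair_res h x); exact: cp_res_class.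
Defined.

Lemma cp_sec_eq (V : sub_open U) (S T : cp_sec V) : sval S = sval T -> S = T.
Proof.
case: S T => [S s] [T t] /= e; subst T.
by congr exist; exact: Prop_irrelevance.
Qed.

Definition contracted : presheaf U.
Proof.
exists cp_sec cp_res.
- move=> V h S; apply: cp_sec_eq; case: S => S [x /= ->].
  rewrite cp_res_class; suff -> : cp_pair_res h x = x by [].
  by case: x => a g; rewrite /cp_pair_res ares_id psres_id.
- move=> V W Z h k l S; apply: cp_sec_eq; case: S => S [x /= ->].
  have e : cp_pair_res k (cp_pair_res h x) = cp_pair_res l x.
    case: x => a g; rewrite /cp_pair_res (@ares_comp X R U _ V W Z h k l).
    by rewrite (@psres_comp X U _ V W Z h k l).
  pose r S := [set z | exists2 y, S y & cp_class (cp_pair_res k y) z].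
  transitivity (cp_class (cp_pair_res l x)); last exact/esym/cp_res_class.
  exact: etrans (congr1 r (cp_res_class h x))
    (etrans (cp_res_class k _) (congr1 (@cp_class Z) e)).
Defined.

End ContractedProduct.

Section Description.
Variables (X : topologicalType) (R : ring_sheaf X) (D : algebroid_data R).
Notation P := (ad_P D).
Notation Phi := (ad_Phi D).

Definition alg_glob (U : opens X) (p : P U) : pzRingType :=
  alg_of Phi p (stop U).

Definition alg_glob_map (U : opens X) (p' p : P U) (g : 'Hom_P(p', p)) :
  alg_glob p' -> alg_glob p := alg_map Phi g (stop U).

Definition alg_glob_res (U V : opens X) (h : V `<=` U) (p : P U)
    (a : alg_glob p) : alg_glob (p ↾ h) :=
  alg_in Phi h p (stop V)
    (ares (alg_of Phi p) (V := stop U) (W := widen h (stop V)) h a).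

Definition ell_glob (U : opens X) (p : P U) (f : 'Hom_P(p, p)) : alg_glob p :=
  uval (ad_ell (p := p) (V := stop U) (pres incl_refl f)).

Variables (A0 : prestack_on P) (L0 : linear_structure R (Prestack A0)).

(* [br U p' p a g] is the class [a, g].  Morphisms of A0 are sections of the
   associated sheaf, hence only locally of this form; the formulas hold over
   every open subset and so determine the structure of A0.  Objects and their
   restrictions are those of P, by the type of [A0]. *)
Record is_A0 (br : forall (U : opens X) (p' p : P U),
    alg_glob p -> 'Hom_P(p', p) -> hom_lmod L0 p' p) : Prop := IsA0 {
  A0_hom : forall (U : opens X) (p' p : P U),
    exists2 eta : presheaf_map (contracted p' p)
        (@hom_presheaf X (Prestack A0) U p' p),
      forall (V : sub_open U) (a : alg_of Phi p V) (g : hom_presheaf p' p V),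
        eta V (cp_mk a g)
        = br V (p' ↾ sincl V) (p ↾ sincl V) (alg_in Phi (sincl V) p (stop V) a) g
      & associated_sheaf eta;
  A0_comp : forall (U : opens X) (p'' p' p : P U) (a : alg_glob p)
    (g : 'Hom_P(p', p)) (a' : alg_glob p') (g' : 'Hom_P(p'', p')),
    ccomp (c := pcat A0 U) (br U p' p a g) (br U p'' p' a' g')
    = br U p'' p (a * alg_glob_map g a') (g ∘ g');
  A0_scale : forall (U : opens X) (p' p : P U) (r : R U) (a : alg_glob p)
    (g : 'Hom_P(p', p)),
    r *: br U p' p a g = br U p' p (astr (alg_of Phi p) (stop U) r * a) g;
  A0_add : forall (U : opens X) (p' p : P U) (a a' : alg_glob p)
    (g : iso (pcat P U) p' p) (g' : 'Hom_P(p', p)),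
    br U p' p a (fwd g) + br U p' p a' g'
    = br U p' p (a + a' * ell_glob (g' ∘ bwd g)) (fwd g);
  A0_res : forall (U V : opens X) (h : V `<=` U) (p' p : P U)
    (a : alg_glob p) (g : 'Hom_P(p', p)),
    @pres X P A0 U V h p' p (br U p' p a g)
    = br V (p' ↾ h) (p ↾ h) (alg_glob_res h a) (pres h g);
  (* the structural isomorphisms of A0 are the images of those of P *)
  A0_unit : forall (U : opens X) (h : U `<=` U) (p : P U),
    fwd (punit A0 h p) = br U (p ↾ h) p 1 (fwd (punit P h p));
  A0_assoc : forall (U V W : opens X) (h : V `<=` U) (k : W `<=` V)
    (l : W `<=` U) (p : P U),
    fwd (pcomp A0 h k l p)
    = br W (p ↾ h ↾ k) (p ↾ l) 1 (fwd (pcomp P h k l p)) }.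

End Description.

(* An isomorphism of sheaves of algebras from the sheaf of endomorphisms of q,
   with the algebra structure given by composition and by [L], to B. *)
Record end_iso (X : topologicalType) (R : ring_sheaf X) (C : prestack X)
    (L : linear_structure R C) (U : opens X) (q : C U) (B : ralg R U) :=
  EndIso {
  ei_fun : forall V : sub_open U,
    hom_lmod L (q ↾ sincl V) (q ↾ sincl V) -> B V;
  ei_bij : forall V, bijective (@ei_fun V);
  ei_res : forall (V W : sub_open U) (h : W `<=` V) (f : hom_presheaf q q V),
    ei_fun (V := W) (psres h f) = ares B h (ei_fun f);
  ei_add : forall V, {morph @ei_fun V : f g / f + g};
  ei_scale : forall (V : sub_open U) r f,
    @ei_fun V (r *: f) = astr B V r * ei_fun f;
  ei_id : forall V : sub_open U, ei_fun (V := V) (idm (q ↾ sincl V)) = 1;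
  ei_comp : forall (V : sub_open U) (f g : hom_presheaf q q V),
    @ei_fun V (f ∘ g) = ei_fun f * ei_fun g }.

(* Main.v *)
From HB Require Import structures.
From Stdlib Require Import Relation_Operators.
Require Import Defs.
From mathcomp Require Import all_boot all_order all_algebra.
From mathcomp Require Import boolp classical_sets topology.

(** The sheaf of morphisms of A0 is the contracted product of Phi(p) and
    Hom(p', p) over End(p).  A class [a, g] is the same thing as a function m on
    local morphisms k : p' -> p with values in Phi(p) such that
    m(phi k) ell(phi) = m(k): the class [a, g] corresponds to the function whose
    value at k is a ell(g k^-1), hence a at g, and m is [m(g), g] as soon as some
    g exists.  Morphisms p' -> p of P exist locally, so the functions m form
    precisely the associated sheaf, without any sheafification.  Sums and
    multiples become pointwise, and the composite m n is the only function with
    value m(g) Phi(g)(n(g')) at g g'; the axioms Ad ell = Phi and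
    ell(g phi g^-1) = Phi(g)(ell(phi)) say that this value depends on g g' only
    ([val_eq]).  Evaluation at the identity identifies the endomorphisms of p in
    A0 with Phi(p).

    Coherence is dealt with once and for all.  For objects x over U1 and y over
    U2, the morphisms over W from x restricted to W to y restricted to W form a
    presheaf in the strict sense when W varies: the structural isomorphisms
    enter only in the canonical isomorphisms between x restricted to V and x.
    [lcat] records such local morphisms; a prestack gives one ([lcat_of]), and
    conversely ([prestack_of]).  Sheaf and descent conditions and functors are
    translated accordingly ([separated_lsheaf], [lsheaf_separated],
    [descent_ldescent], [ldescent_descent], [lfun_of], [functor_of]), and all
    constructions take place among local morphisms.

    The stack associated with a separated prestack C has as objects over U the
    descent data of C on coverings of U, and as morphisms the matrices of local
    morphisms of C compatible with the transition isomorphisms; their products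
    exist by gluing ([datum_comp_ex]).  A descent datum of descent data is again
    a descent datum, for the disjoint union of the coverings
    ([datum_lcat_descent]).  The functor from C is fully faithful and every
    object is locally in its image, and these two properties imply the universal
    one ([associated_stackP]): a functor from C to a stack S is extended to q by
    gluing in S its values at the objects of C isomorphic to q locally, the
    transition isomorphisms being the images of those of q.  Linear structures
    are carried along entrywise ([stackification]). *)

Set Implicit Arguments.
Unset Strict Implicit.
Unset Printing Implicit Defensive.

Import GRing.Theory.
Local Open Scope classical_set_scope.
Local Open Scope ring_scope.
Local Open Scope cat_scope.
Local Notation pcomp := Defs.pcomp.
Local Notation compA := Defs.compA.

(** * Local morphisms *)

(** Strict calculus of morphisms between restrictions: [lh h1 h2 x y] stands for
    the morphisms over W between the restrictions to W of x over U1 and of y over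
    U2.  The restriction [lr] takes the inclusions in U1 and U2 of the smaller
    open subset as arguments, so that no lemma depends on how they are obtained.
    The isomorphisms [lcan] replace all the structural isomorphisms. *)
Record lcat (X : topologicalType) (B : obj_family X) := Lcat {
  lh : forall W U1 U2 : opens X, W `<=` U1 -> W `<=` U2 -> B U1 -> B U2 -> Type;
  lid : forall (W U : opens X) (h : W `<=` U) (x : B U), lh h h x x;
  lc : forall (W U1 U2 U3 : opens X) (h1 : W `<=` U1) (h2 : W `<=` U2)
    (h3 : W `<=` U3) (x : B U1) (y : B U2) (z : B U3),
    lh h2 h3 y z -> lh h1 h2 x y -> lh h1 h3 x z;
  lr : forall (W Z U1 U2 : opens X) (h1 : W `<=` U1) (h2 : W `<=` U2)
    (k : Z `<=` W) (l1 : Z `<=` U1) (l2 : Z `<=` U2) (x : B U1) (y : B U2),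
    lh h1 h2 x y -> lh l1 l2 x y;
  lc1m : forall (W U1 U2 : opens X) (h1 : W `<=` U1) (h2 : W `<=` U2)
    (x : B U1) (y : B U2) (f : lh h1 h2 x y), lc (lid h2 y) f = f;
  lcm1 : forall (W U1 U2 : opens X) (h1 : W `<=` U1) (h2 : W `<=` U2)
    (x : B U1) (y : B U2) (f : lh h1 h2 x y), lc f (lid h1 x) = f;
  lcA : forall (W U1 U2 U3 U4 : opens X) (h1 : W `<=` U1) (h2 : W `<=` U2)
    (h3 : W `<=` U3) (h4 : W `<=` U4) (x : B U1) (y : B U2) (z : B U3)
    (t : B U4) (f : lh h3 h4 z t) (g : lh h2 h3 y z) (e : lh h1 h2 x y),
    lc f (lc g e) = lc (lc f g) e;
  lr_id : forall (W U1 U2 : opens X) (h1 : W `<=` U1) (h2 : W `<=` U2)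
    (k : W `<=` W) (x : B U1) (y : B U2) (f : lh h1 h2 x y), lr k h1 h2 f = f;
  lr_comp : forall (W Z T U1 U2 : opens X) (h1 : W `<=` U1) (h2 : W `<=` U2)
    (k : Z `<=` W) (l1 : Z `<=` U1) (l2 : Z `<=` U2) (m : T `<=` Z)
    (q1 : T `<=` U1) (q2 : T `<=` U2) (n : T `<=` W) (x : B U1) (y : B U2)
    (f : lh h1 h2 x y), lr m q1 q2 (lr k l1 l2 f) = lr n q1 q2 f;
  lr_lid : forall (W Z U : opens X) (h : W `<=` U) (k : Z `<=` W)
    (l : Z `<=` U) (x : B U), lr k l l (lid h x) = lid l x;
  lr_lc : forall (W Z U1 U2 U3 : opens X) (h1 : W `<=` U1) (h2 : W `<=` U2)
    (h3 : W `<=` U3) (k : Z `<=` W) (l1 : Z `<=` U1) (l2 : Z `<=` U2)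
    (l3 : Z `<=` U3) (x : B U1) (y : B U2) (z : B U3)
    (f : lh h2 h3 y z) (g : lh h1 h2 x y),
    lr k l1 l3 (lc f g) = lc (lr k l2 l3 f) (lr k l1 l2 g);
  lcan : forall (U V W : opens X) (h : V `<=` U) (k : W `<=` V) (l : W `<=` U)
    (x : B U), lh k l (x ↾ h) x;
  lcanV : forall (U V W : opens X) (h : V `<=` U) (k : W `<=` V) (l : W `<=` U)
    (x : B U), lh l k x (x ↾ h);
  lcanK : forall (U V W : opens X) (h : V `<=` U) (k : W `<=` V) (l : W `<=` U)
    (x : B U), lc (lcanV h k l x) (lcan h k l x) = lid k (x ↾ h);
  lcanVK : forall (U V W : opens X) (h : V `<=` U) (k : W `<=` V)
    (l : W `<=` U) (x : B U), lc (lcan h k l x) (lcanV h k l x) = lid l x;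
  lr_lcan : forall (U V W Z : opens X) (h : V `<=` U) (k : W `<=` V)
    (l : W `<=` U) (m : Z `<=` W) (k' : Z `<=` V) (l' : Z `<=` U) (x : B U),
    lr m k' l' (lcan h k l x) = lcan h k' l' x }.

Arguments lid {X B} _ {W U}.
Arguments lc {X B L W U1 U2 U3 h1 h2 h3 x y z} f g : rename.
Arguments lr {X B L W Z U1 U2 h1 h2} k l1 l2 {x y} f : rename.
Arguments lcan {X B} _ {U V W}.
Arguments lcanV {X B} _ {U V W}.
Notation "f ⊚ g" := (lc f g) (at level 40, left associativity) : cat_scope.

Section LocalCalculus.
Variables (X : topologicalType) (B : obj_family X) (L : lcat B).
Implicit Types U V W Z T : opens X.

Lemma lr_lr W Z T U1 U2 (h1 : W `<=` U1) (h2 : W `<=` U2) (n : T `<=` W)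
    (k : Z `<=` W) (l1 : Z `<=` U1) (l2 : Z `<=` U2) (m : T `<=` Z)
    (q1 : T `<=` U1) (q2 : T `<=` U2) (x : B U1) (y : B U2)
    (f : lh L h1 h2 x y) : lr m q1 q2 (lr k l1 l2 f) = lr n q1 q2 f.
Proof. exact: lr_comp. Qed.

Lemma lcK W U1 U2 U3 (h1 : W `<=` U1) (h2 : W `<=` U2) (h3 : W `<=` U3)
    (x : B U1) (y : B U2) (z : B U3) (f : lh L h2 h3 y z) (g : lh L h3 h2 z y)
    (e : lh L h1 h2 x y) :
  g ⊚ f = lid L h2 y -> g ⊚ (f ⊚ e) = e.
Proof. by move=> gf; rewrite lcA gf lc1m. Qed.

Lemma lcKr W U1 U2 U3 (h1 : W `<=` U1) (h2 : W `<=` U2) (h3 : W `<=` U3)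
    (x : B U1) (y : B U2) (z : B U3) (f : lh L h2 h3 y z) (g : lh L h3 h2 z y)
    (e : lh L h2 h1 y x) :
  g ⊚ f = lid L h2 y -> e ⊚ g ⊚ f = e.
Proof. by move=> gf; rewrite -lcA gf lcm1. Qed.

Lemma lcanKl W U V U1 (h : V `<=` U) (k : W `<=` V) (l : W `<=` U)
  (h1 : W `<=` U1) (x : B U) (y : B U1) (f : lh L h1 k y (x ↾ h)) :
  lcanV L h k l x ⊚ (lcan L h k l x ⊚ f) = f.
Proof. by apply: lcK; rewrite lcanK. Qed.

Lemma lcanVKl W U V U1 (h : V `<=` U) (k : W `<=` V) (l : W `<=` U)
  (h1 : W `<=` U1) (x : B U) (y : B U1) (f : lh L h1 l y x) :
  lcan L h k l x ⊚ (lcanV L h k l x ⊚ f) = f.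
Proof. by apply: lcK; rewrite lcanVK. Qed.

Lemma lcanKr W U V U1 (h : V `<=` U) (k : W `<=` V) (l : W `<=` U)
  (h1 : W `<=` U1) (x : B U) (y : B U1) (f : lh L k h1 (x ↾ h) y) :
  f ⊚ lcanV L h k l x ⊚ lcan L h k l x = f.
Proof. by apply: lcKr; rewrite lcanK. Qed.

Lemma lcanVKr W U V U1 (h : V `<=` U) (k : W `<=` V) (l : W `<=` U)
  (h1 : W `<=` U1) (x : B U) (y : B U1) (f : lh L l h1 x y) :
  f ⊚ lcan L h k l x ⊚ lcanV L h k l x = f.
Proof. by apply: lcKr; rewrite lcanVK. Qed.

Lemma lr_lcanV U V W Z (h : V `<=` U) (k : W `<=` V)
    (l : W `<=` U) (m : Z `<=` W) (k' : Z `<=` V) (l' : Z `<=` U) (x : B U) :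
  lr m l' k' (lcanV L h k l x) = lcanV L h k' l' x.
Proof.
rewrite -[LHS](lcanKl l') -(lr_lcan L h k l m k' l' x).
by rewrite -lr_lc lcanVK lr_lid lcm1.
Qed.

Definition pcat_of U : category (B U) :=
  @Category (B U) (fun x y => lh L (@incl_refl X U) incl_refl x y)
    (fun x => lid L incl_refl x) (fun x y z f g => f ⊚ g)
    (fun x y f => lc1m f) (fun x y f => lcm1 f)
    (fun x y z t f g h => lcA f g h).

(** The same local morphism, seen between x and y or between their restrictions
    to V1 and V2. *)
Section Transport.
Variables (W U1 U2 V1 V2 : opens X) (h1 : V1 `<=` U1) (h2 : V2 `<=` U2).
Variables (k1 : W `<=` V1) (k2 : W `<=` V2) (l1 : W `<=` U1) (l2 : W `<=` U2).
Variables (x : B U1) (y : B U2).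

Definition ldown (f : lh L l1 l2 x y) : lh L k1 k2 (x ↾ h1) (y ↾ h2) :=
  lcanV L h2 k2 l2 y ⊚ f ⊚ lcan L h1 k1 l1 x.

Definition lup (f : lh L k1 k2 (x ↾ h1) (y ↾ h2)) : lh L l1 l2 x y :=
  lcan L h2 k2 l2 y ⊚ f ⊚ lcanV L h1 k1 l1 x.

Lemma ldownK : cancel ldown lup.
Proof. by move=> f; rewrite /lup /ldown !lcA lcanVKr lcanVK lc1m. Qed.

Lemma lupK : cancel lup ldown.
Proof. by move=> f; rewrite /lup /ldown !lcA lcanKr lcanK lc1m. Qed.

End Transport.

Lemma ldown_id W U V (h : V `<=` U) (k : W `<=` V) (l : W `<=` U) (x : B U) :
  ldown h h k k (lid L l x) = lid L k (x ↾ h).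
Proof. by rewrite /ldown lcm1 lcanK. Qed.

Lemma ldown_comp W U1 U2 U3 V1 V2 V3 (h1 : V1 `<=` U1) (h2 : V2 `<=` U2)
    (h3 : V3 `<=` U3) (k1 : W `<=` V1) (k2 : W `<=` V2) (k3 : W `<=` V3)
    (l1 : W `<=` U1) (l2 : W `<=` U2) (l3 : W `<=` U3)
    (x : B U1) (y : B U2) (z : B U3)
    (f : lh L l2 l3 y z) (g : lh L l1 l2 x y) :
  ldown h1 h3 k1 k3 (f ⊚ g) = ldown h2 h3 k2 k3 f ⊚ ldown h1 h2 k1 k2 g.
Proof. by rewrite /ldown -!lcA lcanVKl. Qed.

Lemma lr_down W Z U1 U2 V1 V2 (h1 : V1 `<=` U1) (h2 : V2 `<=` U2)
    (k1 : W `<=` V1) (k2 : W `<=` V2) (l1 : W `<=` U1) (l2 : W `<=` U2)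
    (m : Z `<=` W) (k1' : Z `<=` V1) (k2' : Z `<=` V2)
    (l1' : Z `<=` U1) (l2' : Z `<=` U2) (x : B U1) (y : B U2)
    (f : lh L l1 l2 x y) :
  lr m k1' k2' (ldown h1 h2 k1 k2 f) = ldown h1 h2 k1' k2' (lr m l1' l2' f).
Proof.
rewrite /ldown (lr_lc _ k1' l1' k2') (lr_lc _ l1' l2' k2').
by rewrite lr_lcan lr_lcanV.
Qed.

(** A morphism is restricted as a local morphism, then its source and target are
    replaced by their restrictions. *)
Definition pres_of U V (h : V `<=` U) (x y : B U)
  (f : chom (pcat_of U) x y) : chom (pcat_of V) (x ↾ h) (y ↾ h) :=
  ldown h h incl_refl incl_refl (lr h h h f).

Definition punit_of U (h : U `<=` U) (x : B U) : iso (pcat_of U) (x ↾ h) x :=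
  @Iso _ (pcat_of U) (x ↾ h) x (lcan L h incl_refl incl_refl x)
    (lcanV L h incl_refl incl_refl x)
    (lcanK _ _ _ _ _) (lcanVK _ _ _ _ _).

Definition pcomp_of U V W (h : V `<=` U) (k : W `<=` V) (l : W `<=` U)
  (x : B U) : iso (pcat_of W) (x ↾ h ↾ k) (x ↾ l).
Proof.
exists (ldown k l incl_refl incl_refl (lcan L h k l x))
  (ldown l k incl_refl incl_refl (lcanV L h k l x)).
- by rewrite [LHS]/= -ldown_comp lcanK ldown_id.
- by rewrite [LHS]/= -ldown_comp lcanVK ldown_id.
Defined.

Definition prestack_of : prestack_on B.
Proof.
exists pcat_of pres_of punit_of pcomp_of.
- by move=> U V h x; rewrite /pres_of /= lr_lid ldown_id.
- move=> U V h x y z f g; rewrite /pres_of /= (lr_lc h h h).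
  by rewrite (ldown_comp h h h incl_refl incl_refl).
- move=> U h; have -> : h = incl_refl by exact: Prop_irrelevance.
  move=> x y f; rewrite /= /pres_of /ldown.
  by rewrite lr_id -!lcA lcanVKl.
- move=> U V W h k l x y f; rewrite /= /pres_of (lr_down _ _ _ _ _ _ _ l l).
  rewrite -!ldown_comp (lr_lr l); congr ldown.
  by rewrite /ldown -!lcA lcanVKl.
- by move=> U V h k x; rewrite /= /pres_of lr_lcan.
- move=> U V h k; have -> : k = incl_refl by exact: Prop_irrelevance.
  by move=> x; rewrite /= /ldown lcanK lc1m.
- move=> U V W Z h k m l n q x.
  rewrite /= /pres_of (lr_down _ _ _ _ _ _ _ n q) lr_lcan -!ldown_comp.
  by congr ldown; rewrite /ldown -!lcA lcanVKl.
Defined.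

Lemma lr_up W Z U1 U2 V1 V2 (h1 : V1 `<=` U1) (h2 : V2 `<=` U2)
    (k1 : W `<=` V1) (k2 : W `<=` V2) (l1 : W `<=` U1) (l2 : W `<=` U2)
    (m : Z `<=` W) (k1' : Z `<=` V1) (k2' : Z `<=` V2)
    (l1' : Z `<=` U1) (l2' : Z `<=` U2) (x : B U1) (y : B U2)
    (f : lh L k1 k2 (x ↾ h1) (y ↾ h2)) :
  lr m l1' l2' (lup l1 l2 f) = lup l1' l2' (lr m k1' k2' f).
Proof.
rewrite /lup (lr_lc _ l1' k1' l2') (lr_lc _ k1' k2' l2').
by rewrite lr_lcan lr_lcanV.
Qed.

Lemma lup_comp W U1 U2 U3 V1 V2 V3 (h1 : V1 `<=` U1) (h2 : V2 `<=` U2)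
    (h3 : V3 `<=` U3) (k1 : W `<=` V1) (k2 : W `<=` V2) (k3 : W `<=` V3)
    (l1 : W `<=` U1) (l2 : W `<=` U2) (l3 : W `<=` U3)
    (x : B U1) (y : B U2) (z : B U3)
    (f : lh L k2 k3 (y ↾ h2) (z ↾ h3)) (g : lh L k1 k2 (x ↾ h1) (y ↾ h2)) :
  lup l1 l3 (f ⊚ g) = lup l2 l3 f ⊚ lup l1 l2 g.
Proof. by rewrite /lup -!lcA lcanKl. Qed.

Lemma lup_id W U V (h : V `<=` U) (k : W `<=` V) (l : W `<=` U) (x : B U) :
  lup l l (lid L k (x ↾ h)) = lid L l x.
Proof. by rewrite /lup lcm1 lcanVK. Qed.

Lemma lr_inv W Z U1 U2 (h1 : W `<=` U1) (h2 : W `<=` U2) (k : Z `<=` W)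
    (l1 : Z `<=` U1) (l2 : Z `<=` U2) (x : B U1) (y : B U2)
    (f : lh L h1 h2 x y) (g : lh L h2 h1 y x) :
  g ⊚ f = lid L h1 x -> lr k l2 l1 g ⊚ lr k l1 l2 f = lid L l1 x.
Proof. by move=> gf; rewrite -lr_lc gf lr_lid. Qed.

End LocalCalculus.

Section LcatOf.
Variables (X : topologicalType) (C : prestack X).

(** [lres] is strictly functorial because it is conjugated by the structural
    isomorphisms to the restrictions from the open subsets where the objects
    live. *)
Definition lcat_of : lcat C.
Proof.
refine (@Lcat X C (fun W U1 U2 h1 h2 x y => 'Hom_C(x ↾ h1, y ↾ h2))
  (fun W U h x => idm (x ↾ h)) (fun W U1 U2 U3 h1 h2 h3 x y z f g => f ∘ g)
  (fun W Z U1 U2 h1 h2 k l1 l2 x y f => lres k l1 l2 f)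
  _ _ _ _ _ _ _
  (fun U V W h k l x => fwd (pcomp C h k l x))
  (fun U V W h k l x => bwd (pcomp C h k l x)) _ _ _).
- by move=> *; exact: comp1m.
- by move=> *; exact: compm1.
- by move=> *; exact: compA.
- by move=> *; exact: lres_id.
- by move=> *; exact: lres_comp.
- by move=> W Z U h k l x; rewrite /lres pres_id compm1 bwdK.
- move=> W Z U1 U2 U3 h1 h2 h3 k l1 l2 l3 x y z f g.
  by rewrite /lres pres_comp !compA -(compA _ (bwd _)) fwdK compm1.
- by move=> *; exact: fwdK.
- by move=> *; exact: bwdK.
- move=> U V W Z h k l m k' l' x; rewrite /lres.
  by rewrite (pcomp_assoc C h k m l k' l') -compA bwdK compm1.
Defined.

End LcatOf.

(** * Sheaves of local morphisms *)

Section Glue.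
Variables (X : topologicalType) (J : Type) (o : J -> opens X) (S : J -> Type).
Variable rs : forall V W : J, o W `<=` o V -> S V -> S W.
Hypothesis rsP : sheaf_axiom rs.

(** Gluing for a relation instead of a family: it suffices to specify which
    sections over which open subsets are the right ones.  The covering is
    indexed by all of them. *)
Lemma glue (V : J) (Q : forall W : J, o W `<=` o V -> S W -> Prop) :
  (forall v, (o V : set X) v -> exists W (k : o W `<=` o V) s, (o W : set X) v /\ Q W k s) ->
  (forall W W' k k' s s', Q W k s -> Q W' k' s' ->
     forall Z (z : o Z `<=` o W) (z' : o Z `<=` o W'), rs z s = rs z' s') ->
  exists t : S V, forall W k s, Q W k s -> rs k t = s.
Proof.
move=> Qex Qeq.
pose I := {W : J & {k : o W `<=` o V & {s : S W | Q W k s}}}.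
pose K (i : I) : o (projT1 i) `<=` o V := projT1 (projT2 i).
have cov : o V `<=` \bigcup_i o (@projT1 _ _ (i : I)).
  move=> v /Qex [W [k [s [Wv Qs]]]].
  by exists (existT _ W (existT _ k (exist _ s Qs))).
have [|t [tP _]] := rsP K cov (s := fun i : I => sval (projT2 (projT2 i))).
  by move=> [W [k [s Qs]]] [W' [k' [s' Qs']]] Z /= z z'; exact: Qeq Qs Qs' _ _ _.
exists t => W k s Qs.
exact: (tP (existT _ W (existT _ k (exist _ s Qs)))).
Qed.

Hypothesis rs_comp : forall (V W Z : J) (h : o W `<=` o V) (k : o Z `<=` o W)
  (l : o Z `<=` o V) s, rs k (rs h s) = rs l s.

Lemma glue_uniq (V : J) (s t : S V) :
  (forall v, (o V : set X) v -> exists W (k : o W `<=` o V),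
     (o W : set X) v /\ rs k s = rs k t) -> s = t.
Proof.
move=> st.
pose I := {W : J & {k : o W `<=` o V | rs k s = rs k t}}.
pose K (i : I) : o (projT1 i) `<=` o V := sval (projT2 i).
have cov : o V `<=` \bigcup_i o (@projT1 _ _ (i : I)).
  by move=> v /st [W [k [Wv e]]]; exists (existT _ W (exist _ k e)).
have [|u [_ uu]] := rsP K cov (s := fun i : I => rs (K i) s).
  move=> i j Z z z'; have l : o Z `<=` o V by move=> x /z /K.
  by rewrite !(rs_comp _ _ l).
by rewrite -(uu s) // -(uu t) // => -[W [k e]].
Qed.

End Glue.

(** The open subsets contained in both U1 and U2 index the sheaf of local
    morphisms between an object over U1 and one over U2, as the conditions are
    stated for arbitrary index types. *)
Record sub_open2 (X : topologicalType) (U1 U2 : opens X) := SubOpen2 {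
  s2open :> opens X;
  s2l : s2open `<=` U1;
  s2r : s2open `<=` U2 }.
Arguments s2l {X U1 U2} s t _.
Arguments s2r {X U1 U2} s t _.

Definition lsheaf (X : topologicalType) (B : obj_family X) (L : lcat B) :=
  forall (U1 U2 : opens X) (x : B U1) (y : B U2),
  sheaf_axiom (o := @s2open X U1 U2) (S := fun V => lh L (s2l V) (s2r V) x y)
    (fun V W (k : W `<=` V) f => lr k (s2l W) (s2r W) f).

Section LocalGlue.
Variables (X : topologicalType) (B : obj_family X) (L : lcat B).
Hypothesis Lsh : lsheaf L.
Implicit Types U V W Z : opens X.

Lemma lglue U1 U2 V (h1 : V `<=` U1) (h2 : V `<=` U2) (x : B U1) (y : B U2)
    (Q : forall W (k : W `<=` V) (l1 : W `<=` U1) (l2 : W `<=` U2),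
      lh L l1 l2 x y -> Prop) :
  (forall v, (V : set X) v -> exists W k l1 l2 f, (W : set X) v /\ Q W k l1 l2 f) ->
  (forall W W' k k' l1 l2 l1' l2' f f', Q W k l1 l2 f -> Q W' k' l1' l2' f' ->
     forall Z (z : Z `<=` W) (z' : Z `<=` W') m1 m2,
     lr z m1 m2 f = lr z' m1 m2 f') ->
  exists t : lh L h1 h2 x y, forall W k l1 l2 f, Q W k l1 l2 f ->
    lr k l1 l2 t = f.
Proof.
move=> Qex Qeq; pose V' := SubOpen2 h1 h2.
have [v|W W' k k' s s' Qs Qs' Z z z'|t tP] :=
    @glue X _ _ _ _ (@Lsh U1 U2 x y) V'
      (fun (W : sub_open2 U1 U2) k s => Q W k (s2l W) (s2r W) s).
- move=> /Qex [W [k [l1 [l2 [f [Wv Qf]]]]]].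
  by exists (SubOpen2 l1 l2), k, f.
- exact: Qeq Qs Qs' _ _ _ _ _.
exists t => W k l1 l2 f; exact: (tP (SubOpen2 l1 l2)).
Qed.

Lemma lsep U1 U2 V (h1 : V `<=` U1) (h2 : V `<=` U2) (x : B U1) (y : B U2)
    (f g : lh L h1 h2 x y) :
  (forall v, (V : set X) v -> exists W (k : W `<=` V) l1 l2,
    (W : set X) v /\ lr k l1 l2 f = lr k l1 l2 g) -> f = g.
Proof.
move=> fg; pose V' := SubOpen2 h1 h2.
apply: (@glue_uniq X _ _ _ _ (@Lsh U1 U2 x y) _ V' f g) => [A C D h k l s|v].
  exact: lr_comp.
move=> /fg [W [k [l1 [l2 [Wv e]]]]].
by exists (SubOpen2 l1 l2), k.
Qed.

End LocalGlue.

(** Separation concerns objects over the same open subset; objects over U1 and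
    U2 are compared after restriction to the open subset where one glues. *)
Lemma separated_lsheaf (X : topologicalType) (C : prestack X) :
  separated_prestack C -> lsheaf (lcat_of C).
Proof.
move=> Csep U1 U2 x y V I D DV cov s sP.
pose L := lcat_of C.
pose x' := x ↾ s2l V; pose y' := y ↾ s2r V.
pose D' i : sub_open V := SubOpen (DV i).
pose s' i : hom_presheaf x' y' (D' i) := ldown (L := L) _ _ _ _ (s i).
have [|t [tP tU]] := Csep V x' y' (stop V) I D' DV cov s'.
  move=> i j W Wi Wj.
  pose l1 := incl_trans (s2l V) (sincl W); pose l2 := incl_trans (s2r V) (sincl W).
  have e k (Wk : W `<=` D k) := lr_down (L := L) (s2l V) (s2r V) (sincl (D' k))
    (sincl (D' k)) Wk (sincl W) (sincl W) l1 l2 (s k).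
  rewrite [LHS]e [RHS]e.
  exact: (congr1 (@ldown X C L W U1 U2 V V (s2l V) (s2r V) (sincl W) (sincl W)
    l1 l2 x y) (sP i j (SubOpen2 l1 l2) Wi Wj)).
have {}tP i : lr (L := L) (DV i) (DV i) (DV i) (t : lh L incl_refl incl_refl x' y')
    = s' i by exact: (tP i).
exists (lup (L := L) (s2l V) (s2r V) t); split.
  move=> i; rewrite (lr_up (L := L) _ _ _ (DV i) (DV i)).
  by rewrite tP ldownK.
move=> t' t'P.
rewrite (tU (ldown (L := L) (s2l V) (s2r V) incl_refl incl_refl t')) ?ldownK//.
move=> i.
apply: (etrans (lr_down (L := L) (s2l V) (s2r V) incl_refl incl_refl (DV i) (DV i)
  (DV i) (s2l (D i)) (s2r (D i)) t')).
exact: (congr1 (@ldown X C L (D i) U1 U2 V V (s2l V) (s2r V) (DV i) (DV i)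
    (s2l (D i)) (s2r (D i)) x y) (t'P i)).
Qed.

(** * Separation and descent *)

Section PrestackOf.
Variables (X : topologicalType) (B : obj_family X) (L : lcat B).
Implicit Types U V W Z : opens X.
Let C := Prestack (prestack_of L).

Lemma lres_down U1 U2 V W (x : B U1) (y : B U2) (h1 : V `<=` U1)
    (h2 : V `<=` U2) (k : W `<=` V) (l1 : W `<=` U1) (l2 : W `<=` U2)
    (f : lh L h1 h2 x y) :
  lres (C := C) k l1 l2 (ldown h1 h2 incl_refl incl_refl f)
  = ldown l1 l2 incl_refl incl_refl (lr k l1 l2 f).
Proof.
rewrite /lres /= /pres_of (lr_down _ _ _ _ _ _ _ l1 l2) -!ldown_comp.
congr ldown; exact: ldownK.
Qed.

Lemma lsheaf_separated : lsheaf L -> separated_prestack C.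
Proof.
move=> Lsh U p' p V I D DV cov s sP.
pose up (W : sub_open U) (f : hom_presheaf (C := C) p' p W) :
  lh L (sincl W) (sincl W) p' p := lup (L := L) (sincl W) (sincl W) f.
pose dn (W : sub_open U) (f : lh L (sincl W) (sincl W) p' p) :
  hom_presheaf (C := C) p' p W := ldown (sincl W) (sincl W) incl_refl incl_refl f.
have upK (W : sub_open U) : cancel (@up W) (@dn W) by exact: lupK.
have dnK (W : sub_open U) : cancel (@dn W) (@up W) by exact: ldownK.
have resE (W Z : sub_open U) (k : Z `<=` W) f :
    psres k (dn W f) = dn Z (lr k (sincl Z) (sincl Z) f).
  exact: lres_down.
pose D2 i := SubOpen2 (sincl (D i)) (sincl (D i)).
have [i j W Wi Wj|t [tP tU]] := Lsh U U p' p (SubOpen2 (sincl V) (sincl V)) I D2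
    DV cov (fun i => up (D i) (s i)).
  rewrite (_ : s2r W = s2l W); last exact: Prop_irrelevance.
  pose W' := SubOpen (s2l W).
  apply: (can_inj (@dnK W')).
  by rewrite -!(resE _ W') !upK; exact: sP.
exists (dn V t); split=> [i|t' t'P].
  by rewrite resE (tP i : lr _ _ _ t = _) upK.
rewrite (tU (up V t')) ?upK// => i; rewrite -[RHS]dnK.
apply: (can_inj (@dnK (D i))) => /=.
by rewrite -(resE V (D i)) !upK t'P.
Qed.

End PrestackOf.

(** Descent when the transition isomorphisms are given on all open subsets of
    the overlaps at once: no isomorphism of coherence is left in the cocycle
    condition. *)
Definition ldescent (X : topologicalType) (B : obj_family X) (L : lcat B) :=
  forall (U : opens X) (I : Type) (V : I -> opens X) (VU : forall i, V i `<=` U),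
  U `<=` \bigcup_i V i ->
  forall (p : forall i, B (V i))
    (t : forall i j (W : opens X) (hi : W `<=` V i) (hj : W `<=` V j),
      lh L hj hi (p j) (p i)),
  (forall i j (W Z : opens X) (hi : W `<=` V i) (hj : W `<=` V j) (k : Z `<=` W)
    (li : Z `<=` V i) (lj : Z `<=` V j),
    lr k lj li (t i j W hi hj) = t i j Z li lj) ->
  (forall i (W : opens X) (h : W `<=` V i), t i i W h h = lid L h (p i)) ->
  (forall i j k (W : opens X) (hi : W `<=` V i) (hj : W `<=` V j)
    (hk : W `<=` V k), t i j W hi hj ⊚ t j k W hj hk = t i k W hi hk) ->
  exists (q : B U)
    (a : forall i (W : opens X) (h : W `<=` V i) (l : W `<=` U), lh L l h q (p i))
    (b : forall i (W : opens X) (h : W `<=` V i) (l : W `<=` U), lh L h l (p i) q),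
  [/\ forall i (W Z : opens X) (h : W `<=` V i) (l : W `<=` U) (k : Z `<=` W)
        (h' : Z `<=` V i) (l' : Z `<=` U), lr k l' h' (a i W h l) = a i Z h' l',
      forall i (W : opens X) (h : W `<=` V i) (l : W `<=` U),
        b i W h l ⊚ a i W h l = lid L l q,
      forall i (W : opens X) (h : W `<=` V i) (l : W `<=` U),
        a i W h l ⊚ b i W h l = lid L h (p i)
    & forall i j (W : opens X) (hi : W `<=` V i) (hj : W `<=` V j) (l : W `<=` U),
        t i j W hi hj ⊚ a j W hj l = a i W hi l].

Section Descent.
Variables (X : topologicalType).
Implicit Types U V W Z : opens X.

Lemma descent_ldescent (S : prestack X) : descent S -> ldescent (lcat_of S).
Proof.
move=> Sd U I V VU cov p t tres tid tcomp.
pose L := lcat_of S.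
pose V' i : sub_open U := SubOpen (VU i).
pose M i j := meet_open (V i) (V j).
have tK i j W hi hj : t i j W hi hj ∘ t j i W hj hi = idm (p i ↾ hi).
  by rewrite [LHS]tcomp tid.
pose t' i j : iso (pcat S (M i j)) (p j ↾ @incl_meetr _ (V' i) (V' j))
    (p i ↾ @incl_meetl _ (V' i) (V' j)) :=
  Iso (t i j (M i j) _ _) (t j i (M i j) _ _) (tK _ _ _ _ _) (tK _ _ _ _ _).
have [|q [al alP]] := Sd U I V' cov p t'.
  move=> i j k W Wi Wj Wk Wij Wjk Wik.
  have e i' j' hi hj (m : W `<=` M i' j') :
      lres m hj hi (fwd (t' i' j')) = t i' j' W hi hj by exact: tres.
  by rewrite !e; exact: tcomp.
exists q.
pose a i W (h : W `<=` V i) (l : W `<=` U) : lh L l h q (p i) :=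
  pres h (fwd (al i)) ∘ bwd (pcomp S (VU i) h l q).
pose b i W (h : W `<=` V i) (l : W `<=` U) : lh L h l (p i) q :=
  fwd (pcomp S (VU i) h l q) ∘ pres h (bwd (al i)).
exists a, b.
have ab i W h l : a i W h l ⊚ b i W h l = lid L h (p i).
  rewrite /a /b /= !compA -(compA _ (bwd _) (fwd _)) fwdK compm1.
  by rewrite -pres_comp bwdK pres_id.
have ares i W Z h l (k : Z `<=` W) h' l' :
    lr k l' h' (a i W h l) = a i Z h' l'.
  rewrite /a /= /lres pres_comp.
  rewrite compA (pcomp_nat h k h').
  apply: (@fwd_epi _ _ _ _ _ (pcomp S l k l' q)).
  rewrite -!compA fwdK compm1; congr (_ ∘ _).
  apply: (@fwd_inj _ _ _ _ _ (pcomp S (VU i) h' l' q)).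
  rewrite bwdKf !compA -(pcomp_assoc S (VU i) h k l h' l' q).
  by rewrite -compA -pres_comp bwdK pres_id compm1.
split=> // [i W h l|i j W hi hj l].
  rewrite /a /b /= !compA -(compA _ (pres h (bwd _)) (pres h _)).
  by rewrite -pres_comp fwdK pres_id compm1 bwdK.
have k : W `<=` M i j by move=> x Wx; split; [exact: hi|exact: hj].
pose lM : M i j `<=` U := incl_trans (VU i) (@incl_meetl _ (V i) (V j)).
rewrite -(tres i j (M i j) W (@incl_meetl _ (V i) (V j)) (@incl_meetr _ (V i) (V j)) k).
rewrite -(ares i (M i j) W (@incl_meetl _ (V i) (V j)) lM k).
rewrite -(ares j (M i j) W (@incl_meetr _ (V i) (V j)) lM k).
rewrite -lr_lc; congr lr; rewrite /a /= compA.
rewrite [X in X ∘ _](alP i j lM).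
by rewrite -!compA bwdK compm1.
Qed.

Lemma ldescent_descent (B : obj_family X) (L : lcat B) :
  ldescent L -> descent (Prestack (prestack_of L)).
Proof.
move=> Ld U I V cov p t tcomp.
pose M i j := meet_open (V i) (V j).
pose mk i j W (hi : W `<=` V i) (hj : W `<=` V j) : W `<=` M i j :=
  fun x Wx => conj (hi x Wx) (hj x Wx).
pose T0 i j := lup (L := L) (@incl_meetr _ (V i) (V j)) (@incl_meetl _ (V i) (V j))
  (fwd (t i j)).
pose T1 i j := lup (L := L) (@incl_meetl _ (V i) (V j)) (@incl_meetr _ (V i) (V j))
  (bwd (t i j)).
pose T i j W hi hj := lr (mk i j W hi hj) hj hi (T0 i j).
have T0E i j : fwd (t i j) = ldown (@incl_meetr _ (V i) (V j))
    (@incl_meetl _ (V i) (V j)) incl_refl incl_refl (T0 i j).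
  by rewrite /T0 lupK.
have lrT i j W hi hj (m : W `<=` M i j) : lres (C := Prestack (prestack_of L)) m hj hi (fwd (t i j))
    = ldown hj hi incl_refl incl_refl (T i j W hi hj).
  by rewrite T0E lres_down (Prop_irrelevance m (mk i j W hi hj)).
have Tcomp i j k W hi hj hk : T i j W hi hj ⊚ T j k W hj hk = T i k W hi hk.
  apply: (can_inj (@ldownK _ _ _ _ _ _ _ _ _ _ incl_refl incl_refl _ _ _ _)).
  rewrite (ldown_comp hk hj hi incl_refl incl_refl incl_refl).
  rewrite -!(lrT _ _ _ _ _ (mk _ _ _ _ _)); exact: tcomp.
(* an invertible idempotent is the identity *)
have Tid i W h : T i i W h h = lid L h (p i).
  have e : lr (mk i i W h h) h h (T1 i i) ⊚ T i i W h h = lid L h (p i).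
    by apply: lr_inv; rewrite -lup_comp [_ ⊚ _](fwdK (t i i)) lup_id.
  by rewrite -[LHS]lc1m -e -lcA Tcomp.
have Tres i j W Z hi hj (k : Z `<=` W) li lj :
    lr k lj li (T i j W hi hj) = T i j Z li lj by exact: lr_comp.
have [q [a [b [ares ba ab ta]]]] := Ld U I (fun i => V i) (fun i => sincl (V i)) cov p T
  Tres Tid Tcomp.
pose af i : chom (pcat_of L (V i)) (q ↾ sincl (V i)) (p i) :=
  a i (V i) incl_refl (sincl (V i)) ⊚ lcan L (sincl (V i)) incl_refl (sincl (V i)) q.
pose ag i : chom (pcat_of L (V i)) (p i) (q ↾ sincl (V i)) :=
  lcanV L (sincl (V i)) incl_refl (sincl (V i)) q ⊚ b i (V i) incl_refl (sincl (V i)).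
have afK i : ag i ∘ af i = idm _.
  by rewrite /= /af /ag !lcA (lcKr _ (ba _ _ _ _)) lcanK.
have agK i : af i ∘ ag i = idm _ by rewrite /= /af /ag !lcA lcanVKr ab.
pose al i : iso (pcat_of L (V i)) (q ↾ sincl (V i)) (p i) := Iso _ _ (afK i) (agK i).
exists q, al => i j l.
rewrite T0E /= /pres_of /af.
have e k (m : M i j `<=` V k) : lr m m m (a k (V k) incl_refl (sincl (V k)) ⊚ lcan L (sincl (V k)) incl_refl (sincl (V k)) q)
  = a k (M i j) m l ⊚ lcan L (sincl (V k)) m l q.
  by rewrite (lr_lc _ m l m) ares lr_lcan.
rewrite !e -!ldown_comp; congr ldown.
rewrite -!lcA lcanVKl !lcA -(ta i j _ _ (@incl_meetr _ (V i) (V j))).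
by rewrite /T lr_id.
Qed.
End Descent.

(** * Functors and transformations *)

(** Commuting with restrictions is a strict equality for local morphisms, so
    this structure contains no isomorphism, in contrast to functors of
    prestacks. *)
Record lfunctor (X : topologicalType) (B B' : obj_family X) (L : lcat B)
    (L' : lcat B') := Lfunctor {
  lf_ob :> forall U : opens X, B U -> B' U;
  lf : forall (W U1 U2 : opens X) (h1 : W `<=` U1) (h2 : W `<=` U2)
    (x : B U1) (y : B U2), lh L h1 h2 x y -> lh L' h1 h2 (lf_ob x) (lf_ob y);
  lf_id : forall (W U : opens X) (h : W `<=` U) (x : B U),
    lf (lid L h x) = lid L' h (lf_ob x);
  lf_comp : forall (W U1 U2 U3 : opens X) (h1 : W `<=` U1) (h2 : W `<=` U2)
    (h3 : W `<=` U3) (x : B U1) (y : B U2) (z : B U3)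
    (f : lh L h2 h3 y z) (g : lh L h1 h2 x y), lf (f ⊚ g) = lf f ⊚ lf g;
  lf_res : forall (W Z U1 U2 : opens X) (h1 : W `<=` U1) (h2 : W `<=` U2)
    (k : Z `<=` W) (l1 : Z `<=` U1) (l2 : Z `<=` U2) (x : B U1) (y : B U2)
    (f : lh L h1 h2 x y), lf (lr k l1 l2 f) = lr k l1 l2 (lf f) }.
Arguments lf_ob {X B B' L L'} _ U _.
Arguments lf {X B B' L L'} _ {W U1 U2 h1 h2 x y} _.

Definition pres_iso (X : topologicalType) (C : prestack X) (U V : opens X)
  (h : V `<=` U) (x y : C U) (i : iso (pcat C U) x y) :
  iso (pcat C V) (x ↾ h) (y ↾ h).
Proof.
exists (pres h (fwd i)) (pres h (bwd i)).
- by rewrite -pres_comp fwdK pres_id.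
- by rewrite -pres_comp bwdK pres_id.
Defined.

Section Unit.
Variables (X : topologicalType) (C : prestack X).
Implicit Types U V W Z : opens X.

Lemma lres_pres U V W (h : V `<=` U) (k : W `<=` V) (l : W `<=` U) (x y : C U)
    (f : 'Hom_C(x, y)) : lres (C := C) k l l (pres h f) = pres l f.
Proof. by rewrite /lres (pcomp_nat h k l) -compA bwdK compm1. Qed.

(** The restriction along the identity inclusion is not the identity: a local
    morphism over the whole of U differs from a morphism over U by [punit]. *)
Definition glob U (x y : C U) (f : 'Hom_C(x ↾ incl_refl, y ↾ incl_refl)) :
  'Hom_C(x, y) :=
  fwd (punit C incl_refl y) ∘ f ∘ bwd (punit C incl_refl x).

Lemma globK U (x y : C U) : cancel (@glob U x y) (@pres X C C U U incl_refl x y).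
Proof.
move=> f; apply: (@fwd_inj _ _ _ _ _ (punit C incl_refl y)).
by rewrite punit_nat /glob -!compA fwdK compm1.
Qed.

Lemma presK U (x y : C U) : cancel (@pres X C C U U incl_refl x y) (@glob U x y).
Proof. by move=> f; rewrite /glob punit_nat -compA bwdK compm1. Qed.

Lemma glob_id U (x : C U) : glob (idm (x ↾ incl_refl)) = idm x.
Proof. by rewrite /glob compm1 bwdK. Qed.

Lemma glob_comp U (x y z : C U) (f : 'Hom_C(y ↾ incl_refl, z ↾ incl_refl))
  (g : 'Hom_C(x ↾ incl_refl, y ↾ incl_refl)) : glob (f ∘ g) = glob f ∘ glob g.
Proof. by rewrite /glob -!compA fwdKf. Qed.

Lemma pres_glob U V (h : V `<=` U) (x y : C U)
    (f : 'Hom_C(x ↾ incl_refl, y ↾ incl_refl)) :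
  pres h (glob f) = lres (C := C) h h h f.
Proof. by rewrite -(lres_pres incl_refl h h) globK. Qed.

End Unit.

Section FunctorOf.
Variables (X : topologicalType) (C D : prestack X).
Implicit Types U V W Z : opens X.

Section LfunOf.
Variable F : functor C D.

Definition lfun W U1 U2 (h1 : W `<=` U1) (h2 : W `<=` U2) (x : C U1) (y : C U2)
    (f : lh (lcat_of C) h1 h2 x y) : lh (lcat_of D) h1 h2 (F U1 x) (F U2 y) :=
  fwd (fun_res F h2 y) ∘ fun_hom F f ∘ bwd (fun_res F h1 x).

Lemma lfun_fwd W U1 U2 (h1 : W `<=` U1) (h2 : W `<=` U2) (x : C U1) (y : C U2)
    (f : lh (lcat_of C) h1 h2 x y) :
  lfun f ∘ fwd (fun_res F h1 x) = fwd (fun_res F h2 y) ∘ fun_hom F f.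
Proof. by rewrite /lfun -compA fwdK compm1. Qed.

Lemma lfun_res W Z U1 U2 (h1 : W `<=` U1) (h2 : W `<=` U2) (k : Z `<=` W)
    (l1 : Z `<=` U1) (l2 : Z `<=` U2) (x : C U1) (y : C U2)
    (f : lh (lcat_of C) h1 h2 x y) :
  lfun (lr k l1 l2 f) = lr k l1 l2 (lfun f).
Proof.
apply: (@fwd_epi _ _ _ _ _ (pcomp D h1 k l1 (F U1 x))).
apply: (@fwd_epi _ _ _ _ _ (pres_iso k (fun_res F h1 x))).
apply: (@fwd_epi _ _ _ _ _ (fun_res F k (x ↾ h1))).
have e := fun_res_comp F h1 k l1 x; rewrite -compA in e.
rewrite -[LHS]compA -[LHS]compA e compA lfun_fwd -compA -fun_comp lres_fwd fun_comp.
rewrite compA -fun_res_comp -compA fun_res_nat lres_fwd !compA; congr (_ ∘ _).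
by rewrite -!compA -!pres_comp lfun_fwd.
Qed.

Definition lfun_of : lfunctor (lcat_of C) (lcat_of D).
Proof.
exists F lfun => [W U h x|W U1 U2 U3 h1 h2 h3 x y z f g|].
- by rewrite /lfun fun_id compm1 bwdK.
- by rewrite /lfun fun_comp /= !compA -[X in X ∘ _ = _]compA
    -[X in _ = X ∘ _ ∘ _]compA fwdK compm1 !compA.
- exact: lfun_res.
Defined.

Lemma lfun_pres U V (h : V `<=` U) (x y : C U) (f : 'Hom_C(x, y)) :
  lfun (pres h f : lh (lcat_of C) h h x y) = pres h (fun_hom F f).
Proof. by rewrite /lfun fun_res_nat -compA bwdK compm1. Qed.

Lemma lfun_can U V (h : V `<=` U) (x : C U) :
  lfun (lcan (lcat_of C) h incl_refl h x)
  = fwd (fun_res F h x) ∘ fwd (punit D incl_refl (F V (x ↾ h))).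
Proof.
apply: (@fwd_epi _ _ _ _ _ (fun_res F incl_refl (x ↾ h))).
by rewrite lfun_fwd -compA fun_res_unit /= pcomp_unitr.
Qed.

End LfunOf.

Section FunctorOf.
Variable phi : lfunctor (lcat_of C) (lcat_of D).

Let lf_compE W U1 U2 U3 (h1 : W `<=` U1) (h2 : W `<=` U2) (h3 : W `<=` U3)
    (x : C U1) (y : C U2) (z : C U3) (f : lh (lcat_of C) h2 h3 y z)
    (g : lh (lcat_of C) h1 h2 x y) :
  lf phi f ∘ lf phi g = lf phi (f ∘ g : lh (lcat_of C) h1 h3 x z).
Proof. exact: esym (lf_comp phi f g). Qed.

Let lf_resE W Z U1 U2 (h1 : W `<=` U1) (h2 : W `<=` U2)
    (k : Z `<=` W) (l1 : Z `<=` U1) (l2 : Z `<=` U2) (x : C U1) (y : C U2)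
    (f : lh (lcat_of C) h1 h2 x y) :
  lres k l1 l2 (lf phi f) = lf phi (lres k l1 l2 f : lh (lcat_of C) l1 l2 x y).
Proof. exact: esym (lf_res phi k l1 l2 f). Qed.

Definition fo_hom U (x y : C U) (f : 'Hom_C(x, y)) : 'Hom_D(phi U x, phi U y) :=
  glob (lf phi (pres incl_refl f : lh (lcat_of C) incl_refl incl_refl x y)).

(** The image of the canonical isomorphism between the restriction of x and x
    makes F commute with restrictions. *)
Definition fo_can U V (h : V `<=` U) (x : C U) :
  iso (pcat D V) (phi V (x ↾ h) ↾ incl_refl) (phi U x ↾ h).
Proof.
exists (lf phi (lcan (lcat_of C) h incl_refl h x))
  (lf phi (lcanV (lcat_of C) h incl_refl h x)).
- by rewrite lf_compE [X in lf phi X]fwdK [LHS](lf_id phi).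
- by rewrite lf_compE [X in lf phi X]bwdK [LHS](lf_id phi).
Defined.

Definition iso_inv (O : Type) (K : category O) (x y : O) (i : iso K x y) :
  iso K y x := Iso (bwd i) (fwd i) (bwdK i) (fwdK i).

Definition fo_res U V (h : V `<=` U) (x : C U) :
  iso (pcat D V) (phi V (x ↾ h)) (phi U x ↾ h) :=
  comp_iso (fo_can h x) (iso_inv (punit D incl_refl (phi V (x ↾ h)))).

Definition functor_of : functor C D.
Proof.
exists (lf_ob phi) fo_hom fo_res.
- by move=> U x; rewrite /fo_hom pres_id (lf_id phi) glob_id.
- by move=> U x y z f g; rewrite /fo_hom pres_comp (lf_comp phi) glob_comp.
- move=> U V h x y f; rewrite /= /fo_hom pres_glob /glob.
  rewrite !compA -[X in X ∘ _ ∘ _ = _]compA fwdK compm1; congr (_ ∘ _).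
  rewrite lf_resE lres_pres !lf_compE; congr (lf phi).
  exact: pcomp_nat.
- move=> U h; have -> : h = incl_refl by exact: Prop_irrelevance.
  move=> x; rewrite /= /fo_hom /glob -compA; congr (_ ∘ (_ ∘ _)).
  by rewrite -pcomp_unitl.
- move=> U V W h k l x; rewrite /= /fo_hom /glob !compA; congr (_ ∘ _).
  rewrite -[X in _ = X ∘ _]compA fwdK compm1 pres_comp.
  have e : pres k (bwd (punit D incl_refl (phi V (x ↾ h))))
      = bwd (pcomp D incl_refl k k (phi V (x ↾ h))).
    apply: (@fwd_inj _ _ _ _ _ (pcomp D incl_refl k k (phi V (x ↾ h)))).
    by rewrite bwdK pcomp_unitl -pres_comp bwdK pres_id.
  rewrite e compA -[X in X ∘ _ = _]/(lres k k l (lf phi (lcan (lcat_of C) h incl_refl h x))).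
  rewrite lf_resE !lf_compE; congr (lf phi).
  rewrite [X in X ∘ _](lr_lcan (lcat_of C) h incl_refl h k k l x) /=.
  by rewrite (pcomp_assoc C h k incl_refl l k l).
Defined.

Lemma lfun_functor_of W U1 U2 (h1 : W `<=` U1) (h2 : W `<=` U2) (x : C U1)
    (y : C U2) (f : lh (lcat_of C) h1 h2 x y) :
  lfun functor_of f = lf phi f.
Proof.
rewrite /lfun /= /glob !compA.
rewrite -[X in X ∘ _ ∘ _ ∘ _ ∘ _]compA fwdK compm1.
rewrite -[X in X ∘ _]compA fwdK compm1.
rewrite !lf_compE; congr (lf phi).
exact: (lres_id (C := C) incl_refl f).
Qed.

End FunctorOf.

Section Transformations.
Variables F G : functor C D.

Definition transf_of
  (t : forall W U (h : W `<=` U) (x : C U), lh (lcat_of D) h h (F U x) (G U x))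
  (t_res : forall W Z U (h : W `<=` U) (k : Z `<=` W) (l : Z `<=` U) (x : C U),
    lr k l l (t W U h x) = t Z U l x)
  (t_nat : forall W U1 U2 (h1 : W `<=` U1) (h2 : W `<=` U2) (x : C U1) (y : C U2)
    (f : lh (lcat_of C) h1 h2 x y),
    t W U2 h2 y ⊚ lfun F f = lfun G f ⊚ t W U1 h1 x) : transf F G.
Proof.
exists (fun U x => glob (t U U incl_refl x)).
- move=> U x y f; rewrite -[fun_hom F f]presK -[fun_hom G f]presK -!lfun_pres.
  by rewrite -!glob_comp; congr glob; exact: t_nat.
- move=> U V h x; rewrite pres_glob.
  have -> : lres h h h (t U U incl_refl x) = t V U h x by exact: t_res.
  apply: (@fwd_epi _ _ _ _ _ (punit D incl_refl (F V (x ↾ h)))).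
  rewrite -[RHS]compA -lfun_can.
  apply: etrans (esym (t_nat _ _ _ _ _ _ _ (lcan (lcat_of C) h incl_refl h x))).
  rewrite lfun_can /= -!compA; congr (_ ∘ _).
  by rewrite fwdK compm1.
Defined.

Lemma transf_ofK t t_res t_nat U (x : C U) :
  transf_of (t := t) t_res t_nat U x = glob (t U U incl_refl x).
Proof. by []. Qed.

Variable t : transf F G.

Lemma transf_lnat W U1 U2 (h1 : W `<=` U1) (h2 : W `<=` U2) (x : C U1) (y : C U2)
    (f : lh (lcat_of C) h1 h2 x y) :
  pres h2 (t U2 y) ∘ lfun F f = lfun G f ∘ pres h1 (t U1 x).
Proof.
apply: (@fwd_epi _ _ _ _ _ (fun_res F h1 x)).
rewrite /lfun -!compA fwdK compm1 compA -tr_res -[in RHS]tr_res fwdKf -!compA.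
by congr (_ ∘ _); exact: tr_nat.
Qed.

End Transformations.

End FunctorOf.

Lemma lfun_comp (X : topologicalType) (B C D : prestack X) (G : functor C D)
    (F : functor B C) (W U1 U2 : opens X) (h1 : W `<=` U1) (h2 : W `<=` U2)
    (x : B U1) (y : B U2) (f : lh (lcat_of B) h1 h2 x y) :
  lfun (comp_functor G F) f = lfun G (lfun F f).
Proof. by rewrite /lfun /= !fun_comp !compA. Qed.

(** * A criterion for associated stacks *)

Section GlueFamily.
Variables (X : topologicalType) (B : obj_family X) (L : lcat B).
Hypothesis Lsh : lsheaf L.
Implicit Types U V W Z T : opens X.

Lemma lglue_fam U1 U2 W (h1 : W `<=` U1) (h2 : W `<=` U2) (x : B U1) (y : B U2)
    (J : Type) (D : J -> opens X)
    (s : forall j Z (k : Z `<=` W) (kj : Z `<=` D j) (l1 : Z `<=` U1)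
      (l2 : Z `<=` U2), lh L l1 l2 x y) :
  W `<=` \bigcup_j D j ->
  (forall j Z T (k : Z `<=` W) (kj : Z `<=` D j) (l1 : Z `<=` U1) (l2 : Z `<=` U2)
    (m : T `<=` Z) (k' : T `<=` W) (kj' : T `<=` D j) (l1' : T `<=` U1)
    (l2' : T `<=` U2), lr m l1' l2' (s j Z k kj l1 l2) = s j T k' kj' l1' l2') ->
  (forall i j Z (k : Z `<=` W) (ki : Z `<=` D i) (kj : Z `<=` D j)
    (l1 : Z `<=` U1) (l2 : Z `<=` U2), s i Z k ki l1 l2 = s j Z k kj l1 l2) ->
  exists t : lh L h1 h2 x y, forall j Z (k : Z `<=` W) (kj : Z `<=` D j)
    (l1 : Z `<=` U1) (l2 : Z `<=` U2), lr k l1 l2 t = s j Z k kj l1 l2.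
Proof.
move=> cov sres seq.
have [v Wv|Z Z' k k' l1 l2 l1' l2' f f' [j [kj ->]] [j' [kj' ->]] T z z' m1 m2|t tP] :=
  @lglue X B L Lsh U1 U2 W h1 h2 x y (fun Z (k : Z `<=` W) l1 l2 f =>
    exists j (kj : Z `<=` D j), f = s j Z k kj l1 l2).
- have [j _ Dv] := cov v Wv; pose Z := meet_open W (D j).
  have l1 : Z `<=` U1 := incl_trans h1 (@incl_meetl _ W (D j)).
  have l2 : Z `<=` U2 := incl_trans h2 (@incl_meetl _ W (D j)).
  exists Z, (@incl_meetl _ W (D j)), l1, l2, (s j Z (@incl_meetl _ W (D j)) (@incl_meetr _ W (D j)) l1 l2).
  by split=> //; exists j, (@incl_meetr _ W (D j)).
- rewrite (sres j Z T k kj l1 l2 z (incl_trans k z) (incl_trans kj z)) //.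
  rewrite (sres j' Z' T k' kj' l1' l2' z' (incl_trans k z) (incl_trans kj' z')) //.
by exists t => j Z k kj l1 l2; apply: tP; exists j, kj.
Qed.

Lemma lsep_fam U1 U2 W (h1 : W `<=` U1) (h2 : W `<=` U2) (x : B U1) (y : B U2)
    (J : Type) (D : J -> opens X) (f g : lh L h1 h2 x y) :
  W `<=` \bigcup_j D j ->
  (forall j Z (k : Z `<=` W) (kj : Z `<=` D j) (l1 : Z `<=` U1) (l2 : Z `<=` U2),
    lr k l1 l2 f = lr k l1 l2 g) -> f = g.
Proof.
move=> cov fg; apply: (lsep Lsh) => v Wv.
have [j _ Dv] := cov v Wv; pose Z := meet_open W (D j).
have l1 : Z `<=` U1 := incl_trans h1 (@incl_meetl _ W (D j)).
have l2 : Z `<=` U2 := incl_trans h2 (@incl_meetl _ W (D j)).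
exists Z, (@incl_meetl _ W (D j)), l1, l2; split=> //.
exact: (fg j Z _ (@incl_meetr _ W (D j))).
Qed.

End GlueFamily.

(** Natural transformations, given by their restrictions to all open subsets. *)
Record ltransf (X : topologicalType) (B B' : obj_family X) (L : lcat B)
    (L' : lcat B') (F G : lfunctor L L') := Ltransf {
  lt : forall (W U : opens X) (h : W `<=` U) (x : B U), lh L' h h (F U x) (G U x);
  lt_res : forall (W Z U : opens X) (h : W `<=` U) (k : Z `<=` W) (l : Z `<=` U)
    (x : B U), lr k l l (lt h x) = lt l x;
  lt_nat : forall (W U1 U2 : opens X) (h1 : W `<=` U1) (h2 : W `<=` U2)
    (x : B U1) (y : B U2) (f : lh L h1 h2 x y),
    lt h2 y ⊚ lf F f = lf G f ⊚ lt h1 x }.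

Definition lfcomp (X : topologicalType) (B1 B2 B3 : obj_family X) (L1 : lcat B1)
  (L2 : lcat B2) (L3 : lcat B3) (G : lfunctor L2 L3) (F : lfunctor L1 L2) :
  lfunctor L1 L3.
Proof.
exists (fun U x => G U (F U x)) (fun W U1 U2 h1 h2 x y f => lf G (lf F f)).
- by move=> *; rewrite !lf_id.
- by move=> *; rewrite !lf_comp.
- by move=> *; rewrite !lf_res.
Defined.

Section Recognition.
Variables (X : topologicalType) (BC BA : obj_family X) (LC : lcat BC).
Variables (LA : lcat BA) (i : lfunctor LC LA).
Implicit Types U V W Z T : opens X.

(** A local presentation of q by an object of C: an isomorphism over [cdom] from
    i(p) to q. *)
Record chart U (q : BA U) := Chart {
  cdom : opens X;
  cincl : cdom `<=` U;
  cobj : BC cdom;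
  cmap : lh LA incl_refl cincl (i cdom cobj) q;
  cmapV : lh LA cincl incl_refl q (i cdom cobj);
  cmapK : cmapV ⊚ cmap = lid LA incl_refl (i cdom cobj);
  cmapVK : cmap ⊚ cmapV = lid LA cincl q }.

Hypothesis lf_bij : forall W U1 U2 (h1 : W `<=` U1) (h2 : W `<=` U2)
  (x : BC U1) (y : BC U2), bijective (@lf _ _ _ _ _ i W U1 U2 h1 h2 x y).
Hypothesis chart_ex : forall U (q : BA U) x, (U : set X) x ->
  exists c : chart q, (cdom c : set X) x.

Definition lf_inv W U1 U2 (h1 : W `<=` U1) (h2 : W `<=` U2) (x : BC U1) (y : BC U2)
  (f : lh LA h1 h2 (i U1 x) (i U2 y)) : lh LC h1 h2 x y :=
  sval (cid (let: Bijective g _ gK := lf_bij h1 h2 x y in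
    ex_intro (fun e => lf i e = f) (g f) (gK f))).

Lemma lf_invK W U1 U2 (h1 : W `<=` U1) (h2 : W `<=` U2) (x : BC U1) (y : BC U2)
  (f : lh LA h1 h2 (i U1 x) (i U2 y)) : lf i (lf_inv f) = f.
Proof. by rewrite /lf_inv; case: cid. Qed.

Lemma lf_inj W U1 U2 (h1 : W `<=` U1) (h2 : W `<=` U2) (x : BC U1) (y : BC U2) :
  injective (@lf _ _ _ _ _ i W U1 U2 h1 h2 x y).
Proof. exact: bij_inj (lf_bij h1 h2 x y). Qed.

Definition theta U (q : BA U) (c : chart q) W (k : W `<=` cdom c) (l : W `<=` U) :
  lh LA k l (i _ (cobj c)) q := lr k k l (cmap c).
Definition thetaV U (q : BA U) (c : chart q) W (k : W `<=` cdom c) (l : W `<=` U) :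
  lh LA l k q (i _ (cobj c)) := lr k l k (cmapV c).

Lemma thetaK U (q : BA U) (c : chart q) W (k : W `<=` cdom c) (l : W `<=` U) :
  thetaV k l ⊚ theta k l = lid LA k (i _ (cobj c)).
Proof. by rewrite /thetaV /theta -lr_lc cmapK lr_lid. Qed.
Lemma thetaVK U (q : BA U) (c : chart q) W (k : W `<=` cdom c) (l : W `<=` U) :
  theta k l ⊚ thetaV k l = lid LA l q.
Proof. by rewrite /thetaV /theta -lr_lc cmapVK lr_lid. Qed.
Lemma lr_theta U (q : BA U) (c : chart q) W Z (k : W `<=` cdom c) (l : W `<=` U)
  (m : Z `<=` W) (k' : Z `<=` cdom c) (l' : Z `<=` U) :
  lr m k' l' (theta k l) = theta k' l'.
Proof. exact: lr_comp. Qed.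
Lemma lr_thetaV U (q : BA U) (c : chart q) W Z (k : W `<=` cdom c) (l : W `<=` U)
  (m : Z `<=` W) (k' : Z `<=` cdom c) (l' : Z `<=` U) :
  lr m l' k' (thetaV k l) = thetaV k' l'.
Proof. exact: lr_comp. Qed.

Lemma charts_iso U (q' q : BA U) (c' : chart q') (c : chart q) W
    (k' : W `<=` cdom c') (k : W `<=` cdom c) (l : W `<=` U)
    (g : lh LC k' k (cobj c') (cobj c)) (g' : lh LC k k' (cobj c) (cobj c')) :
  g' ⊚ g = lid LC k' (cobj c') -> g ⊚ g' = lid LC k (cobj c) ->
  exists (e : lh LA l l q' q) (e' : lh LA l l q q'),
    e' ⊚ e = lid LA l q' /\ e ⊚ e' = lid LA l q.
Proof.
move=> gK gKV; exists (theta k l ⊚ lf i g ⊚ thetaV k' l), (theta k' l ⊚ lf i g' ⊚ thetaV k l).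
split; rewrite !lcA (lcKr _ (thetaK _ _)) -[X in X ⊚ _ = _]lcA -lf_comp.
  by rewrite gK lf_id lcm1 thetaVK.
by rewrite gKV lf_id lcm1 thetaVK.
Qed.

(** The expression of f in charts of its source and of its target: a local
    morphism of C, by full faithfulness.  For f the identity of q this is the
    transition between two charts of q. *)
Definition in_charts W U' U (l' : W `<=` U') (l : W `<=` U) (q' : BA U') (q : BA U)
  (f : lh LA l' l q' q) (c' : chart q') (c : chart q) (k' : W `<=` cdom c')
  (k : W `<=` cdom c) : lh LC k' k (cobj c') (cobj c) :=
  lf_inv (thetaV k l ⊚ f ⊚ theta k' l').

Lemma in_chartsP W U' U (l' : W `<=` U') (l : W `<=` U) (q' : BA U') (q : BA U)
  (f : lh LA l' l q' q) (c' : chart q') (c : chart q) (k' : W `<=` cdom c')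
  (k : W `<=` cdom c) : lf i (in_charts f k' k) = thetaV k l ⊚ f ⊚ theta k' l'.
Proof. exact: lf_invK. Qed.

Lemma in_charts_comp W U'' U' U (l'' : W `<=` U'') (l' : W `<=` U') (l : W `<=` U)
    (q'' : BA U'') (q' : BA U') (q : BA U)
    (f : lh LA l' l q' q) (g : lh LA l'' l' q'' q') (c'' : chart q'')
    (c' : chart q') (c : chart q) (k'' : W `<=` cdom c'') (k' : W `<=` cdom c')
    (k : W `<=` cdom c) :
  in_charts f k' k ⊚ in_charts g k'' k' = in_charts (f ⊚ g) k'' k.
Proof.
apply: lf_inj; rewrite (lf_comp i) !in_chartsP !lcA.
by rewrite (lcKr (thetaV k l ⊚ f) (thetaVK k' l')).
Qed.

Lemma in_charts_id W U (l : W `<=` U) (q : BA U) (c : chart q) (k : W `<=` cdom c) :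
  in_charts (lid LA l q) k k = lid LC k (cobj c).
Proof. by apply: lf_inj; rewrite (lf_id i) in_chartsP lcm1 thetaK. Qed.

Lemma lr_in_charts W Z U' U (l' : W `<=` U') (l : W `<=` U) (q' : BA U') (q : BA U)
  (f : lh LA l' l q' q) (c' : chart q') (c : chart q) (k' : W `<=` cdom c')
  (k : W `<=` cdom c) (m : Z `<=` W) (n' : Z `<=` U') (n : Z `<=` U)
  (r' : Z `<=` cdom c') (r : Z `<=` cdom c) :
  lr m r' r (in_charts f k' k) = in_charts (lr m n' n f) r' r.
Proof.
apply: lf_inj; rewrite (lf_res i) !in_chartsP (lr_lc _ r' n' r) (lr_lc _ n' n r).
by rewrite lr_theta lr_thetaV.
Qed.

Definition unit_chart U (p : BC U) : chart (i U p) :=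
  @Chart U (i U p) U incl_refl p (lid LA incl_refl _) (lid LA incl_refl _)
    (lc1m _) (lc1m _).

Lemma theta_unit W U (k : W `<=` U) (p : BC U) :
  theta (c := unit_chart p) k k = lid LA k (i U p).
Proof. by rewrite /theta lr_lid. Qed.
Lemma thetaV_unit W U (k : W `<=` U) (p : BC U) :
  thetaV (c := unit_chart p) k k = lid LA k (i U p).
Proof. by rewrite /thetaV lr_lid. Qed.

(** For q = i(p), the change of coordinates from a chart to the tautological one,
    given by p itself. *)
Definition to_unit W U (p : BC U) (c : chart (i U p)) (k : W `<=` cdom c)
  (l : W `<=` U) : lh LC k l (cobj c) p := lf_inv (theta k l).
Definition of_unit W U (p : BC U) (c : chart (i U p)) (k : W `<=` cdom c)
  (l : W `<=` U) : lh LC l k p (cobj c) := lf_inv (thetaV k l).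

Section UnitChart.
Variables (W U : opens X) (p : BC U) (c d : chart (i U p)) (k : W `<=` cdom c).
Variables (k' : W `<=` cdom d) (l : W `<=` U).

Lemma to_unit_in_charts : to_unit k l ⊚ in_charts (lid LA l (i U p)) k' k = to_unit k' l.
Proof. by apply: lf_inj; rewrite (lf_comp i) in_chartsP !lf_invK lcm1 lcA thetaVK lc1m. Qed.

Lemma in_charts_of_unit : in_charts (lid LA l (i U p)) k' k ⊚ of_unit k' l = of_unit k l.
Proof. by apply: lf_inj; rewrite (lf_comp i) in_chartsP !lf_invK lcm1 -lcA thetaVK lcm1. Qed.

Lemma of_to_unit : of_unit k l ⊚ to_unit k' l = in_charts (lid LA l (i U p)) k' k.
Proof. by apply: lf_inj; rewrite (lf_comp i) in_chartsP !lf_invK lcm1. Qed.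

Lemma to_of_unit : to_unit k l ⊚ of_unit k l = lid LC l p.
Proof. by apply: lf_inj; rewrite (lf_comp i) (lf_id i) !lf_invK thetaVK. Qed.

Lemma lr_to_unit Z (m : Z `<=` W) (r : Z `<=` cdom c) (n : Z `<=` U) :
  lr m r n (to_unit k l) = to_unit r n.
Proof. by apply: lf_inj; rewrite (lf_res i) !lf_invK lr_theta. Qed.

Lemma lr_of_unit Z (m : Z `<=` W) (r : Z `<=` cdom c) (n : Z `<=` U) :
  lr m n r (of_unit k l) = of_unit r n.
Proof. by apply: lf_inj; rewrite (lf_res i) !lf_invK lr_thetaV. Qed.

End UnitChart.

Section Target.
Variables (BS : obj_family X) (LS : lcat BS).
Hypothesis Ssh : lsheaf LS.

(** One chart around each point: unlike the collection of all charts, this is a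
    covering indexed by a small type, as descent requires. *)
Definition chosen U (q : BA U) (x : {x : X | (U : set X) x}) : chart q :=
  sval (cid (chart_ex q (svalP x))).

Lemma chosen_cover U (q : BA U) : U `<=` \bigcup_x cdom (chosen q x).
Proof.
move=> x Ux; exists (exist _ x Ux) => //.
by rewrite /chosen; case: cid.
Qed.

Section Extension.
Variables (F F' : lfunctor LA LS) (t : ltransf (lfcomp F i) (lfcomp F' i)).

(** In a chart of q, naturality with respect to the isomorphism i(p) -> q forces
    the value of the extension. *)
Definition ext_loc U (q : BA U) (c : chart q) W (k : W `<=` cdom c) (l : W `<=` U) :
  lh LS l l (F U q) (F' U q) :=
  lf F' (theta k l) ⊚ lt t k (cobj c) ⊚ lf F (thetaV k l).

(** Naturality of the local values with respect to every f : q' -> q.  For f the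
    identity and two charts of q it says that they do not depend on the
    chart. *)
Lemma ext_loc_nat W U' U (l' : W `<=` U') (l : W `<=` U) (q' : BA U') (q : BA U)
    (f : lh LA l' l q' q) (c' : chart q') (c : chart q) (k' : W `<=` cdom c')
    (k : W `<=` cdom c) :
  ext_loc k l ⊚ lf F f = lf F' f ⊚ ext_loc k' l'.
Proof.
have e : thetaV k l ⊚ f = lf i (in_charts f k' k) ⊚ thetaV k' l'.
  by rewrite in_chartsP (lcKr _ (thetaVK _ _)).
rewrite /ext_loc -lcA -(lf_comp F) e (lf_comp F) -[LHS]lcA [X in _ ⊚ X = _]lcA.
have /= -> := lt_nat t (in_charts f k' k); rewrite !lcA; congr (_ ⊚ _ ⊚ _).
by rewrite -!lf_comp /= in_chartsP !lcA thetaVK lc1m.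
Qed.

Lemma ext_loc_res U (q : BA U) (c : chart q) W Z (k : W `<=` cdom c) (l : W `<=` U)
    (m : Z `<=` W) (k' : Z `<=` cdom c) (l' : Z `<=` U) :
  lr m l' l' (ext_loc k l) = ext_loc k' l'.
Proof.
rewrite /ext_loc (lr_lc _ l' k' l') (lr_lc _ k' k' l').
have /= e := lt_res t k m k' (cobj c).
by rewrite -(lf_res F) -(lf_res F') lr_theta lr_thetaV e.
Qed.

Lemma ext_loc_eq U (q : BA U) (c d : chart q) W (k : W `<=` cdom c)
    (k' : W `<=` cdom d) (l : W `<=` U) : ext_loc k l = ext_loc k' l.
Proof.
have := ext_loc_nat (lid LA l q) k' k.
by rewrite (lf_id F) (lf_id F') lcm1 lc1m.
Qed.

Lemma ext_ex W U (h : W `<=` U) (q : BA U) :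
  exists e : lh LS h h (F U q) (F' U q),
  forall (c : chart q) Z (m : Z `<=` W) (k : Z `<=` cdom c) (l : Z `<=` U),
    lr m l l e = ext_loc k l.
Proof.
have [|||e eP] := lglue_fam Ssh h h (x := F U q) (y := F' U q)
  (D := fun x => cdom (chosen q x))
  (s := fun x Z _ k l1 l2 => lr incl_refl l1 l2 (ext_loc k l1)).
- exact: incl_trans (@chosen_cover _ q) h.
- move=> x Z T _ k l1 l2 m _ k' l1' l2'.
  rewrite (lr_lr m) -(ext_loc_res k l1 m k' l1').
  by rewrite (lr_lr m).
- by move=> x y Z _ k k' l1 l2; rewrite (ext_loc_eq k k').
exists e => c Z m k l.
apply: (lsep_fam Ssh (D := fun x => cdom (chosen q x))).
  exact: incl_trans (@chosen_cover _ q) l.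
move=> x T n kx l1 l2; rewrite (Prop_irrelevance l2 l1).
rewrite (lr_lr (incl_trans m n)) (eP x T (incl_trans m n) kx) lr_id.
by rewrite (ext_loc_res _ _ _ (incl_trans k n)); exact: ext_loc_eq.
Qed.

Definition ext_fun W U (h : W `<=` U) (q : BA U) := sval (cid (ext_ex h q)).

Lemma ext_funP W U (h : W `<=` U) (q : BA U) (c : chart q) Z (m : Z `<=` W)
  (k : Z `<=` cdom c) (l : Z `<=` U) : lr m l l (ext_fun h q) = ext_loc k l.
Proof. by rewrite /ext_fun; case: cid => e /= eP; exact: eP. Qed.

Definition extension : ltransf F F'.
Proof.
exists ext_fun.
- move=> W Z U h k l q; apply: (lsep_fam Ssh (D := fun x => cdom (chosen q x))).
    exact: incl_trans (@chosen_cover _ q) l.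
  move=> x T n kx l1 l2; rewrite (Prop_irrelevance l2 l1).
  by rewrite (lr_lr (incl_trans k n)) 2!(ext_funP _ _ kx).
- move=> W U1 U2 h1 h2 x y f.
  apply: (lsep_fam Ssh (D := fun ab => meet_open (cdom (chosen x ab.1)) (cdom (chosen y ab.2)))).
    move=> w Ww; have [a _ xa] := chosen_cover x (h1 w Ww).
    by have [b _ yb] := chosen_cover y (h2 w Ww); exists (a, b).
  move=> [a b] Z m /= kab l1 l2.
  have ka := incl_trans (@incl_meetl _ _ _) kab.
  have kb := incl_trans (@incl_meetr _ _ _) kab.
  rewrite (lr_lc _ l1 l2 l2) (lr_lc _ l1 l1 l2) (ext_funP _ _ ka) (ext_funP _ _ kb).
  by rewrite -(lf_res F) -(lf_res F'); exact: ext_loc_nat.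
Defined.

Lemma extensionE W U (h : W `<=` U) (p : BC U) : lt extension h (i U p) = lt t h p.
Proof.
rewrite -[LHS](lr_id incl_refl) /= (ext_funP _ (c := unit_chart p) _ h).
by rewrite /ext_loc theta_unit thetaV_unit (lf_id F) (lf_id F') lcm1 lc1m.
Qed.

(** Two transformations which agree on the image of C agree in every chart. *)
Lemma extension_uniq (t1 t2 : ltransf F F') :
  (forall U (p : BC U), lt t1 incl_refl (i U p) = lt t2 incl_refl (i U p)) ->
  forall W U (h : W `<=` U) (q : BA U), lt t1 h q = lt t2 h q.
Proof.
move=> e W U h q; apply: (lsep_fam Ssh (D := fun x => cdom (chosen q x))).
  exact: incl_trans (@chosen_cover _ q) h.
move=> x Z m k l1 l2; rewrite (Prop_irrelevance l2 l1) !lt_res.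
have e' : lt t1 k (i _ (cobj (chosen q x))) = lt t2 k (i _ (cobj (chosen q x))).
  by rewrite -(lt_res t1 incl_refl k k) e lt_res.
rewrite -[lt t1 l1 q]lcm1 -[lt t2 l1 q]lcm1.
rewrite -(lf_id F l1 q) -(thetaVK (c := chosen q x) k l1) (lf_comp F) !lcA.
by rewrite !lt_nat e'.
Qed.

End Extension.

Section Lift.
Hypothesis Sd : ldescent LS.
Variable G : lfunctor LC LS.
Local Notation I U := {x : X | (U : set X) x}.

(** The image of q in S is glued from the images of the objects of C which
    present q in the chosen charts, along the images of the transitions between
    these charts. *)
Lemma lift_ob U (q : BA U) : exists (s : BS U)
  (a : forall (x : I U) W (h : W `<=` cdom (chosen q x)) (l : W `<=` U),
    lh LS l h s (G _ (cobj (chosen q x))))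
  (b : forall (x : I U) W (h : W `<=` cdom (chosen q x)) (l : W `<=` U),
    lh LS h l (G _ (cobj (chosen q x))) s),
  [/\ forall x W Z (h : W `<=` cdom (chosen q x)) (l : W `<=` U) (k : Z `<=` W)
        (h' : Z `<=` cdom (chosen q x)) (l' : Z `<=` U),
        lr k l' h' (a x W h l) = a x Z h' l',
      forall x W (h : W `<=` cdom (chosen q x)) (l : W `<=` U),
        b x W h l ⊚ a x W h l = lid LS l s,
      forall x W (h : W `<=` cdom (chosen q x)) (l : W `<=` U),
        a x W h l ⊚ b x W h l = lid LS h (G _ (cobj (chosen q x)))
    & forall x y W (hx : W `<=` cdom (chosen q x)) (hy : W `<=` cdom (chosen q y))
        (l : W `<=` U),
        lf G (in_charts (lid LA l q) hy hx) ⊚ a y W hy l = a x W hx l].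
Proof.
have V x : cdom (chosen q x) `<=` U by exact: cincl.
have [|||s [a [b [ares ba ab ta]]]] := Sd V (@chosen_cover _ q)
  (p := fun x => G _ (cobj (chosen q x)))
  (t := fun x y W hx hy => lf G (in_charts (lid LA (incl_trans (V x) hx) q) hy hx)).
- move=> x y W Z hx hy k lx ly; rewrite -(lf_res G); congr lf.
  rewrite (lr_in_charts _ _ _ _ (incl_trans (V x) lx) (incl_trans (V x) lx)) lr_lid.
  by [].
- by move=> x W h; rewrite in_charts_id lf_id.
- move=> x y z W hx hy hz.
  rewrite (Prop_irrelevance (incl_trans (V y) hy) (incl_trans (V x) hx)).
  by rewrite -(lf_comp G) in_charts_comp lc1m.
exists s, a, b; split=> // x y W hx hy l.
by rewrite (Prop_irrelevance l (incl_trans (V x) hx)); exact: ta.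
Qed.

Definition lift_obj U (q : BA U) : BS U := sval (cid (lift_ob q)).
Definition lift_a U (q : BA U) (x : I U) W (h : W `<=` cdom (chosen q x)) (l : W `<=` U) :
  lh LS l h (lift_obj q) (G _ (cobj (chosen q x))) :=
  sval (cid (svalP (cid (lift_ob q)))) x W h l.
Definition lift_b U (q : BA U) (x : I U) W (h : W `<=` cdom (chosen q x)) (l : W `<=` U) :
  lh LS h l (G _ (cobj (chosen q x))) (lift_obj q) :=
  sval (cid (svalP (cid (svalP (cid (lift_ob q)))))) x W h l.

Lemma lift_abP U (q : BA U) :
  [/\ forall x W Z (h : W `<=` cdom (chosen q x)) (l : W `<=` U) (k : Z `<=` W)
        (h' : Z `<=` cdom (chosen q x)) (l' : Z `<=` U),
        lr k l' h' (lift_a h l) = lift_a h' l',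
      forall x W (h : W `<=` cdom (chosen q x)) (l : W `<=` U),
        lift_b h l ⊚ lift_a h l = lid LS l (lift_obj q),
      forall x W (h : W `<=` cdom (chosen q x)) (l : W `<=` U),
        lift_a h l ⊚ lift_b h l = lid LS h (G _ (cobj (chosen q x)))
    & forall x y W (hx : W `<=` cdom (chosen q x)) (hy : W `<=` cdom (chosen q y))
        (l : W `<=` U),
        lf G (in_charts (lid LA l q) hy hx) ⊚ lift_a hy l = lift_a hx l].
Proof. exact: (svalP (cid (svalP (cid (svalP (cid (lift_ob q))))))). Qed.

Lemma lr_lift_a U (q : BA U) x W Z (h : W `<=` cdom (chosen q x)) (l : W `<=` U)
  (k : Z `<=` W) (h' : Z `<=` cdom (chosen q x)) (l' : Z `<=` U) :
  lr k l' h' (lift_a h l) = lift_a h' l'.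
Proof. by case: (lift_abP q). Qed.
Lemma lift_baK U (q : BA U) x W (h : W `<=` cdom (chosen q x)) (l : W `<=` U) :
  lift_b h l ⊚ lift_a h l = lid LS l (lift_obj q).
Proof. by case: (lift_abP q). Qed.
Lemma lift_abK U (q : BA U) x W (h : W `<=` cdom (chosen q x)) (l : W `<=` U) :
  lift_a h l ⊚ lift_b h l = lid LS h (G _ (cobj (chosen q x))).
Proof. by case: (lift_abP q). Qed.
Lemma in_charts_a U (q : BA U) x y W (hx : W `<=` cdom (chosen q x))
    (hy : W `<=` cdom (chosen q y)) (l : W `<=` U) :
  lf G (in_charts (lid LA l q) hy hx) ⊚ lift_a hy l = lift_a hx l.
Proof. by case: (lift_abP q). Qed.
Lemma b_in_charts U (q : BA U) x y W (hx : W `<=` cdom (chosen q x))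
    (hy : W `<=` cdom (chosen q y)) (l : W `<=` U) :
  lift_b hx l ⊚ lf G (in_charts (lid LA l q) hy hx) = lift_b hy l.
Proof.
rewrite -[LHS]lcm1 -(lift_abK (q := q) (x := y) hy l) lcA -[X in X ⊚ _ = _]lcA in_charts_a.
by rewrite lift_baK lc1m.
Qed.
Lemma lr_lift_b U (q : BA U) x W Z (h : W `<=` cdom (chosen q x)) (l : W `<=` U)
  (k : Z `<=` W) (h' : Z `<=` cdom (chosen q x)) (l' : Z `<=` U) :
  lr k h' l' (lift_b h l) = lift_b h' l'.
Proof.
rewrite -[LHS]lc1m -(lift_baK (q := q) (x := x) h' l') -lcA -(lr_lift_a h l k h' l').
by rewrite -lr_lc lift_abK lr_lid lcm1.
Qed.

(** The image of f, read in a chart of q' and in a chart of q. *)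
Definition lift_loc W U' U (l' : W `<=` U') (l : W `<=` U) (q' : BA U') (q : BA U)
  (f : lh LA l' l q' q) (x' : I U') (x : I U) (k' : W `<=` cdom (chosen q' x'))
  (k : W `<=` cdom (chosen q x)) : lh LS l' l (lift_obj q') (lift_obj q) :=
  lift_b k l ⊚ lf G (in_charts f k' k) ⊚ lift_a k' l'.

Lemma lr_lift_loc W Z U' U (l' : W `<=` U') (l : W `<=` U) (q' : BA U') (q : BA U)
    (f : lh LA l' l q' q) (x' : I U') (x : I U) (k' : W `<=` cdom (chosen q' x'))
    (k : W `<=` cdom (chosen q x)) (m : Z `<=` W) (n' : Z `<=` U') (n : Z `<=` U)
    (r' : Z `<=` cdom (chosen q' x')) (r : Z `<=` cdom (chosen q x)) :
  lr m n' n (lift_loc f k' k) = lift_loc (lr m n' n f) r' r.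
Proof.
rewrite /lift_loc (lr_lc _ n' r' n) (lr_lc _ r' r n) lr_lift_a lr_lift_b -(lf_res G).
by rewrite (lr_in_charts _ _ _ _ n' n).
Qed.

(** Changing the charts changes the expression of f by transitions, which are
    absorbed by the gluing isomorphisms of the images of q' and q. *)
Lemma lift_loc_eq W U' U (l' : W `<=` U') (l : W `<=` U) (q' : BA U') (q : BA U)
    (f : lh LA l' l q' q) (x' y' : I U') (x y : I U)
    (k' : W `<=` cdom (chosen q' x')) (k : W `<=` cdom (chosen q x))
    (r' : W `<=` cdom (chosen q' y')) (r : W `<=` cdom (chosen q y)) :
  lift_loc f k' k = lift_loc f r' r.
Proof.
rewrite /lift_loc -(b_in_charts r k l) -(in_charts_a k' r' l') !lcA.
rewrite -[X in X ⊚ _ ⊚ _ = _]lcA -(lf_comp G) in_charts_comp lc1m.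
rewrite -[X in X ⊚ _ = _]lcA -(lf_comp G) in_charts_comp lcm1.
by [].
Qed.

Let D2 U' U (q' : BA U') (q : BA U) (ab : I U' * I U) :=
  meet_open (cdom (chosen q' ab.1)) (cdom (chosen q ab.2)).

Let D2_cover W U' U (l' : W `<=` U') (l : W `<=` U) (q' : BA U') (q : BA U) :
  W `<=` \bigcup_ab D2 q' q ab.
Proof.
move=> w Ww; have [a _ xa] := chosen_cover q' (l' w Ww).
by have [b _ yb] := chosen_cover q (l w Ww); exists (a, b).
Qed.

Lemma lift_ex W U' U (l' : W `<=` U') (l : W `<=` U) (q' : BA U') (q : BA U)
    (f : lh LA l' l q' q) : exists e : lh LS l' l (lift_obj q') (lift_obj q),
  forall x' x Z (m : Z `<=` W) (n' : Z `<=` U') (n : Z `<=` U)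
    (k' : Z `<=` cdom (chosen q' x')) (k : Z `<=` cdom (chosen q x)),
  lr m n' n e = lift_loc (lr m n' n f) k' k.
Proof.
have kl (Z : opens X) x' x (kj : Z `<=` D2 q' q (x', x)) : Z `<=` cdom (chosen q' x').
  exact: incl_trans (@incl_meetl _ _ _) kj.
have kr (Z : opens X) x' x (kj : Z `<=` D2 q' q (x', x)) : Z `<=` cdom (chosen q x).
  exact: incl_trans (@incl_meetr _ _ _) kj.
have [|||e eP] := lglue_fam Ssh l' l (x := lift_obj q') (y := lift_obj q) (D := D2 q' q)
  (s := fun ab Z m kj n' n => lift_loc (lr m n' n f) (kl Z ab.1 ab.2 kj) (kr Z ab.1 ab.2 kj)).
- exact: D2_cover.
- by move=> [a b] Z T k kj n' n m k' kj' r' r; rewrite (lr_lift_loc _ _ _ _ r' r (kl T a b kj') (kr T a b kj')) (lr_lr k').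
- by move=> [a b] [a' b'] Z k kj kj' n' n; exact: lift_loc_eq.
exists e => x' x Z m n' n k' k.
rewrite (eP (x', x) Z m (fun z Zz => conj (k' z Zz) (k z Zz))) /=.
exact: lift_loc_eq.
Qed.

Definition lift_hom W U' U (l' : W `<=` U') (l : W `<=` U) (q' : BA U') (q : BA U)
    (f : lh LA l' l q' q) : lh LS l' l (lift_obj q') (lift_obj q) := sval (cid (lift_ex f)).

Lemma lift_homP W U' U (l' : W `<=` U') (l : W `<=` U) (q' : BA U') (q : BA U)
    (f : lh LA l' l q' q) x' x Z (m : Z `<=` W) (n' : Z `<=` U') (n : Z `<=` U)
    (k' : Z `<=` cdom (chosen q' x')) (k : Z `<=` cdom (chosen q x)) :
  lr m n' n (lift_hom f) = lift_loc (lr m n' n f) k' k.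
Proof. by rewrite /lift_hom; case: cid => e /= eP; exact: eP. Qed.

Definition lift_functor : lfunctor LA LS.
Proof.
exists lift_obj lift_hom.
- move=> W U h q; apply: (lsep_fam Ssh (D := D2 q q)); first exact: D2_cover.
  move=> [a b] Z m kj n' n; rewrite (Prop_irrelevance n n').
  have ka := incl_trans (@incl_meetl _ _ _) kj.
  rewrite (lift_homP _ _ _ _ ka ka) !lr_lid /lift_loc in_charts_id (lf_id G) lcm1.
  exact: lift_baK.
- move=> W U1 U2 U3 h1 h2 h3 x y z f g.
  apply: (lsep_fam Ssh (D := fun abc => meet_open (D2 x y abc.1) (cdom (chosen z abc.2)))).
    move=> w Ww; have [ab _ Dw] := @D2_cover _ _ _ h1 h2 x y w Ww.
    by have [c _ yc] := chosen_cover z (h3 w Ww); exists (ab, c).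
  move=> [[a b] c] Z m kj n1 n3; have n2 := incl_trans h2 m.
  have kc := incl_trans (@incl_meetr _ _ _) kj.
  have kab := incl_trans (@incl_meetl _ _ _) kj.
  have ka := incl_trans (@incl_meetl _ _ _) kab.
  have kb := incl_trans (@incl_meetr _ _ _) kab.
  rewrite (lift_homP _ _ _ _ ka kc) (lr_lc _ n1 n2 n3) (lr_lc _ n1 n2 n3).
  rewrite (lift_homP _ _ _ _ ka kb) (lift_homP _ _ _ _ kb kc).
  rewrite /lift_loc !lcA (lcKr _ (lift_abK _ _)) -[X in _ = X ⊚ _]lcA -(lf_comp G).
  by rewrite in_charts_comp.
- move=> W Z U1 U2 h1 h2 k l1 l2 x y f.
  apply: (lsep_fam Ssh (D := D2 x y)); first exact: D2_cover.
  move=> [a b] T m kj n1 n2.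
  have ka := incl_trans (@incl_meetl _ _ _) kj.
  have kb := incl_trans (@incl_meetr _ _ _) kj.
  rewrite (lift_homP _ _ _ _ ka kb) !(lr_lr (incl_trans k m)).
  by rewrite (lift_homP _ _ _ _ ka kb).
Defined.

(** The image of i(p) is glued from pieces; each of them is identified with the
    image of p by the passage to the tautological chart. *)
Definition unit_loc W U (l : W `<=` U) (p : BC U) (x : I U)
  (k : W `<=` cdom (chosen (i U p) x)) : lh LS l l (lift_obj (i U p)) (G U p) :=
  lf G (to_unit k l) ⊚ lift_a k l.
Definition unit_locV W U (l : W `<=` U) (p : BC U) (x : I U)
  (k : W `<=` cdom (chosen (i U p) x)) : lh LS l l (G U p) (lift_obj (i U p)) :=
  lift_b k l ⊚ lf G (of_unit k l).

Lemma lr_unit_loc W Z U (l : W `<=` U) (p : BC U) (x : I U)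
    (k : W `<=` cdom (chosen (i U p) x)) (m : Z `<=` W) (l' : Z `<=` U)
    (k' : Z `<=` cdom (chosen (i U p) x)) :
  lr m l' l' (unit_loc l k) = unit_loc l' k'.
Proof. by rewrite /unit_loc (lr_lc _ l' k' l') lr_lift_a -(lf_res G) lr_to_unit. Qed.

Lemma lr_unit_locV W Z U (l : W `<=` U) (p : BC U) (x : I U)
    (k : W `<=` cdom (chosen (i U p) x)) (m : Z `<=` W) (l' : Z `<=` U)
    (k' : Z `<=` cdom (chosen (i U p) x)) :
  lr m l' l' (unit_locV l k) = unit_locV l' k'.
Proof. by rewrite /unit_locV (lr_lc _ l' k' l') lr_lift_b -(lf_res G) lr_of_unit. Qed.

Lemma unit_loc_eq W U (l : W `<=` U) (p : BC U) (x y : I U)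
    (k : W `<=` cdom (chosen (i U p) x)) (k' : W `<=` cdom (chosen (i U p) y)) :
  unit_loc l k = unit_loc l k'.
Proof. by rewrite /unit_loc -(in_charts_a k k' l) lcA -(lf_comp G) to_unit_in_charts. Qed.

Lemma unit_locV_eq W U (l : W `<=` U) (p : BC U) (x y : I U)
    (k : W `<=` cdom (chosen (i U p) x)) (k' : W `<=` cdom (chosen (i U p) y)) :
  unit_locV l k = unit_locV l k'.
Proof. by rewrite /unit_locV -(b_in_charts k' k l) -lcA -(lf_comp G) in_charts_of_unit. Qed.

Lemma unit_ex W U (h : W `<=` U) (p : BC U) :
  exists e : lh LS h h (lift_obj (i U p)) (G U p), forall x Z (m : Z `<=` W)
    (k : Z `<=` cdom (chosen (i U p) x)) (l : Z `<=` U), lr m l l e = unit_loc l k.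
Proof.
have [|||e eP] := lglue_fam Ssh h h (x := lift_obj (i U p)) (y := G U p)
  (D := fun x => cdom (chosen (i U p) x))
  (s := fun x Z _ k l1 l2 => lr incl_refl l1 l2 (unit_loc l1 k)).
- exact: incl_trans (@chosen_cover _ _) h.
- move=> x Z T _ k l1 l2 m _ k' l1' l2'.
  by rewrite (lr_lr m) -(lr_unit_loc l1 k m l1' k') (lr_lr m).
- by move=> x y Z _ k k' l1 l2; rewrite (unit_loc_eq l1 k k').
by exists e => x Z m k l; rewrite (eP x Z m k) lr_id.
Qed.

Lemma unitV_ex W U (h : W `<=` U) (p : BC U) :
  exists e : lh LS h h (G U p) (lift_obj (i U p)), forall x Z (m : Z `<=` W)
    (k : Z `<=` cdom (chosen (i U p) x)) (l : Z `<=` U), lr m l l e = unit_locV l k.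
Proof.
have [|||e eP] := lglue_fam Ssh h h (x := G U p) (y := lift_obj (i U p))
  (D := fun x => cdom (chosen (i U p) x))
  (s := fun x Z _ k l1 l2 => lr incl_refl l1 l2 (unit_locV l1 k)).
- exact: incl_trans (@chosen_cover _ _) h.
- move=> x Z T _ k l1 l2 m _ k' l1' l2'.
  by rewrite (lr_lr m) -(lr_unit_locV l1 k m l1' k') (lr_lr m).
- by move=> x y Z _ k k' l1 l2; rewrite (unit_locV_eq l1 k k').
by exists e => x Z m k l; rewrite (eP x Z m k) lr_id.
Qed.

Lemma unit_inv W U (h : W `<=` U) (p : BC U) :
  sval (cid (unitV_ex h p)) ⊚ sval (cid (unit_ex h p)) = lid LS h _ /\
  sval (cid (unit_ex h p)) ⊚ sval (cid (unitV_ex h p)) = lid LS h _.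
Proof.
case: cid => e eP; case: cid => e' e'P /=.
split; apply: (lsep_fam Ssh (D := fun x => cdom (chosen (i U p) x)));
  try exact: incl_trans (@chosen_cover _ _) h;
  move=> x Z m k l1 l2; rewrite (Prop_irrelevance l2 l1) (lr_lc _ l1 l1 l1);
  rewrite (eP x _ _ k) (e'P x _ _ k) lr_lid.
- rewrite /unit_loc /unit_locV lcA -[X in X ⊚ _ = _]lcA -(lf_comp G) of_to_unit.
  by rewrite in_charts_id lf_id lcm1 lift_baK.
- rewrite /unit_loc /unit_locV lcA (lcKr _ (lift_abK _ _)) -(lf_comp G) to_of_unit.
  by rewrite lf_id.
Qed.

Definition lift_unit : ltransf (lfcomp lift_functor i) G.
Proof.
exists (fun W U h p => sval (cid (unit_ex h p))).
- move=> W Z U h k l p; case: cid => e eP; case: cid => e' e'P /=.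
  apply: (lsep_fam Ssh (D := fun x => cdom (chosen (i U p) x))).
    exact: incl_trans (@chosen_cover _ _) l.
  move=> x T m kx l1 l2; rewrite (Prop_irrelevance l2 l1) (lr_lr (incl_trans k m)).
  by rewrite (eP x _ _ kx) (e'P x _ _ kx).
- move=> W U1 U2 h1 h2 x y f; case: cid => e eP; case: cid => e' e'P.
  apply: (lsep_fam Ssh (D := D2 (i _ x) (i _ y))); first exact: D2_cover.
  move=> [a b] Z m kj n1 n2.
  have ka := incl_trans (@incl_meetl _ _ _) kj.
  have kb := incl_trans (@incl_meetr _ _ _) kj.
  rewrite (lr_lc _ n1 n2 n2) (lr_lc _ n1 n1 n2) (eP b _ _ kb) (e'P a _ _ ka).
  rewrite /= (lift_homP _ _ _ _ ka kb) /unit_loc /lift_loc.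
  rewrite !lcA (lcKr _ (lift_abK _ _)) -(lf_res G) -!(lf_comp G); congr (lf G _ ⊚ _).
  apply: lf_inj; rewrite !(lf_comp i) in_chartsP !lf_invK !lcA thetaVK lc1m.
  by rewrite -(lf_res i).
Defined.

End Lift.
End Target.
End Recognition.

Section LtransfOf.
Variables (X : topologicalType) (C D : prestack X).

Definition ltransf_of (F G : functor C D) (t : transf F G) :
  ltransf (lfun_of F) (lfun_of G).
Proof.
exists (fun W U h x => pres h (t U x)).
- by move=> W Z U h k l x; exact: (lres_pres h k l (t U x)).
- by move=> W U1 U2 h1 h2 x y f; exact: (transf_lnat t f).
Defined.

End LtransfOf.

Lemma chart_of_iso (X : topologicalType) (C A : prestack X) (i : functor C A)
    (U : opens X) (q : A U) (W : sub_open U) (p : C W) :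
  iso (pcat A W) (i W p) (q ↾ sincl W) ->
  exists c : chart (lfun_of i) q, cdom c = W.
Proof.
move=> e.
unshelve eexists (@Chart _ _ _ _ _ (lfun_of i) U q W (sincl W) p
  (fwd e ∘ fwd (punit A incl_refl (i W p)))
  (bwd (punit A incl_refl (i W p)) ∘ bwd e) _ _) => //.
- by rewrite /= -compA fwdKf fwdK.
- by rewrite /= -compA bwdKf bwdK.
Qed.

Lemma lfun_bij (X : topologicalType) (C A : prestack X) (i : functor C A) :
  (forall (U : opens X) (x y : C U), bijective (@fun_hom X C A i U x y)) ->
  forall (W U1 U2 : opens X) (h1 : W `<=` U1) (h2 : W `<=` U2) (x : C U1) (y : C U2),
  bijective (@lfun X C A i W U1 U2 h1 h2 x y).
Proof.
move=> i_ff W U1 U2 h1 h2 x y; have [j ij ji] := i_ff _ (x ↾ h1) (y ↾ h2).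
exists (fun f => j (bwd (fun_res i h2 y) ∘ f ∘ fwd (fun_res i h1 x))) => f.
  by rewrite /lfun -!compA fwdK compm1 fwdKf ij.
by rewrite /lfun ji -!compA bwdK compm1 bwdKf.
Qed.

(** Every functor from C to a stack extends along a fully faithful functor whose
    image contains every object locally: the values are prescribed locally up to
    unique isomorphism, and the stack condition provides the global ones. *)
Theorem associated_stackP (X : topologicalType) (C A : prestack X)
    (i : functor C A) :
  stack A ->
  (forall (U : opens X) (x y : C U), bijective (@fun_hom X C A i U x y)) ->
  (forall (U : opens X) (q : A U) x, (U : set X) x ->
    exists W : sub_open U, (W : set X) x /\
      exists p : C W, inhabited (iso (pcat A W) (i W p) (q ↾ sincl W))) ->
  associated_stack i.
Proof.
move=> Ast i_ff i_ess; split=> // S [Ssep Sd].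
have Ssh := separated_lsheaf Ssep; have {}Sd := descent_ldescent Sd.
have lf_bij (W U1 U2 : opens X) (h1 : W `<=` U1) (h2 : W `<=` U2)
    (x : C U1) (y : C U2) : bijective (@lf _ _ _ _ _ (lfun_of i) W U1 U2 h1 h2 x y).
  exact: (lfun_bij i_ff h1 h2 x y).
have chart_ex (U : opens X) (q : A U) x : (U : set X) x ->
    exists c : chart (lfun_of i) q, (cdom c : set X) x.
  move=> /(i_ess U q) [W [Wx [p [e]]]].
  by have [c cE] := chart_of_iso e; exists c; rewrite cE.
split=> [G|F F' t].
- pose phi := lift_functor lf_bij chart_ex Ssh Sd (lfun_of G).
  pose u := lift_unit lf_bij chart_ex Ssh Sd (lfun_of G).
  have uE (W U1 U2 : opens X) (h1 : W `<=` U1) (h2 : W `<=` U2) (x : C U1)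
      (y : C U2) (f : lh (lcat_of C) h1 h2 x y) :
    lt u h2 y ⊚ lfun (comp_functor (functor_of phi) i) f
    = lfun G f ⊚ lt u h1 x.
    by rewrite lfun_comp lfun_functor_of; exact: (lt_nat u f).
  exists (functor_of phi), (transf_of (F := comp_functor (functor_of phi) i)
    (t := fun W U h x => lt u h x) (fun W Z U h k l x => lt_res u h k l x) uE).
  move=> U p; rewrite transf_ofK.
  have [e1 e2] := unit_inv lf_bij chart_ex Ssh Sd (lfun_of G) (@incl_refl X U) p.
  eexists (glob (sval (cid (unitV_ex lf_bij chart_ex Ssh Sd (lfun_of G)
    (@incl_refl X U) p)))).
  split.
  + by rewrite -glob_comp -[RHS]glob_id; congr glob; exact: e1.
  + by rewrite -glob_comp -[RHS]glob_id; congr glob; exact: e2.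
- pose LF := lfcomp (lfun_of F) (lfun_of i); pose LF' := lfcomp (lfun_of F') (lfun_of i).
  have tn (W U1 U2 : opens X) (h1 : W `<=` U1) (h2 : W `<=` U2)
      (x : C U1) (y : C U2) (f : lh (lcat_of C) h1 h2 x y) :
    lt (ltransf_of t) h2 y ⊚ lf LF f = lf LF' f ⊚ lt (ltransf_of t) h1 x.
    by have := lt_nat (ltransf_of t) f; rewrite /= !lfun_comp.
  pose lt0 : ltransf LF LF' := @Ltransf _ _ _ _ _ LF LF'
    (fun W U h x => lt (ltransf_of t) h x) (fun W Z U h k l x => lt_res (ltransf_of t) h k l x) tn.
  split.
    pose e := extension lf_bij chart_ex Ssh lt0.
    exists (transf_of (fun W Z U h k l x => lt_res e h k l x)
      (fun W U1 U2 h1 h2 x y f => lt_nat e f)) => U p.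
    by rewrite transf_ofK (extensionE lf_bij chart_ex Ssh lt0) /= presK.
  move=> t1 t2 e1 e2 U q.
  apply: (can_inj (@presK _ _ _ _ _)).
  apply: (@extension_uniq _ _ _ _ _ _ chart_ex _ _ Ssh (lfun_of F) (lfun_of F')
    (ltransf_of t1) (ltransf_of t2) _ U U incl_refl q) => V p /=.
  by rewrite e1 e2.
Qed.

(** * Descent data *)

Section Stackification.
Variables (X : topologicalType) (B : obj_family X) (L : lcat B).
Hypothesis Lsh : lsheaf L.
Implicit Types U V W Z T : opens X.

(** Objects p_i of the local category over E_i, used on the open subsets D_i
    only.  Keeping E_i and D_i apart allows one to shrink a covering, as needed
    for the composition of coverings in [datum_lcat_descent], without
    restricting the objects.  The covering is indexed by an arbitrary type so
    that coverings compose. *)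
Record datum U := Dd {
  dI : Type;
  dE : dI -> opens X;
  dp : forall i, B (dE i);
  dD : dI -> opens X;
  dDE : forall i, dD i `<=` dE i;
  dt : forall i j W (hi : W `<=` dD i) (hj : W `<=` dD j), W `<=` U ->
    lh L (incl_trans (@dDE j) hj) (incl_trans (@dDE i) hi) (dp j) (dp i);
  dt_res : forall i j W Z (hi : W `<=` dD i) (hj : W `<=` dD j) (h : W `<=` U)
    (k : Z `<=` W) (ki : Z `<=` dD i) (kj : Z `<=` dD j) (l : Z `<=` U),
    lr k (incl_trans (@dDE j) kj) (incl_trans (@dDE i) ki) (dt hi hj h) = dt ki kj l;
  dt_id : forall i W (hi : W `<=` dD i) (h : W `<=` U),
    dt hi hi h = lid L (incl_trans (@dDE i) hi) (dp i);
  dt_comp : forall i j k W (hi : W `<=` dD i) (hj : W `<=` dD j)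
    (hk : W `<=` dD k) (h : W `<=` U), dt hi hj h ⊚ dt hj hk h = dt hi hk h;
  dcov : U `<=` \bigcup_i dD i }.
Arguments dI {U} _.
Arguments dE {U} _ _.
Arguments dp {U} _ _.
Arguments dD {U} _ _.
Arguments dDE {U} _ _ _ _.
Arguments dt {U} _ _ _ {W}.

Definition datum_res U V (h : V `<=` U) (q : datum U) : datum V.
Proof.
exists (dI q) (dE q) (dp q) (dD q) (dDE q)
  (fun i j W hi hj w => dt q i j hi hj (incl_trans h w)).
- by move=> *; exact: dt_res.
- by move=> *; exact: dt_id.
- by move=> *; exact: dt_comp.
- exact: incl_trans (@dcov _ q) h.
Defined.

Definition datum_family : obj_family X := ObjFamily datum_res.

Section DH.
Variables (W U1 U2 : opens X) (h1 : W `<=` U1) (h2 : W `<=` U2).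
Variables (x : datum U1) (y : datum U2).

(** Matrices compatible with the transition isomorphisms on both sides.  The
    redundancy, compared to the choice of entries on a common refinement, makes
    composition a product of matrices. *)
Record datum_hom := Dh {
  dm : forall i j Z (hi : Z `<=` dD x i) (hj : Z `<=` dD y j), Z `<=` W ->
    lh L (incl_trans (dDE x i) hi) (incl_trans (dDE y j) hj) (dp x i) (dp y j);
  dm_res : forall i j Z T (hi : Z `<=` dD x i) (hj : Z `<=` dD y j)
    (z : Z `<=` W) (k : T `<=` Z) (ki : T `<=` dD x i) (kj : T `<=` dD y j)
    (t : T `<=` W),
    lr k (incl_trans (dDE x i) ki) (incl_trans (dDE y j) kj) (dm hi hj z)
    = dm ki kj t;
  dm_l : forall i j k Z (hi : Z `<=` dD x i) (hj : Z `<=` dD y j)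
    (hk : Z `<=` dD y k) (z : Z `<=` W),
    dt y k j hk hj (incl_trans h2 z) ⊚ dm hi hj z = dm hi hk z;
  dm_r : forall i j k Z (hi : Z `<=` dD x i) (hj : Z `<=` dD x j)
    (hk : Z `<=` dD y k) (z : Z `<=` W),
    dm hj hk z ⊚ dt x j i hj hi (incl_trans h1 z) = dm hi hk z }.

Lemma datum_hom_eq (f g : datum_hom) :
  (forall i j Z (hi : Z `<=` dD x i) (hj : Z `<=` dD y j) (z : Z `<=` W),
    dm f hi hj z = dm g hi hj z) -> f = g.
Proof.
case: f g => [f fr fl frr] [g gr gl grr] /= e.
have {}e : f = g.
  apply: functional_extensionality_dep => i.
  apply: functional_extensionality_dep => j.
  apply: functional_extensionality_dep => Z.
  apply: functional_extensionality_dep => hi.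
  apply: functional_extensionality_dep => hj.
  by apply: functional_extensionality_dep => z.
by subst g; congr Dh; exact: Prop_irrelevance.
Qed.

Lemma datum_hom_ext (J : Type) (D : J -> opens X) (f g : datum_hom) :
  W `<=` \bigcup_d D d ->
  (forall d i j Z (hi : Z `<=` dD x i) (hj : Z `<=` dD y j) (z : Z `<=` W),
    Z `<=` D d -> dm f hi hj z = dm g hi hj z) -> f = g.
Proof.
move=> cov e; apply: datum_hom_eq => i j Z hi hj z.
apply: (lsep_fam Lsh (D := D)); first exact: incl_trans cov z.
move=> d T k kd l1 l2.
pose ki := incl_trans hi k; pose kj := incl_trans hj k.
rewrite (Prop_irrelevance l1 (incl_trans (dDE x i) ki)).
rewrite (Prop_irrelevance l2 (incl_trans (dDE y j) kj)).
by rewrite !(dm_res _ _ _ _ _ _ _ (incl_trans z k)); exact: e kd.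
Qed.

(** The entries may be prescribed over the members of a covering of W only. *)
Lemma datum_hom_glue (J : Type) (D : J -> opens X)
    (s : forall d i j Z (hi : Z `<=` dD x i) (hj : Z `<=` dD y j), Z `<=` W ->
      Z `<=` D d ->
      lh L (incl_trans (dDE x i) hi) (incl_trans (dDE y j) hj) (dp x i) (dp y j)) :
  W `<=` \bigcup_d D d ->
  (forall d i j Z T (hi : Z `<=` dD x i) (hj : Z `<=` dD y j) (z : Z `<=` W)
    (zd : Z `<=` D d) (k : T `<=` Z) (ki : T `<=` dD x i) (kj : T `<=` dD y j)
    (t : T `<=` W) (td : T `<=` D d),
    lr k (incl_trans (dDE x i) ki) (incl_trans (dDE y j) kj) (s d i j Z hi hj z zd)
    = s d i j T ki kj t td) ->
  (forall d e i j Z (hi : Z `<=` dD x i) (hj : Z `<=` dD y j) (z : Z `<=` W)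
    (zd : Z `<=` D d) (ze : Z `<=` D e),
    s d i j Z hi hj z zd = s e i j Z hi hj z ze) ->
  (forall d i j k Z (hi : Z `<=` dD x i) (hj : Z `<=` dD y j)
    (hk : Z `<=` dD y k) (z : Z `<=` W) (zd : Z `<=` D d),
    dt y k j hk hj (incl_trans h2 z) ⊚ s d i j Z hi hj z zd = s d i k Z hi hk z zd) ->
  (forall d i j k Z (hi : Z `<=` dD x i) (hj : Z `<=` dD x j)
    (hk : Z `<=` dD y k) (z : Z `<=` W) (zd : Z `<=` D d),
    s d j k Z hj hk z zd ⊚ dt x j i hj hi (incl_trans h1 z) = s d i k Z hi hk z zd) ->
  exists f : datum_hom, forall d i j Z (hi : Z `<=` dD x i) (hj : Z `<=` dD y j)
    (z : Z `<=` W) (zd : Z `<=` D d), dm f hi hj z = s d i j Z hi hj z zd.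
Proof.
move=> cov sr seq sl srr.
have ex i j Z (hi : Z `<=` dD x i) (hj : Z `<=` dD y j) (z : Z `<=` W) :
  exists f : lh L (incl_trans (dDE x i) hi) (incl_trans (dDE y j) hj) (dp x i) (dp y j),
  forall d T (k : T `<=` Z) (td : T `<=` D d) (ki : T `<=` dD x i) (kj : T `<=` dD y j)
    (t : T `<=` W),
  lr k (incl_trans (dDE x i) ki) (incl_trans (dDE y j) kj) f = s d i j T ki kj t td.
  have [|||f fP] := lglue_fam Lsh (incl_trans (dDE x i) hi) (incl_trans (dDE y j) hj)
    (x := dp x i) (y := dp y j) (D := D)
    (s := fun d T (k : T `<=` Z) td l1 l2 => lr incl_refl l1 l2
      (s d i j T (incl_trans hi k) (incl_trans hj k) (incl_trans z k) td)).
  - exact: incl_trans cov z.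
  - move=> d T T' k td l1 l2 m k' td' l1' l2'; rewrite (lr_lr m).
    rewrite -(sr d i j T T' (incl_trans hi k) (incl_trans hj k) (incl_trans z k) td m).
    by rewrite (lr_lr m).
  - by move=> d e T k td te l1 l2; congr lr; exact: seq.
  exists f => d T k td ki kj t; rewrite (fP d T k td).
  rewrite (Prop_irrelevance ki (incl_trans hi k)) (Prop_irrelevance kj (incl_trans hj k)).
  by rewrite lr_id; rewrite (Prop_irrelevance t (incl_trans z k)).
pose F i j Z hi hj z := sval (cid (ex i j Z hi hj z)).
have FP i j Z hi hj z d T (k : T `<=` Z) (td : T `<=` D d) (ki : T `<=` dD x i)
    (kj : T `<=` dD y j) (t : T `<=` W) :
  lr k (incl_trans (dDE x i) ki) (incl_trans (dDE y j) kj) (F i j Z hi hj z)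
  = s d i j T ki kj t td by rewrite /F; case: cid => f /= fP; exact: fP.
have loc i j Z (hi : Z `<=` dD x i) (hj : Z `<=` dD y j) (z : Z `<=` W)
    (f g : lh L (incl_trans (dDE x i) hi) (incl_trans (dDE y j) hj) (dp x i) (dp y j)) :
    (forall d T (k : T `<=` Z) (ki : T `<=` dD x i) (kj : T `<=` dD y j), T `<=` D d ->
      lr k (incl_trans (dDE x i) ki) (incl_trans (dDE y j) kj) f
      = lr k (incl_trans (dDE x i) ki) (incl_trans (dDE y j) kj) g) -> f = g.
  move=> e; apply: (lsep_fam Lsh (D := D)); first exact: incl_trans cov z.
  move=> d T k kd l1 l2.
  rewrite (Prop_irrelevance l1 (incl_trans (dDE x i) (incl_trans hi k))).
  rewrite (Prop_irrelevance l2 (incl_trans (dDE y j) (incl_trans hj k))).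
  exact: e kd.
unshelve eexists (@Dh F _ _ _).
- move=> i j Z T hi hj z k ki kj t; apply: (loc) => // d T' m mi mj td.
  rewrite (lr_lr (incl_trans k m)).
  by rewrite !(FP _ _ _ _ _ _ d _ _ td _ _ (incl_trans t m)).
- move=> i j k Z hi hj hk z; apply: (loc) => // d T m mi mk td.
  rewrite (lr_lc _ _ (incl_trans (dDE y j) (incl_trans hj m))).
  rewrite !(FP _ _ _ _ _ _ d _ _ td _ _ (incl_trans z m)) -(sl d i j k T mi (incl_trans hj m)).
  by rewrite (dt_res _ _ _ _ _ _ (incl_trans h2 (incl_trans z m))).
- move=> i j k Z hi hj hk z; apply: (loc) => // d T m mi mk td.
  rewrite (lr_lc _ _ (incl_trans (dDE x j) (incl_trans hj m))).
  rewrite !(FP _ _ _ _ _ _ d _ _ td _ _ (incl_trans z m)) -(srr d i j k T mi (incl_trans hj m)).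
  by rewrite (dt_res _ _ _ _ _ _ (incl_trans h1 (incl_trans z m))).
- move=> d i j Z hi hj z zd /=.
  by rewrite -[LHS](lr_id incl_refl) (FP _ _ _ _ _ _ d _ _ zd _ _ z).
Qed.

End DH.
Arguments dm {W U1 U2 h1 h2 x y} f i j {Z} hi hj z : rename.

(** The identity matrix consists of the transition isomorphisms. *)
Definition datum_id W U (h : W `<=` U) (x : datum U) : datum_hom h h x x.
Proof.
exists (fun i j Z hi hj z => dt x j i hj hi (incl_trans h z)).
- by move=> *; exact: dt_res.
- by move=> *; exact: dt_comp.
- by move=> *; exact: dt_comp.
Defined.

Definition datum_can U V W (h : V `<=` U) (k : W `<=` V) (l : W `<=` U) (x : datum U) :
  datum_hom k l (datum_res h x) x.
Proof.
refine (@Dh W V U k l (datum_res h x) x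
  (fun i j Z hi hj z => dt x j i hj hi (incl_trans l z)) _ _ _).
- move=> i j Z T hi hj z m ki kj t.
  exact: (@dt_res U x j i Z T hj hi _ m kj ki).
- move=> i j j' Z hi hj hk z.
  exact: (@dt_comp U x j' j i Z hk hj hi).
- move=> i j j' Z hi hj hk z.
  rewrite /= (Prop_irrelevance (incl_trans h (incl_trans k z)) (incl_trans l z)).
  exact: (@dt_comp U x j' j i Z hk hj hi (incl_trans l z)).
Defined.

Definition datum_canV U V W (h : V `<=` U) (k : W `<=` V) (l : W `<=` U) (x : datum U) :
  datum_hom l k x (datum_res h x).
Proof.
refine (@Dh W U V l k x (datum_res h x)
  (fun i j Z hi hj z => dt x j i hj hi (incl_trans l z)) _ _ _).
- move=> i j Z T hi hj z m ki kj t.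
  exact: (@dt_res U x j i Z T hj hi _ m kj ki).
- move=> i j j' Z hi hj hk z.
  rewrite /= (Prop_irrelevance (incl_trans h (incl_trans k z)) (incl_trans l z)).
  exact: (@dt_comp U x j' j i Z hk hj hi (incl_trans l z)).
- move=> i j j' Z hi hj hk z.
  exact: (@dt_comp U x j' j i Z hk hj hi).
Defined.

Definition datum_hom_res W Z U1 U2 (h1 : W `<=` U1) (h2 : W `<=` U2) (k : Z `<=` W)
  (l1 : Z `<=` U1) (l2 : Z `<=` U2) (x : datum U1) (y : datum U2) (f : datum_hom h1 h2 x y) :
  datum_hom l1 l2 x y.
Proof.
exists (fun i j T hi hj t => dm f i j hi hj (incl_trans k t)).
- by move=> *; exact: dm_res.
- move=> i j j' T hi hj hk z.
  by rewrite (Prop_irrelevance (incl_trans l2 z) (incl_trans h2 (incl_trans k z))) dm_l.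
- move=> i j j' T hi hj hk z.
  by rewrite (Prop_irrelevance (incl_trans l1 z) (incl_trans h1 (incl_trans k z))) dm_r.
Defined.

Section DComp.
Variables (W U1 U2 U3 : opens X) (h1 : W `<=` U1) (h2 : W `<=` U2).
Variables (h3 : W `<=` U3) (x : datum U1) (y : datum U2) (z : datum U3).
Variables (f : datum_hom h2 h3 y z) (g : datum_hom h1 h2 x y).

(** The entry f_jk g_ij of the product is available only where the chart j of
    the middle object is defined; compatibility with transitions makes it
    independent of j, so that these products glue. *)
Lemma datum_comp_ex : exists e : datum_hom h1 h3 x z, forall j i k Z (hi : Z `<=` dD x i)
  (hk : Z `<=` dD z k) (w : Z `<=` W) (hj : Z `<=` dD y j),
  dm e i k hi hk w = dm f j k hj hk w ⊚ dm g i j hi hj w.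
Proof.
have [|||||e eP] := datum_hom_glue (h1 := h1) (h2 := h3) (x := x) (y := z) (D := dD y)
  (s := fun j i k Z hi hk w hj => dm f j k hj hk w ⊚ dm g i j hi hj w).
- exact: incl_trans (@dcov _ y) h2.
- move=> j i k Z T hi hk w hj m ki kk t kj.
  by rewrite (lr_lc _ _ (incl_trans (dDE y j) kj)) !(dm_res _ _ _ _ _ _ _ t).
- move=> j j' i k Z hi hk w hj hj'.
  by rewrite -(dm_r f hj hj' hk w) -lcA (dm_l g hi hj hj' w).
- by move=> d i j k Z hi hj hk w hd; rewrite lcA dm_l.
- by move=> d i j k Z hi hj hk w hd; rewrite -lcA dm_r.
- by exists e => j i k Z hi hk w hj; exact: eP.
Qed.

Definition datum_comp : datum_hom h1 h3 x z := sval (cid datum_comp_ex).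

Lemma datum_compE j i k Z (hi : Z `<=` dD x i) (hk : Z `<=` dD z k) (w : Z `<=` W)
    (hj : Z `<=` dD y j) :
  dm datum_comp i k hi hk w = dm f j k hj hk w ⊚ dm g i j hi hj w.
Proof. by rewrite /datum_comp; case: cid => e /= eP; exact: eP. Qed.

End DComp.

Definition datum_lcat : lcat datum_family.
Proof.
refine (@Lcat X datum_family datum_hom datum_id datum_comp datum_hom_res _ _ _ _ _ _ _ datum_can datum_canV _ _ _).
- move=> W U1 U2 h1 h2 x y f.
  apply: (datum_hom_ext (D := dD y)); first exact: incl_trans (@dcov _ y) h2.
  by move=> d i j Z hi hj z hd; rewrite (datum_compE _ _ _ _ _ hd); exact: dm_l.
- move=> W U1 U2 h1 h2 x y f.
  apply: (datum_hom_ext (D := dD x)); first exact: incl_trans (@dcov _ x) h1.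
  by move=> d i j Z hi hj z hd; rewrite (datum_compE _ _ _ _ _ hd); exact: dm_r.
- move=> W U1 U2 U3 U4 h1 h2 h3 h4 x y z t f g e.
  apply: (datum_hom_ext (D := fun ab => meet_open (dD y ab.1) (dD z ab.2))).
    move=> w Ww; have [a _ ya] := dcov y (h2 w Ww).
    by have [b _ zb] := dcov z (h3 w Ww); exists (a, b).
  move=> [a b] i j Z hi hj w wab.
  have wa := incl_trans (@incl_meetl _ _ _) wab.
  have wb := incl_trans (@incl_meetr _ _ _) wab.
  rewrite (datum_compE _ _ _ _ _ wb) (datum_compE _ _ _ _ _ wa).
  by rewrite (datum_compE _ _ _ _ _ wa) (datum_compE _ _ _ _ _ wb) lcA.
- move=> W U1 U2 h1 h2 k x y f; apply: datum_hom_eq => i j Z hi hj z /=.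
  by rewrite (Prop_irrelevance (incl_trans k z) z).
- move=> W Z T U1 U2 h1 h2 k l1 l2 m q1 q2 n x y f.
  apply: datum_hom_eq => i j T' hi hj t /=.
  by rewrite (Prop_irrelevance (incl_trans k _) (incl_trans n t)).
- move=> W Z U h k l x; apply: datum_hom_eq => i j T hi hj t /=.
  by rewrite (Prop_irrelevance (incl_trans h _) (incl_trans l t)).
- move=> W Z U1 U2 U3 h1 h2 h3 k l1 l2 l3 x y z f g.
  apply: (datum_hom_ext (D := dD y)); first exact: incl_trans (@dcov _ y) l2.
  by move=> d i j T hi hj t hd; rewrite /= !(datum_compE _ _ _ _ _ hd).
- move=> U V W h k l x; apply: (datum_hom_ext (D := dD x)).
    exact: incl_trans (@dcov _ x) l.
  move=> d i j Z hi hj z hd; rewrite (datum_compE _ _ _ _ _ hd) /=.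
  by rewrite (Prop_irrelevance (incl_trans h _) (incl_trans l z)) dt_comp.
- move=> U V W h k l x; apply: (datum_hom_ext (D := dD x)).
    exact: incl_trans (@dcov _ x) l.
  by move=> d i j Z hi hj z hd; rewrite (datum_compE (y := datum_res h x) _ _ _ _ _ hd) /= dt_comp.
- move=> U V W Z h k l m k' l' x; apply: datum_hom_eq => i j T hi hj t /=.
  by rewrite (Prop_irrelevance (incl_trans l _) (incl_trans l' t)).
Defined.

Lemma datum_lcat_sheaf : lsheaf datum_lcat.
Proof.
move=> U1 U2 x y V I C CV cov s sP.
have sE a b i j Z (hi : Z `<=` dD x i) (hj : Z `<=` dD y j) (za : Z `<=` C a)
    (zb : Z `<=` C b) : dm (s a) i j hi hj za = dm (s b) i j hi hj zb.
  pose Z' := SubOpen2 (incl_trans (s2l (C a)) za) (incl_trans (s2r (C a)) za).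
  exact: (congr1 (fun f => dm f i j hi hj incl_refl) (sP a b Z' za zb)).
have [|||||f fP] := datum_hom_glue (h1 := s2l V) (h2 := s2r V) (x := x) (y := y) (D := C)
  (s := fun a i j Z hi hj _ za => dm (s a) i j hi hj za).
- exact: cov.
- by move=> *; exact: dm_res.
- by move=> a b i j Z hi hj _ za zb; exact: sE.
- move=> a i j k Z hi hj hk z za.
  by rewrite (Prop_irrelevance (incl_trans (s2r V) z) (incl_trans (s2r (C a)) za)) dm_l.
- move=> a i j k Z hi hj hk z za.
  by rewrite (Prop_irrelevance (incl_trans (s2l V) z) (incl_trans (s2l (C a)) za)) dm_r.
exists f; split=> [a|g gP].
  by apply: datum_hom_eq => i j Z hi hj z; rewrite /= (fP a).
apply: (datum_hom_ext (D := C)) => // a i j Z hi hj z za; rewrite (fP a) //= -(gP a) /=.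
by congr (dm g _ _ _ _ _); exact: Prop_irrelevance.
Qed.

(** The charts of the glued object are the charts of all the given ones, and the
    transition from the chart d of q_b to the chart c of q_a is the (d, c) entry
    of the gluing isomorphism q_b -> q_a.  The entries of the comparison with
    q_a are again entries of gluing isomorphisms. *)
Lemma datum_lcat_descent : ldescent datum_lcat.
Proof.
move=> U I V VU cov p t tres tid tcomp.
have trE a b W Z (ha : W `<=` V a) (hb : W `<=` V b) (za : Z `<=` V a) (zb : Z `<=` V b)
    (z : Z `<=` W) i j (hi : Z `<=` dD (p b) i) (hj : Z `<=` dD (p a) j) :
    dm (t a b W ha hb) i j hi hj z = dm (t a b Z za zb) i j hi hj incl_refl.
  by rewrite -(tres a b W Z ha hb z).
have tcE a b c Z (ha : Z `<=` V a) (hb : Z `<=` V b) (hc : Z `<=` V c) i j k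
    (hi : Z `<=` dD (p c) i) (hj : Z `<=` dD (p b) j) (hk : Z `<=` dD (p a) k) :
    dm (t a b Z ha hb) j k hj hk incl_refl ⊚ dm (t b c Z hb hc) i j hi hj incl_refl
    = dm (t a c Z ha hc) i k hi hk incl_refl.
  by rewrite -(tcomp a b c Z ha hb hc) (datum_compE _ _ _ _ _ hj).
have tiE a Z (ha ha' : Z `<=` V a) i j (hi : Z `<=` dD (p a) i) (hj : Z `<=` dD (p a) j)
    (z : Z `<=` V a) :
    dm (t a a Z ha ha') i j hi hj incl_refl = dt (p a) j i hj hi z.
  rewrite (Prop_irrelevance ha' ha) tid /=.
  by rewrite (Prop_irrelevance (incl_trans ha _) z).
pose J := {a : I & dI (p a)}.
pose E (c : J) := dE (p (tag c)) (tagged c).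
pose P (c : J) : B (E c) := dp (p (tag c)) (tagged c).
pose D (c : J) := meet_open (dD (p (tag c)) (tagged c)) (V (tag c)).
pose pr1 (c : J) W (h : W `<=` D c) := incl_trans (@incl_meetl _ _ _) h.
pose pr2 (c : J) W (h : W `<=` D c) := incl_trans (@incl_meetr _ _ _) h.
pose DE (c : J) : D c `<=` E c := incl_trans (dDE (p (tag c)) (tagged c)) (@incl_meetl _ _ _).
pose Tr (c d : J) W (hc : W `<=` D c) (hd : W `<=` D d) (h : W `<=` U) :
  lh L (incl_trans (@DE d) hd) (incl_trans (@DE c) hc) (P d) (P c) :=
  dm (t (tag c) (tag d) W (pr2 c W hc) (pr2 d W hd)) (tagged d) (tagged c)
    (pr1 d W hd) (pr1 c W hc) incl_refl.
unshelve epose (q := @Dd U J E P D DE Tr _ _ _ _).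
- move=> c d W Z hc hd h k kc kd l; rewrite /Tr.
  rewrite -(trE _ _ _ _ (pr2 c W hc) (pr2 d W hd) (pr2 c Z kc) (pr2 d Z kd) k).
  exact: (dm_res (t (tag c) (tag d) W (pr2 c W hc) (pr2 d W hd))).
- move=> c W hc h; rewrite /Tr (tiE _ _ _ _ _ _ _ _ (pr2 c W hc)).
  exact: dt_id.
- move=> c d e W hc hd he h; exact: tcE.
- move=> u /cov [a _ Vu]; have [i _ xi] := dcov (p a) Vu.
  by exists (existT _ a i).
have alex a W (h : W `<=` V a) (l : W `<=` U) : exists f : datum_hom l h q (p a),
  forall (c : J) j Z (hc : Z `<=` D c) (hj : Z `<=` dD (p a) j) (z : Z `<=` W)
    (za : Z `<=` V a),
  dm f c j hc hj z = dm (t a (tag c) Z za (pr2 c Z hc)) (tagged c) j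
    (pr1 c Z hc) hj incl_refl.
  unshelve eexists (@Dh W U (V a) l h q (p a) (fun (c : J) j Z hc hj z =>
    dm (t a (tag c) Z (incl_trans h z) (pr2 c Z hc)) (tagged c) j (pr1 c Z hc) hj
      incl_refl) _ _ _).
  - move=> c j Z T hc hj z k kc kj m.
    refine (etrans _ (trE a (tag c) Z T (incl_trans h z) (pr2 c Z hc) _ _ k _ _ _ _)).
    exact: (dm_res (t a (tag c) Z (incl_trans h z) (pr2 c Z hc))).
  - move=> c j k Z hc hj hk z.
    by rewrite -(tiE a Z (incl_trans h z) (incl_trans h z)) tcE.
  - by move=> c d k Z hc hd hk z; exact: tcE.
  - move=> c j Z hc hj z za /=.
    by rewrite (Prop_irrelevance (incl_trans h z) za).
have beex a W (h : W `<=` V a) (l : W `<=` U) : exists f : datum_hom h l (p a) q,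
  forall i (c : J) Z (hi : Z `<=` dD (p a) i) (hc : Z `<=` D c) (z : Z `<=` W)
    (za : Z `<=` V a),
  dm f i c hi hc z = dm (t (tag c) a Z (pr2 c Z hc) za) i (tagged c)
    hi (pr1 c Z hc) incl_refl.
  unshelve eexists (@Dh W (V a) U h l (p a) q (fun i (c : J) Z hi hc z =>
    dm (t (tag c) a Z (pr2 c Z hc) (incl_trans h z)) i (tagged c) hi (pr1 c Z hc)
      incl_refl) _ _ _).
  - move=> i c Z T hi hc z k ki kc m.
    refine (etrans _ (trE (tag c) a Z T (pr2 c Z hc) (incl_trans h z) _ _ k _ _ _ _)).
    exact: (dm_res (t (tag c) a Z (pr2 c Z hc) (incl_trans h z))).
  - by move=> c d k Z hc hd hk z; exact: tcE.
  - move=> i j c Z hi hj hc z.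
    by rewrite -(tiE a Z (incl_trans h z) (incl_trans h z)) tcE.
  - move=> i c Z hi hc z za /=.
    by rewrite (Prop_irrelevance (incl_trans h z) za).
pose al a W h l := sval (cid (alex a W h l)).
pose be a W h l := sval (cid (beex a W h l)).
have alE a W h l (c : J) j Z hc hj (z : Z `<=` W) za :
    dm (al a W h l) c j hc hj z = dm (t a (tag c) Z za (pr2 c Z hc)) (tagged c) j
    (pr1 c Z hc) hj incl_refl.
  exact: (svalP (cid (alex a W h l))).
have beE a W h l (c : J) i Z hi hc (z : Z `<=` W) za :
    dm (be a W h l) i c hi hc z = dm (t (tag c) a Z (pr2 c Z hc) za) i (tagged c)
    hi (pr1 c Z hc) incl_refl.
  exact: (svalP (cid (beex a W h l))).
exists q, al, be; split.
- move=> a W Z h l k h' l'; apply: datum_hom_eq => c j T hc hj z.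
  by rewrite [LHS]/= !(alE _ _ _ _ _ _ _ _ _ _ (incl_trans h' z)).
- move=> a W h l; apply: (datum_hom_ext (D := dD (p a))); first exact: incl_trans (@dcov _ (p a)) h.
  move=> j c d Z hc hd z hj; rewrite (datum_compE _ _ _ _ _ hj).
  by rewrite (alE _ _ _ _ _ _ _ _ _ _ (incl_trans h z)) (beE _ _ _ _ _ _ _ _ _ _ (incl_trans h z)) tcE.
- move=> a W h l; apply: (datum_hom_ext (D := D)); first exact: incl_trans (@dcov _ q) l.
  move=> c i j Z hi hj z hc; rewrite (datum_compE (y := q) _ _ _ _ _ hc).
  rewrite (alE _ _ _ _ _ _ _ _ _ _ (incl_trans h z)) (beE _ _ _ _ _ _ _ _ _ _ (incl_trans h z)) tcE.
  exact: tiE.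
- move=> a b W ha hb l; apply: (datum_hom_ext (D := dD (p b))); first exact: incl_trans (@dcov _ (p b)) hb.
  move=> j c i Z hc hi z hj; rewrite (datum_compE _ _ _ _ _ hj).
  rewrite (alE _ _ _ _ _ _ _ _ _ _ (incl_trans ha z)) (alE _ _ _ _ _ _ _ _ _ _ (incl_trans hb z)).
  by rewrite -(tcE a b (tag c) _ _ (incl_trans hb z) _ _ _ _ _ hj) (trE _ _ _ _ _ _ (incl_trans ha z) (incl_trans hb z)).
Qed.

(** The identity of x restricted to W, for two proofs h and h' that W is contained
    in U: the two entries of a pair of charts come with their own proofs. *)
Definition lcast W U (h h' : W `<=` U) (x : B U) : lh L h h' x x :=
  lr incl_refl h h' (lid L h x).

Lemma lcastE W U (h : W `<=` U) (x : B U) : lcast h h x = lid L h x.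
Proof. exact: lr_lid. Qed.

Definition datum_of U (x : B U) : datum U.
Proof.
exists unit (fun _ => U) (fun _ => x) (fun _ => U) (fun _ => incl_refl)
  (fun _ _ W hi hj _ => lcast hj hi x).
- move=> i j W Z hi hj h k ki kj l.
  rewrite (Prop_irrelevance hj hi) (Prop_irrelevance kj ki) !lcastE.
  exact: lr_lid.
- by move=> i W hi h; exact: lcastE.
- move=> i j j' W hi hj hk h.
  rewrite (Prop_irrelevance hj hi) (Prop_irrelevance hk hi) !lcastE.
  exact: lc1m.
- by move=> u Uu; exists tt.
Defined.

Definition datum_of_hom W U1 U2 (h1 : W `<=` U1) (h2 : W `<=` U2) (x : B U1) (y : B U2)
  (f : lh L h1 h2 x y) : datum_hom h1 h2 (datum_of x) (datum_of y).
Proof.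
refine (@Dh W U1 U2 h1 h2 (datum_of x) (datum_of y) (fun _ _ Z hi hj z => lr z hi hj f) _ _ _).
- by move=> i j Z T hi hj z k ki kj t; exact: lr_comp.
- move=> i j j' Z hi hj hk z /=.
  by rewrite (Prop_irrelevance hj hk) lcastE; exact: lc1m.
- move=> i j j' Z hi hj hk z /=.
  by rewrite (Prop_irrelevance hj hi) lcastE; exact: lcm1.
Defined.

Definition datum_of_functor : lfunctor L datum_lcat.
Proof.
exists datum_of datum_of_hom.
- move=> W U h x; apply: datum_hom_eq => i j Z hi hj z /=.
  by rewrite (Prop_irrelevance hj hi) lcastE lr_lid.
- move=> W U1 U2 U3 h1 h2 h3 x y z f g; apply: datum_hom_eq => i j Z hi hj w.
  have h : Z `<=` dD (datum_of y) tt by exact: incl_trans h2 w.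
  by rewrite [RHS](datum_compE (y := datum_of y) _ _ _ _ _ h) /= (lr_lc _ _ h).
- move=> W Z U1 U2 h1 h2 k l1 l2 x y f; apply: datum_hom_eq => i j T hi hj w /=.
  exact: lr_comp.
Defined.

(** A matrix with one row and one column amounts to its only entry. *)
Lemma datum_of_bij W U1 U2 (h1 : W `<=` U1) (h2 : W `<=` U2) (x : B U1) (y : B U2) :
  bijective (@lf _ _ _ _ _ datum_of_functor W U1 U2 h1 h2 x y).
Proof.
exists (fun f : datum_hom h1 h2 (datum_of x) (datum_of y) => dm f tt tt h1 h2 incl_refl) => f.
  exact: lr_id.
apply: datum_hom_eq => -[] [] Z hi hj z /=.
exact: (dm_res f).
Qed.

(** Over the i-th open subset, q is isomorphic to p_i by the transitions into the
    chart i. *)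
Lemma datum_of_chart U (q : datum U) (v : X) : (U : set X) v ->
  exists c : chart datum_of_functor q, (cdom c : set X) v.
Proof.
move=> Uv; have [i _ Dv] := dcov q Uv.
pose W := meet_open U (dD q i); pose wU := @incl_meetl _ U (dD q i).
pose wD := @incl_meetr _ U (dD q i).
pose k := incl_trans (dDE q i) wD; pose p := dp q i ↾ k.
pose hi Z (z : Z `<=` W) := incl_trans (dDE q i) (incl_trans wD z).
unshelve epose (f := @Dh W W U incl_refl wU (datum_of p) q
  (fun (_ : unit) j Z z hj _ =>
    dt q j i hj (incl_trans wD z) (incl_trans wU z) ⊚ lcan L k z (hi Z z) (dp q i))
  _ _ _).
- move=> u j Z T z hj z' m t kj t'.
  rewrite [LHS](lr_lc m t (hi T t)) lr_lcan.
  by rewrite (dt_res _ _ _ _ _ _ (incl_trans wU t)).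
- move=> u j j' Z z hj hj' z' /=.
  by rewrite lcA (Prop_irrelevance z' z) dt_comp.
- move=> [] [] j Z z z' hj w /=.
  by rewrite (Prop_irrelevance z' z) lcastE; exact: lcm1.
unshelve epose (g := @Dh W U W wU incl_refl q (datum_of p)
  (fun j (_ : unit) Z hj z _ =>
    lcanV L k z (hi Z z) (dp q i) ⊚ dt q i j (incl_trans wD z) hj (incl_trans wU z))
  _ _ _).
- move=> j u Z T hj z z' m kj t t'.
  rewrite [LHS](lr_lc m (incl_trans (dDE q j) kj) (hi T t) t) lr_lcanV.
  by rewrite (dt_res _ _ _ _ _ _ (incl_trans wU t)).
- move=> j [] [] Z hj z z' w /=.
  by rewrite (Prop_irrelevance z' z) lcastE; exact: lc1m.
- move=> j j' u Z hj hj' z z' /=.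
  by rewrite -lcA (Prop_irrelevance z' z) dt_comp.
have gf : datum_comp g f = datum_id incl_refl (datum_of p).
  apply: (datum_hom_ext (D := dD q)); first exact: incl_trans (@dcov _ q) wU.
  move=> j [] [] Z z z' w hj; rewrite (datum_compE _ _ _ _ _ hj) /=.
  rewrite (Prop_irrelevance z' z) lcastE lcA -[X in X ⊚ _ = _]lcA.
  by rewrite dt_comp dt_id lcm1 lcanK.
have fg : datum_comp f g = datum_id wU q.
  apply: datum_hom_eq => j j' Z hj hj' z; rewrite (datum_compE (y := datum_of p) (j := tt) _ _ _ _ _ z) /=.
  by rewrite lcA lcanVKr dt_comp.
by exists (@Chart _ _ _ _ _ datum_of_functor U q W wU p f g gf fg).
Qed.

End Stackification.
Arguments dI {X B L U} _ : rename.
Arguments dE {X B L U} _ _ : rename.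
Arguments dp {X B L U} _ _ : rename.
Arguments dD {X B L U} _ _ : rename.
Arguments dDE {X B L U} _ _ _ _ : rename.
Arguments dt {X B L U} _ _ _ {W} : rename.
Arguments dm {X B L W U1 U2 h1 h2 x y} f i j {Z} hi hj z : rename.

(** * Linear structures *)

Section MakeLmodule.
Variables (R : pzRingType) (T : Type).
Variables (zero : T) (opp : T -> T) (add : T -> T -> T) (scale : R -> T -> T).
Hypotheses (addA : associative add) (addC : commutative add).
Hypotheses (add0 : left_id zero add) (addN : left_inverse zero opp add).
Hypotheses (scaleA : forall a b v, scale a (scale b v) = scale (a * b) v).
Hypotheses (scale1 : left_id 1 scale).
Hypotheses (scaleDr : right_distributive scale add).
Hypotheses (scaleDl : forall v a b, scale (a + b) v = add (scale a v) (scale b v)).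

(** Morphisms carry no decidable equality; classical choice provides the
    structures on which modules are built. *)
Definition mk_choice : choiceType :=
  HB.pack T (gen_eqMixin T) (gen_choiceMixin T).

Definition mk_zmod : zmodType :=
  HB.pack (Choice.sort mk_choice) (GRing.isZmodule.Build mk_choice addA addC add0 addN).

Definition mk_lmod : lmodType R :=
  HB.pack (GRing.Zmodule.sort mk_zmod)
    (GRing.Zmodule_isLmodule.Build R mk_zmod scaleA scale1 scaleDr scaleDl).

Definition mk_lmodule : GRing.Lmodule R T := GRing.Lmodule.class mk_lmod.

End MakeLmodule.

(** Module structures on local morphisms, compatible with composition and
    restriction. *)
Record llin (X : topologicalType) (R : ring_sheaf X) (B : obj_family X)
    (L : lcat B) := Llin {
  ll_mod : forall (W U1 U2 : opens X) (h1 : W `<=` U1) (h2 : W `<=` U2)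
    (x : B U1) (y : B U2), GRing.Lmodule (R W) (lh L h1 h2 x y);
  llm : forall (W U1 U2 : opens X) (h1 : W `<=` U1) (h2 : W `<=` U2)
    (x : B U1) (y : B U2), lmodType (R W) :=
    fun W U1 U2 h1 h2 x y => GRing.Lmodule.Pack (ll_mod h1 h2 x y);
  ll_addl : forall (W U1 U2 U3 : opens X) (h1 : W `<=` U1) (h2 : W `<=` U2)
    (h3 : W `<=` U3) (x : B U1) (y : B U2) (z : B U3) (f1 f2 : llm h2 h3 y z)
    (g : llm h1 h2 x y),
    (f1 + f2 : llm h2 h3 y z) ⊚ g = (f1 ⊚ g : llm h1 h3 x z) + f2 ⊚ g;
  ll_addr : forall (W U1 U2 U3 : opens X) (h1 : W `<=` U1) (h2 : W `<=` U2)
    (h3 : W `<=` U3) (x : B U1) (y : B U2) (z : B U3) (f : llm h2 h3 y z)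
    (g1 g2 : llm h1 h2 x y),
    f ⊚ (g1 + g2 : llm h1 h2 x y) = (f ⊚ g1 : llm h1 h3 x z) + f ⊚ g2;
  ll_scalel : forall (W U1 U2 U3 : opens X) (h1 : W `<=` U1) (h2 : W `<=` U2)
    (h3 : W `<=` U3) (x : B U1) (y : B U2) (z : B U3) (r : R W)
    (f : llm h2 h3 y z) (g : llm h1 h2 x y),
    (r *: f : llm h2 h3 y z) ⊚ g = r *: (f ⊚ g : llm h1 h3 x z);
  ll_scaler : forall (W U1 U2 U3 : opens X) (h1 : W `<=` U1) (h2 : W `<=` U2)
    (h3 : W `<=` U3) (x : B U1) (y : B U2) (z : B U3) (r : R W)
    (f : llm h2 h3 y z) (g : llm h1 h2 x y),
    f ⊚ (r *: g : llm h1 h2 x y) = r *: (f ⊚ g : llm h1 h3 x z);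
  ll_radd : forall (W Z U1 U2 : opens X) (h1 : W `<=` U1) (h2 : W `<=` U2)
    (k : Z `<=` W) (l1 : Z `<=` U1) (l2 : Z `<=` U2) (x : B U1) (y : B U2)
    (f g : llm h1 h2 x y),
    lr k l1 l2 (f + g : llm h1 h2 x y)
    = (lr k l1 l2 f : llm l1 l2 x y) + lr k l1 l2 g;
  ll_rscale : forall (W Z U1 U2 : opens X) (h1 : W `<=` U1) (h2 : W `<=` U2)
    (k : Z `<=` W) (l1 : Z `<=` U1) (l2 : Z `<=` U2) (x : B U1) (y : B U2)
    (r : R W) (f : llm h1 h2 x y),
    lr k l1 l2 (r *: f : llm h1 h2 x y)
    = rres R k r *: (lr k l1 l2 f : llm l1 l2 x y) }.
Arguments llm {X R B L} _ {W U1 U2} h1 h2 x y : rename.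

Section Linear.
Variables (X : topologicalType) (R : ring_sheaf X).
Implicit Types U V W Z T : opens X.

Definition linear_of (B : obj_family X) (L : lcat B) (M : llin R L) :
  linear_structure R (Prestack (prestack_of L)).
Proof.
unshelve eexists (fun U p' p => ll_mod M incl_refl incl_refl p' p).
- by move=> U p'' p' p f1 f2 g; exact: (ll_addl (l := M)).
- by move=> U p'' p' p f g1 g2; exact: (ll_addr (l := M)).
- by move=> U p'' p' p r f g; exact: (ll_scalel (l := M)).
- by move=> U p'' p' p r f g; exact: (ll_scaler (l := M)).
- move=> U V h p' p f g; rewrite /= /pres_of /ldown.
  by rewrite (ll_radd (l := M)) (ll_addr (l := M)) (ll_addl (l := M)).
- move=> U V h p' p r f; rewrite /= /pres_of /ldown.
  by rewrite (ll_rscale (l := M)) (ll_scaler (l := M)) (ll_scalel (l := M)).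
Defined.

Definition llin_of (C : prestack X) (L0 : linear_structure R C) : llin R (lcat_of C).
Proof.
unshelve eexists (fun W U1 U2 h1 h2 x y => lmod L0 (x ↾ h1) (y ↾ h2)).
- by move=> W U1 U2 U3 h1 h2 h3 x y z f1 f2 g; exact: (comp_addl (l := L0)).
- by move=> W U1 U2 U3 h1 h2 h3 x y z f g1 g2; exact: (comp_addr (l := L0)).
- by move=> W U1 U2 U3 h1 h2 h3 x y z r f g; exact: (comp_scalel (l := L0)).
- by move=> W U1 U2 U3 h1 h2 h3 x y z r f g; exact: (comp_scaler (l := L0)).
- move=> W Z U1 U2 h1 h2 k l1 l2 x y f g; rewrite /= /lres.
  by rewrite (pres_add (l := L0)) (comp_addr (l := L0)) (comp_addl (l := L0)).
- move=> W Z U1 U2 h1 h2 k l1 l2 x y r f; rewrite /= /lres.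
  by rewrite (pres_scale (l := L0)) (comp_scaler (l := L0)) (comp_scalel (l := L0)).
Defined.

Section DDLinear.
Variables (B : obj_family X) (L : lcat B).
Hypothesis Lsh : lsheaf L.
Variable M : llin R L.

Section Ops.
Variables (W U1 U2 : opens X) (h1 : W `<=` U1) (h2 : W `<=` U2).
Variables (x : datum L U1) (y : datum L U2).
Implicit Types f g : datum_hom h1 h2 x y.
Local Notation T i j hi hj := (llm M (incl_trans (dDE x i) hi)
  (incl_trans (dDE y j) hj) (dp x i) (dp y j)).
Let addl := ll_addl (l := M).
Let addr := ll_addr (l := M).
Let scalel := ll_scalel (l := M).
Let scaler := ll_scaler (l := M).
Let radd := ll_radd (l := M).
Let rscale := ll_rscale (l := M).

Let zerol V V1 V2 V3 (k1 : V `<=` V1) (k2 : V `<=` V2) (k3 : V `<=` V3) (a : B V1)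
  (b : B V2) (c : B V3) (e : llm M k1 k2 a b) :
  ((0 : llm M k2 k3 b c) ⊚ e : llm M k1 k3 a c) = 0.
Proof. by rewrite -[X in X ⊚ e](scale0r (0 : llm M k2 k3 b c)) scalel scale0r. Qed.
Let zeror V V1 V2 V3 (k1 : V `<=` V1) (k2 : V `<=` V2) (k3 : V `<=` V3) (a : B V1)
  (b : B V2) (c : B V3) (e : llm M k2 k3 b c) :
  (e ⊚ (0 : llm M k1 k2 a b) : llm M k1 k3 a c) = 0.
Proof. by rewrite -[X in e ⊚ X](scale0r (0 : llm M k1 k2 a b)) scaler scale0r. Qed.

Definition datum_add f g : datum_hom h1 h2 x y.
Proof.
refine (@Dh _ _ _ _ _ _ h1 h2 x y (fun i j Z hi hj z =>
  (dm f i j hi hj z : T i j hi hj) + dm g i j hi hj z) _ _ _).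
- move=> i j Z V hi hj z k ki kj t.
  by rewrite radd (dm_res f _ _ _ _ _ _ t) (dm_res g _ _ _ _ _ _ t).
- by move=> i j k Z hi hj hk z; rewrite addr !dm_l.
- by move=> i j k Z hi hj hk z; rewrite addl !dm_r.
Defined.

Definition datum_scale (r : R W) f : datum_hom h1 h2 x y.
Proof.
refine (@Dh _ _ _ _ _ _ h1 h2 x y (fun i j Z hi hj z =>
  rres R z r *: (dm f i j hi hj z : T i j hi hj)) _ _ _).
- move=> i j Z V hi hj z k ki kj t.
  by rewrite rscale (rres_comp z k t) (dm_res f _ _ _ _ _ _ t).
- by move=> i j k Z hi hj hk z; rewrite scaler !dm_l.
- by move=> i j k Z hi hj hk z; rewrite scalel !dm_r.
Defined.

Definition datum_zero : datum_hom h1 h2 x y.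
Proof.
refine (@Dh _ _ _ _ _ _ h1 h2 x y (fun i j Z hi hj z => 0 : T i j hi hj) _ _ _).
- move=> i j Z V hi hj z k ki kj t.
  by rewrite -[X in lr _ _ _ X](scale0r (0 : T i j hi hj)) rscale rmorph0 scale0r.
- by move=> i j k Z hi hj hk z; exact: zeror.
- by move=> i j k Z hi hj hk z; exact: zerol.
Defined.

Definition datum_lmodule : GRing.Lmodule (R W) (datum_hom h1 h2 x y).
Proof.
apply: (@mk_lmodule (R W) (datum_hom h1 h2 x y) datum_zero (datum_scale (-1)) datum_add datum_scale).
- by move=> f g e; apply: datum_hom_eq => i j Z hi hj z; rewrite /= addrA.
- by move=> f g; apply: datum_hom_eq => i j Z hi hj z; rewrite /= addrC.
- by move=> f; apply: datum_hom_eq => i j Z hi hj z; rewrite /= add0r.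
- move=> f; apply: datum_hom_eq => i j Z hi hj z /=.
  by rewrite rmorphN1 scaleN1r addNr.
- by move=> a b f; apply: datum_hom_eq => i j Z hi hj z; rewrite /= scalerA rmorphM.
- by move=> f; apply: datum_hom_eq => i j Z hi hj z; rewrite /= rmorph1 scale1r.
- by move=> a f g; apply: datum_hom_eq => i j Z hi hj z; rewrite /= scalerDr.
- by move=> f a b; apply: datum_hom_eq => i j Z hi hj z; rewrite /= rmorphD scalerDl.
Defined.

Definition datum_lmodType : lmodType (R W) := GRing.Lmodule.Pack datum_lmodule.

Lemma datum_addE (f g : datum_lmodType) i j Z (hi : Z `<=` dD x i) (hj : Z `<=` dD y j) z :
  dm (f + g : datum_lmodType) i j hi hj z = (dm f i j hi hj z : T i j hi hj) + dm g i j hi hj z.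
Proof. by []. Qed.

Lemma datum_scaleE r (f : datum_lmodType) i j Z (hi : Z `<=` dD x i) (hj : Z `<=` dD y j) z :
  dm (r *: f : datum_lmodType) i j hi hj z = rres R z r *: (dm f i j hi hj z : T i j hi hj).
Proof. by []. Qed.

End Ops.

Definition datum_llin : llin R (datum_lcat Lsh).
Proof.
refine (@Llin X R _ (datum_lcat Lsh) (fun W U1 U2 h1 h2 x y => datum_lmodule h1 h2 x y) _ _ _ _ _ _).
- move=> W U1 U2 U3 h1 h2 h3 x y z f1 f2 g.
  apply: (datum_hom_ext Lsh (D := dD y)); first exact: incl_trans (@dcov _ _ _ _ y) h2.
  move=> d i j Z hi hj w hd; rewrite [RHS]datum_addE.
  by rewrite !(datum_compE Lsh _ _ _ _ _ hd) datum_addE (ll_addl (l := M)).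
- move=> W U1 U2 U3 h1 h2 h3 x y z f g1 g2.
  apply: (datum_hom_ext Lsh (D := dD y)); first exact: incl_trans (@dcov _ _ _ _ y) h2.
  move=> d i j Z hi hj w hd; rewrite [RHS]datum_addE.
  by rewrite !(datum_compE Lsh _ _ _ _ _ hd) datum_addE (ll_addr (l := M)).
- move=> W U1 U2 U3 h1 h2 h3 x y z r f g.
  apply: (datum_hom_ext Lsh (D := dD y)); first exact: incl_trans (@dcov _ _ _ _ y) h2.
  move=> d i j Z hi hj w hd; rewrite [RHS]datum_scaleE.
  by rewrite !(datum_compE Lsh _ _ _ _ _ hd) datum_scaleE (ll_scalel (l := M)).
- move=> W U1 U2 U3 h1 h2 h3 x y z r f g.
  apply: (datum_hom_ext Lsh (D := dD y)); first exact: incl_trans (@dcov _ _ _ _ y) h2.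
  move=> d i j Z hi hj w hd; rewrite [RHS]datum_scaleE.
  by rewrite !(datum_compE Lsh _ _ _ _ _ hd) datum_scaleE (ll_scaler (l := M)).
- by move=> W Z U1 U2 h1 h2 k l1 l2 x y f g; apply: datum_hom_eq.
- move=> W Z U1 U2 h1 h2 k l1 l2 x y r f; apply: datum_hom_eq => i j V hi hj z.
  by rewrite [RHS]datum_scaleE (rres_comp k z (incl_trans k z)).
Defined.

Lemma datum_of_add W U1 U2 (h1 : W `<=` U1) (h2 : W `<=` U2) (x : B U1) (y : B U2)
    (f g : llm M h1 h2 x y) :
  datum_of_hom (f + g : llm M h1 h2 x y)
  = (datum_of_hom f : llm datum_llin h1 h2 (datum_of L x) (datum_of L y)) + datum_of_hom g.
Proof. by apply: datum_hom_eq => i j Z hi hj z; rewrite datum_addE; exact: (ll_radd (l := M)). Qed.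

Lemma datum_of_scale W U1 U2 (h1 : W `<=` U1) (h2 : W `<=` U2) (x : B U1) (y : B U2)
    r (f : llm M h1 h2 x y) :
  datum_of_hom (r *: f : llm M h1 h2 x y)
  = r *: (datum_of_hom f : llm datum_llin h1 h2 (datum_of L x) (datum_of L y)).
Proof. by apply: datum_hom_eq => i j Z hi hj z; rewrite datum_scaleE; exact: (ll_rscale (l := M)). Qed.

End DDLinear.
End Linear.

(** * The associated stack of a separated prestack *)

Definition ldown_functor (X : topologicalType) (B : obj_family X) (L : lcat B) :
  lfunctor L (lcat_of (Prestack (prestack_of L))).
Proof.
exists (fun U x => x)
  (fun W U1 U2 h1 h2 x y f => ldown h1 h2 incl_refl incl_refl f).
- by move=> W U h x; exact: ldown_id.
- by move=> W U1 U2 U3 h1 h2 h3 x y z f g; exact: ldown_comp.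
- by move=> W Z U1 U2 h1 h2 k l1 l2 x y f; exact/esym/lres_down.
Defined.

Definition iso_of (X : topologicalType) (B : obj_family X) (L : lcat B)
  (W U : opens X) (h : W `<=` U) (p : B W) (q : B U) (f : lh L incl_refl h p q)
  (g : lh L h incl_refl q p) (gf : g ⊚ f = lid L incl_refl p)
  (fg : f ⊚ g = lid L h q) : iso (pcat_of L W) p (q ↾ h).
Proof.
exists (lcanV L h incl_refl h q ⊚ f) (g ⊚ lcan L h incl_refl h q).
- by rewrite [LHS]/= !lcA lcanVKr.
- by rewrite [LHS]/= !lcA (lcKr _ fg) lcanK.
Defined.

Lemma linear_glob (X : topologicalType) (R : ring_sheaf X) (C : prestack X)
  (L0 : linear_structure R C) (U : opens X) (x y : C U) :
  (forall f g : hom_lmod L0 (x ↾ incl_refl) (y ↾ incl_refl),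
    glob (f + g : hom_lmod L0 _ _) = (glob f : hom_lmod L0 x y) + glob g) /\
  (forall r (f : hom_lmod L0 (x ↾ incl_refl) (y ↾ incl_refl)),
    glob (r *: f : hom_lmod L0 _ _) = r *: (glob f : hom_lmod L0 x y)).
Proof.
split=> [f g|r f]; rewrite /glob.
  by rewrite (comp_addr (l := L0)) (comp_addl (l := L0)).
by rewrite (comp_scaler (l := L0)) (comp_scalel (l := L0)).
Qed.

Lemma ldown_linear (X : topologicalType) (R : ring_sheaf X) (B : obj_family X)
  (L : lcat B) (M : llin R L) (W U1 U2 V1 V2 : opens X) (h1 : V1 `<=` U1) (h2 : V2 `<=` U2)
  (k1 : W `<=` V1) (k2 : W `<=` V2) (l1 : W `<=` U1) (l2 : W `<=` U2)
  (x : B U1) (y : B U2) :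
  (forall f g : llm M l1 l2 x y, ldown h1 h2 k1 k2 (f + g : llm M l1 l2 x y)
    = (ldown h1 h2 k1 k2 f : llm M k1 k2 _ _) + ldown h1 h2 k1 k2 g) /\
  (forall r (f : llm M l1 l2 x y), ldown h1 h2 k1 k2 (r *: f : llm M l1 l2 x y)
    = r *: (ldown h1 h2 k1 k2 f : llm M k1 k2 _ _)).
Proof.
split=> [f g|r f]; rewrite /ldown.
  by rewrite (ll_addr (l := M)) (ll_addl (l := M)).
by rewrite (ll_scaler (l := M)) (ll_scalel (l := M)).
Qed.

Section FunctorTo.
Variables (X : topologicalType) (R : ring_sheaf X) (C : prestack X).
Variables (L0 : linear_structure R C) (B : obj_family X) (L : lcat B) (M : llin R L).
Variable F : lfunctor (lcat_of C) L.

Definition functor_to : functor C (Prestack (prestack_of L)) :=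
  functor_of (lfcomp (ldown_functor L) F).

Lemma functor_to_ff :
  (forall (U : opens X) (x y : C U),
    bijective (@lf _ _ _ _ _ F U U U incl_refl incl_refl x y)) ->
  forall (U : opens X) (x y : C U), bijective (@fun_hom _ _ _ functor_to U x y).
Proof.
move=> b2 U x y.
have b1 : bijective (@pres X C C U U incl_refl x y).
  exact: Bijective (@presK _ _ _ _ _) (@globK _ _ _ _ _).
have b3 : bijective (@ldown _ _ L U U U U U incl_refl incl_refl incl_refl incl_refl
    incl_refl incl_refl (F U x) (F U y)).
  exact: Bijective (@ldownK _ _ _ _ _ _ _ _ _ _ _ _ _ _ _ _)
    (@lupK _ _ _ _ _ _ _ _ _ _ _ _ _ _ _ _).
have b4 : bijective (@glob X (Prestack (prestack_of L)) U (functor_to U x) (functor_to U y)).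
  exact: Bijective (@globK _ _ _ _ _) (@presK _ _ _ _ _).
exact: bij_comp b4 (bij_comp b3 (bij_comp (b2 U x y) b1)).
Qed.

(** Passing from local morphisms over U to morphisms over U is a composition with
    isomorphisms on both sides, hence linear. *)
Lemma functor_to_linear :
  (forall (U : opens X) (x y : C U) (f g : llm (llin_of L0) incl_refl incl_refl x y),
    lf F (f + g : llm (llin_of L0) incl_refl incl_refl x y)
    = (lf F f : llm M incl_refl incl_refl _ _) + lf F g) ->
  (forall (U : opens X) (x y : C U) r (f : llm (llin_of L0) incl_refl incl_refl x y),
    lf F (r *: f : llm (llin_of L0) incl_refl incl_refl x y)
    = r *: (lf F f : llm M incl_refl incl_refl _ _)) ->
  linear_functor L0 (linear_of M) functor_to.
Proof.
move=> FD FZ; pose phi := lfcomp (ldown_functor L) F.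
have addD U (x y : C U) (f g : llm (llin_of L0) incl_refl incl_refl x y) :
  lf phi (f + g : llm (llin_of L0) incl_refl incl_refl x y)
  = (lf phi f : hom_lmod (linear_of M) _ _) + lf phi g.
  by rewrite /= FD; exact: (ldown_linear M _ _ _ _ _ _ _ _).1.
have scaleD U (x y : C U) r (f : llm (llin_of L0) incl_refl incl_refl x y) :
  lf phi (r *: f : llm (llin_of L0) incl_refl incl_refl x y)
  = r *: (lf phi f : hom_lmod (linear_of M) _ _).
  by rewrite /= FZ; exact: (ldown_linear M _ _ _ _ _ _ _ _).2.
split=> U x y.
- move=> f g; rewrite [LHS]/(fo_hom phi _) /fo_hom (pres_add (l := L0)).
  rewrite [X in glob X]addD; exact: (linear_glob (linear_of M) _ _).1.
- move=> r f; rewrite [LHS]/(fo_hom phi _) /fo_hom (pres_scale (l := L0)) rres_id.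
  rewrite [X in glob X]scaleD; exact: (linear_glob (linear_of M) _ _).2.
Qed.

End FunctorTo.

Theorem stackification (X : topologicalType) (R : ring_sheaf X) (C : prestack X)
    (L0 : linear_structure R C) :
  separated_prestack C ->
  exists (A : prestack X) (L : linear_structure R A) (i : functor C A),
  [/\ associated_stack i, linear_functor L0 L i,
      forall (U : opens X) (x y : C U), bijective (@fun_hom X C A i U x y)
    & forall (U : opens X) (q : A U) x, (U : set X) x ->
      exists W : sub_open U, (W : set X) x /\
        exists p : C W, inhabited (iso (pcat A W) (i W p) (q ↾ sincl W))].
Proof.
move=> Csep; have Lsh := separated_lsheaf Csep.
pose M := datum_llin Lsh (llin_of L0); pose i := functor_to (datum_of_functor Lsh).
have Ast : stack (Prestack (prestack_of (datum_lcat Lsh))).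
  split; first exact/lsheaf_separated/datum_lcat_sheaf.
  exact/ldescent_descent/datum_lcat_descent.
have i_ff (U : opens X) (x y : C U) : bijective (@fun_hom _ _ _ i U x y).
  by apply: functor_to_ff => V p' p; exact: datum_of_bij.
have i_ess (U : opens X) (q : Prestack (prestack_of (datum_lcat Lsh)) U) x : (U : set X) x ->
    exists W : sub_open U, (W : set X) x /\
      exists p : C W, inhabited (iso (pcat (Prestack (prestack_of (datum_lcat Lsh))) W) (i W p) (q ↾ sincl W)).
  move=> /(datum_of_chart Lsh q) [[W wU p f g gf fg] /= Wx].
  by exists (SubOpen wU); split=> //; exists p; constructor; exact: iso_of gf fg.
exists (Prestack (prestack_of (datum_lcat Lsh))), (linear_of M), i; split=> //.
  exact: associated_stackP.
by apply: functor_to_linear => [U x y f g|U x y r f];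
  [exact: datum_of_add|exact: datum_of_scale].
Qed.

(** * Equivariant functions on a groupoid *)

(** The content of an algebroid data in terms of local morphisms: a locally
    connected groupoid, the algebras [tA] with the action [tm] of morphisms on
    them, and the homomorphisms [tell]. *)
Record twist_data (X : topologicalType) (R : ring_sheaf X) (B : obj_family X)
    (L : lcat B) := TwistData {
  tinv : forall (W U1 U2 : opens X) (h1 : W `<=` U1) (h2 : W `<=` U2) (x : B U1)
    (y : B U2), lh L h1 h2 x y -> lh L h2 h1 y x;
  tinvK : forall (W U1 U2 : opens X) (h1 : W `<=` U1) (h2 : W `<=` U2) (x : B U1)
    (y : B U2) (f : lh L h1 h2 x y), tinv f ⊚ f = lid L h1 x;
  tinvVK : forall (W U1 U2 : opens X) (h1 : W `<=` U1) (h2 : W `<=` U2) (x : B U1)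
    (y : B U2) (f : lh L h1 h2 x y), f ⊚ tinv f = lid L h2 y;
  tloc : forall (W U1 U2 : opens X) (h1 : W `<=` U1) (h2 : W `<=` U2) (x : B U1)
    (y : B U2) (v : X), (W : set X) v ->
    exists (Z : opens X) (z : Z `<=` W) (l1 : Z `<=` U1) (l2 : Z `<=` U2),
      (Z : set X) v /\ inhabited (lh L l1 l2 x y);
  tA : forall (W U : opens X) (h : W `<=` U) (x : B U), pzRingType;
  tstr : forall (W U : opens X) (h : W `<=` U) (x : B U), {rmorphism R W -> tA h x};
  tstrC : forall (W U : opens X) (h : W `<=` U) (x : B U) (r : R W) (a : tA h x),
    tstr h x r * a = a * tstr h x r;
  ta : forall (W Z U : opens X) (h : W `<=` U) (k : Z `<=` W) (l : Z `<=` U)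
    (x : B U), {rmorphism tA h x -> tA l x};
  ta_id : forall (W U : opens X) (h : W `<=` U) (k : W `<=` W) (x : B U)
    (a : tA h x), ta h k h x a = a;
  ta_comp : forall (W Z T U : opens X) (h : W `<=` U) (k : Z `<=` W) (l : Z `<=` U)
    (m : T `<=` Z) (n : T `<=` U) (q : T `<=` W) (x : B U) (a : tA h x),
    ta l m n x (ta h k l x a) = ta h q n x a;
  ta_str : forall (W Z U : opens X) (h : W `<=` U) (k : Z `<=` W) (l : Z `<=` U)
    (x : B U) (r : R W), ta h k l x (tstr h x r) = tstr l x (rres R k r);
  ta_sheaf : forall (U : opens X) (x : B U),
    sheaf_axiom (o := @sopen X U) (S := fun V => tA (sincl V) x)
      (fun V W k => ta (sincl V) k (sincl W) x);
  tm : forall (W U1 U2 : opens X) (h1 : W `<=` U1) (h2 : W `<=` U2) (x : B U1)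
    (y : B U2), lh L h1 h2 x y -> tA h1 x -> tA h2 y;
  tmD : forall (W U1 U2 : opens X) (h1 : W `<=` U1) (h2 : W `<=` U2) (x : B U1)
    (y : B U2) (g : lh L h1 h2 x y), {morph tm g : a b / a + b};
  tmM : forall (W U1 U2 : opens X) (h1 : W `<=` U1) (h2 : W `<=` U2) (x : B U1)
    (y : B U2) (g : lh L h1 h2 x y), {morph tm g : a b / a * b};
  tm_str : forall (W U1 U2 : opens X) (h1 : W `<=` U1) (h2 : W `<=` U2) (x : B U1)
    (y : B U2) (g : lh L h1 h2 x y) (r : R W), tm g (tstr h1 x r) = tstr h2 y r;
  tm_id : forall (W U : opens X) (h : W `<=` U) (x : B U) (a : tA h x),
    tm (lid L h x) a = a;
  tm_comp : forall (W U1 U2 U3 : opens X) (h1 : W `<=` U1) (h2 : W `<=` U2)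
    (h3 : W `<=` U3) (x : B U1) (y : B U2) (z : B U3) (f : lh L h2 h3 y z)
    (g : lh L h1 h2 x y) (a : tA h1 x), tm (f ⊚ g) a = tm f (tm g a);
  tm_res : forall (W Z U1 U2 : opens X) (h1 : W `<=` U1) (h2 : W `<=` U2)
    (k : Z `<=` W) (l1 : Z `<=` U1) (l2 : Z `<=` U2) (x : B U1) (y : B U2)
    (g : lh L h1 h2 x y) (a : tA h1 x),
    ta h2 k l2 y (tm g a) = tm (lr k l1 l2 g) (ta h1 k l1 x a);
  tell : forall (W U : opens X) (h : W `<=` U) (x : B U), lh L h h x x -> tA h x;
  tell_id : forall (W U : opens X) (h : W `<=` U) (x : B U),
    tell (lid L h x) = 1;
  tellM : forall (W U : opens X) (h : W `<=` U) (x : B U) (f g : lh L h h x x),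
    tell (f ⊚ g) = tell f * tell g;
  tell_res : forall (W Z U : opens X) (h : W `<=` U) (k : Z `<=` W) (l : Z `<=` U)
    (x : B U) (f : lh L h h x x), tell (lr k l l f) = ta h k l x (tell f);
  tell_Ad : forall (W U : opens X) (h : W `<=` U) (x : B U) (f : lh L h h x x)
    (a : tA h x), tm f a = tell f * a * tell (tinv f);
  tell_conj : forall (W U1 U2 : opens X) (h1 : W `<=` U1) (h2 : W `<=` U2)
    (x : B U1) (y : B U2) (g : lh L h1 h2 x y) (f : lh L h1 h1 x x),
    tell (g ⊚ f ⊚ tinv g) = tm g (tell f) }.

Section Twist.
Variables (X : topologicalType) (R : ring_sheaf X) (B : obj_family X).
Variables (L : lcat B) (D : twist_data R L).
Implicit Types U V W Z T : opens X.
Local Notation inv := (tinv D).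
Local Notation Al := (tA D).
Local Notation ell := (tell D).
Local Notation act := (@tm _ _ _ _ D _ _ _ _ _ _ _).
Local Notation rs k l := (ta D _ k l _).

Lemma tinv_lc W U1 U2 U3 (h1 : W `<=` U1) (h2 : W `<=` U2) (h3 : W `<=` U3)
    (x : B U1) (y : B U2) (z : B U3) (f : lh L h2 h3 y z) (g : lh L h1 h2 x y) :
  inv (f ⊚ g) = inv g ⊚ inv f.
Proof.
rewrite -[LHS]lcm1 -(tinvVK D f) -[X in X ⊚ inv f](lcKr f (tinvVK D g)) !lcA.
by rewrite -[X in X ⊚ _ ⊚ _ = _]lcA tinvK lc1m.
Qed.

Lemma lr_tinv W Z U1 U2 (h1 : W `<=` U1) (h2 : W `<=` U2) (k : Z `<=` W)
    (l1 : Z `<=` U1) (l2 : Z `<=` U2) (x : B U1) (y : B U2) (f : lh L h1 h2 x y) :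
  lr k l2 l1 (inv f) = inv (lr k l1 l2 f).
Proof.
rewrite -[LHS]lcm1 -(tinvVK D (lr k l1 l2 f)) lcA -lr_lc tinvK lr_lid.
by rewrite lc1m.
Qed.

Lemma inv_inv W U1 U2 (h1 : W `<=` U1) (h2 : W `<=` U2) (x : B U1) (y : B U2)
  (f : lh L h1 h2 x y) : inv (inv f) = f.
Proof. by rewrite -[LHS]lc1m -(tinvVK D f) -lcA tinvVK lcm1. Qed.

Lemma ell_inv W U (h : W `<=` U) (x : B U) (f : lh L h h x x) :
  ell f * ell (inv f) = 1.
Proof. by rewrite -tellM tinvVK tell_id. Qed.

Lemma ell_invl W U (h : W `<=` U) (x : B U) (f : lh L h h x x) :
  ell (inv f) * ell f = 1.
Proof. by rewrite -tellM tinvK tell_id. Qed.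

Lemma ell_inv_unique W U (h : W `<=` U) (x : B U) (f : lh L h h x x) (a b : Al h x) :
  a * ell f = b -> a = b * ell (inv f).
Proof. by move=> <-; rewrite -mulrA ell_inv mulr1. Qed.

Lemma tglue U (x : B U) W (h : W `<=` U)
    (Q : forall Z (z : Z `<=` W) (l : Z `<=` U), Al l x -> Prop) :
  (forall v, (W : set X) v -> exists Z z l a, (Z : set X) v /\ Q Z z l a) ->
  (forall Z Z' z z' l l' a a', Q Z z l a -> Q Z' z' l' a' ->
     forall T (t : T `<=` Z) (t' : T `<=` Z') (m : T `<=` U),
     rs t m a = rs t' m a') ->
  exists e : Al h x, forall Z z l a, Q Z z l a -> rs z l e = a.
Proof.
move=> Qex Qeq.
have [v|Z Z' z z' a a' Qa Qa' T t t'|e eP] := @glue X _ _ _ _ (@ta_sheaf _ _ _ _ D U x)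
  (SubOpen h) (fun (Z : sub_open U) z a => Q Z z (sincl Z) a).
- move=> /Qex [Z [z [l [a [Zv Qa]]]]].
  by exists (SubOpen l), z, a.
- exact: Qeq Qa Qa' _ _ _ _.
by exists e => Z z l a; exact: (eP (SubOpen l)).
Qed.

Lemma tsep U (x : B U) W (h : W `<=` U) (a b : Al h x) :
  (forall v, (W : set X) v -> exists Z (z : Z `<=` W) (l : Z `<=` U),
    (Z : set X) v /\ rs z l a = rs z l b) -> a = b.
Proof.
move=> ab; apply: (@glue_uniq X _ _ _ _ (@ta_sheaf _ _ _ _ D U x) _ (SubOpen h) a b).
  by move=> V Z T k m l s; exact: ta_comp.
by move=> v /ab [Z [z [l [Zv e]]]]; exists (SubOpen l), z.
Qed.

Section Hom.
Variables (W U1 U2 : opens X) (h1 : W `<=` U1) (h2 : W `<=` U2).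
Variables (x : B U1) (y : B U2).

(** The sheaf associated with the contracted product, as a sheaf of equivariant
    functions: the class [a, g] is the function with value a at g. *)
Record eqmap := Eqmap {
  tf : forall Z, Z `<=` W -> forall (l1 : Z `<=` U1) (l2 : Z `<=` U2),
    lh L l1 l2 x y -> Al l2 y;
  tf_res : forall Z T (z : Z `<=` W) (l1 : Z `<=` U1) (l2 : Z `<=` U2)
    (k : T `<=` Z) (t : T `<=` W) (m1 : T `<=` U1) (m2 : T `<=` U2)
    (g : lh L l1 l2 x y), rs k m2 (tf z g) = tf t (lr k m1 m2 g);
  tf_eqv : forall Z (z : Z `<=` W) (l1 : Z `<=` U1) (l2 : Z `<=` U2)
    (g : lh L l1 l2 x y) (phi : lh L l2 l2 y y),
    tf z (phi ⊚ g) * ell phi = tf z g }.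

Lemma eqmap_eq (m n : eqmap) :
  (forall Z (z : Z `<=` W) (l1 : Z `<=` U1) (l2 : Z `<=` U2) (g : lh L l1 l2 x y),
    tf m z g = tf n z g) -> m = n.
Proof.
case: m n => [m mr me] [n nr ne] /= e.
have {}e : m = n.
  apply: functional_extensionality_dep => Z.
  apply: functional_extensionality_dep => z.
  apply: functional_extensionality_dep => l1.
  apply: functional_extensionality_dep => l2.
  by apply: functional_extensionality_dep => g.
by subst n; congr Eqmap; exact: Prop_irrelevance.
Qed.

(** By equivariance, one value of m determines all the others. *)
Lemma tfE (m : eqmap) Z (z : Z `<=` W) (l1 : Z `<=` U1) (l2 : Z `<=` U2)
    (g k : lh L l1 l2 x y) : tf m z k = tf m z g * ell (g ⊚ inv k).
Proof.
have -> : g ⊚ inv k = inv (k ⊚ inv g) by rewrite tinv_lc inv_inv.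
apply: ell_inv_unique; rewrite -(tf_eqv m z g (k ⊚ inv g)).
by rewrite -lcA tinvK lcm1.
Qed.

(** Local morphisms exist around every point, so it is enough to compare one value
    near each point. *)
Lemma eqmap_ext (m n : eqmap) :
  (forall v, (W : set X) v -> exists Z (z : Z `<=` W) l1 l2 (g : lh L l1 l2 x y),
    (Z : set X) v /\ tf m z g = tf n z g) -> m = n.
Proof.
move=> mn; apply: eqmap_eq => V w l1 l2 k; apply: tsep => v Vv.
have [Z [z [q1 [q2 [g [Zv e]]]]]] := mn v (w v Vv).
pose T := meet_open V Z.
have t := incl_trans w (@incl_meetl _ V Z).
have m1 := incl_trans l1 (@incl_meetl _ V Z).
have m2 := incl_trans l2 (@incl_meetl _ V Z).
exists T, (@incl_meetl _ V Z), m2; split=> //.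
have E (o : eqmap) : rs (@incl_meetl _ V Z) m2 (tf o w k)
    = rs (@incl_meetr _ V Z) m2 (tf o z g)
      * ell (lr (@incl_meetr _ V Z) m1 m2 g ⊚ inv (lr (@incl_meetl _ V Z) m1 m2 k)).
  by rewrite (tf_res o _ _ t m1) (tf_res o _ _ t m1); exact: tfE.
by rewrite (E m) (E n) e.
Qed.

Lemma bracket_eqv (a : Al h2 y) (f : lh L h1 h2 x y) Z (z : Z `<=` W) (l1 : Z `<=` U1)
    (l2 : Z `<=` U2) (g : lh L l1 l2 x y) (phi : lh L l2 l2 y y) :
  rs z l2 a * ell (lr z l1 l2 f ⊚ inv (phi ⊚ g)) * ell phi
  = rs z l2 a * ell (lr z l1 l2 f ⊚ inv g).
Proof. by rewrite -mulrA -tellM tinv_lc lcA (lcKr _ (tinvK D phi)). Qed.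

Lemma bracket_res (a : Al h2 y) (f : lh L h1 h2 x y) Z T (z : Z `<=` W) (l1 : Z `<=` U1)
    (l2 : Z `<=` U2) (k : T `<=` Z) (t : T `<=` W) (m1 : T `<=` U1)
    (m2 : T `<=` U2) (g : lh L l1 l2 x y) :
  rs k m2 (rs z l2 a * ell (lr z l1 l2 f ⊚ inv g))
  = rs t m2 a * ell (lr t m1 m2 f ⊚ inv (lr k m1 m2 g)).
Proof.
rewrite rmorphM (ta_comp _ _ _ _ t) -tell_res (lr_lc k m2 m1 m2).
by rewrite (lr_lr t) lr_tinv.
Qed.

Definition bracket (a : Al h2 y) (f : lh L h1 h2 x y) : eqmap :=
  @Eqmap (fun Z z l1 l2 g => rs z l2 a * ell (lr z l1 l2 f ⊚ inv g))
    (bracket_res a f) (bracket_eqv a f).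

Lemma tf_bracket (a : Al h2 y) (f : lh L h1 h2 x y) Z (z : Z `<=` W) (l1 : Z `<=` U1)
  (l2 : Z `<=` U2) : tf (bracket a f) z (lr z l1 l2 f) = rs z l2 a.
Proof. by rewrite /= tinvVK tell_id mulr1. Qed.

Lemma tf_bracket1 (a : Al h2 y) (f : lh L h1 h2 x y) (z : W `<=` W) :
  tf (bracket a f) z f = a.
Proof. by rewrite -[X in tf _ _ X](lr_id z) tf_bracket ta_id. Qed.

Lemma bracket_tf (m : eqmap) (f : lh L h1 h2 x y) : bracket (tf m incl_refl f) f = m.
Proof.
apply: eqmap_ext => v Wv; exists W, incl_refl, h1, h2, f; split=> //.
by rewrite tf_bracket1.
Qed.

Lemma eqmap_inj (m n : eqmap) (f : lh L h1 h2 x y) :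
  tf m incl_refl f = tf n incl_refl f -> m = n.
Proof. by move=> e; rewrite -(bracket_tf m f) e bracket_tf. Qed.

End Hom.

Arguments eqmap W {U1 U2} x y.
Arguments tf {W U1 U2 x y} t {Z} z {l1 l2} g : rename.

Definition eqmap_res W Z U1 U2 (k : Z `<=` W) (x : B U1) (y : B U2) (m : eqmap W x y) :
  eqmap Z x y :=
  @Eqmap Z _ _ x y (fun T t _ _ g => tf m (incl_trans k t) g)
    (fun T V t q1 q2 u v n1 n2 g => tf_res m (incl_trans k t) u (incl_trans k v) n1 n2 g)
    (fun T t q1 q2 g phi => tf_eqv m (incl_trans k t) g phi).

Lemma res_bracket W Z U1 U2 (h1 : W `<=` U1) (h2 : W `<=` U2) (k : Z `<=` W)
    (l1 : Z `<=` U1) (l2 : Z `<=` U2) (x : B U1) (y : B U2) (a : Al h2 y)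
    (f : lh L h1 h2 x y) :
  eqmap_res k (bracket a f) = bracket (rs k l2 a) (lr k l1 l2 f).
Proof.
apply: eqmap_eq => V v m1 m2 g /=.
by rewrite (ta_comp _ _ _ _ (incl_trans k v)) (lr_lr (incl_trans k v)).
Qed.

Section Comp.
Variables (W U1 U2 U3 : opens X) (h1 : W `<=` U1) (h2 : W `<=` U2).
Variables (h3 : W `<=` U3) (x : B U1) (y : B U2) (z : B U3).
Variables (m : eqmap W y z) (n : eqmap W x y).

(** The value of the composite m n at g g', as dictated by
    [a, g] [a', g'] = [a Phi(g)(a'), g g']. *)
Let val Z (w : Z `<=` W) (l1 : Z `<=` U1) (l2 : Z `<=` U2) (l3 : Z `<=` U3)
  (g : lh L l2 l3 y z) (g' : lh L l1 l2 x y) : Al l3 z :=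
  tf m w g * act g (tf n w g').

(** Two factorizations of the same morphism differ by psi : f = g psi and
    g' = psi f'.  With chi = g psi g^-1 one has f = chi g, and the factors
    ell(chi) produced by equivariance of m, by Phi(chi) = Ad(ell(chi)) and by
    Phi(g)(ell(psi)) = ell(chi) cancel. *)
Let val_eq Z (w w' : Z `<=` W) (l1 : Z `<=` U1) (l2 l2' : Z `<=` U2) (l3 : Z `<=` U3)
    (g : lh L l2 l3 y z) (g' : lh L l1 l2 x y) (f : lh L l2' l3 y z)
    (f' : lh L l1 l2' x y) : g ⊚ g' = f ⊚ f' -> val w g g' = val w' f f'.
Proof.
rewrite (Prop_irrelevance w' w); have el : l2' = l2 := Prop_irrelevance _ _.
subst l2' => e; pose psi := g' ⊚ inv f'; pose chi := g ⊚ psi ⊚ inv g.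
have ef' : psi ⊚ f' = g' by rewrite /psi (lcKr _ (tinvK D f')).
have ef : f = chi ⊚ g.
  rewrite /chi (lcKr _ (tinvK D g)) /psi lcA e -lcA tinvVK lcm1.
  by [].
rewrite /val -(tf_eqv n w f' psi) ef' ef tmM.
rewrite !(tm_comp chi g) -(tell_conj D g psi) -/chi !(tell_Ad chi).
rewrite -!mulrA ell_inv mulr1 ell_invl mulr1 mulrA.
by rewrite (tf_eqv m w g chi).
Qed.

(** A local morphism k factors only locally; the values attached to the
    factorizations agree by [val_eq] and glue. *)
Lemma eqmap_comp_ex Z (w : Z `<=` W) (l1 : Z `<=` U1) (l3 : Z `<=` U3) (k : lh L l1 l3 x z) :
  exists e : Al l3 z, forall T (t : T `<=` Z) (m1 : T `<=` U1) (m2 : T `<=` U2)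
    (m3 : T `<=` U3) (g : lh L m2 m3 y z) (g' : lh L m1 m2 x y) (v : T `<=` W),
    g ⊚ g' = lr t m1 m3 k -> rs t m3 e = tf m v g * act g (tf n v g').
Proof.
have [v Zv|T T' t t' q q' a a' [m1 [m2 [g [g' [v [e ->]]]]]] [n1 [n2 [f [f' [v' [e' ->]]]]]] V u u' p|e eP] :=
  @tglue U3 z Z l3 (fun T (t : T `<=` Z) (m3 : T `<=` U3) a =>
    exists (m1 : T `<=` U1) (m2 : T `<=` U2) (g : lh L m2 m3 y z)
      (g' : lh L m1 m2 x y) (v : T `<=` W),
      g ⊚ g' = lr t m1 m3 k /\ a = tf m v g * act g (tf n v g')).
- have [T [t [m1 [m2 [Tv [g']]]]]] :=
    tloc D (incl_trans h1 w) (incl_trans h2 w) x y Zv.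
  pose m3 := incl_trans l3 t; pose g := lr t m1 m3 k ⊚ inv g'.
  exists T, t, m3, (tf m (incl_trans w t) g * act g (tf n (incl_trans w t) g')).
  split=> //; exists m1, m2, g, g', (incl_trans w t); split=> //.
  by rewrite /g (lcKr _ (tinvK D g')).
- have c (Y : opens X) (r : V `<=` Y) (r1 : Y `<=` U1) (r2 : Y `<=` U2) (r3 : Y `<=` U3)
      (b : lh L r2 r3 y z) (b' : lh L r1 r2 x y) (o : Y `<=` W) :
    rs r p (tf m o b * act b (tf n o b'))
    = val (incl_trans o r) (lr r (incl_trans r2 r) p b)
      (lr r (incl_trans r1 r) (incl_trans r2 r) b').
    rewrite rmorphM (tf_res _ _ _ (incl_trans o r) (incl_trans r2 r)).
    by rewrite (tm_res _ (incl_trans r2 r)) (tf_res _ _ _ (incl_trans o r) (incl_trans r1 r)).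
  rewrite !c (Prop_irrelevance (incl_trans n1 u') (incl_trans m1 u)).
  by apply: val_eq; rewrite -!lr_lc e e' !(lr_lr (incl_trans t u)).
by exists e => T t m1 m2 m3 g g' v E; apply: eP; exists m1, m2, g, g', v.
Qed.

Let comp_fun Z (w : Z `<=` W) (l1 : Z `<=` U1) (l3 : Z `<=` U3) (k : lh L l1 l3 x z) :=
  sval (cid (eqmap_comp_ex w k)).

Let comp_funP Z (w : Z `<=` W) (l1 : Z `<=` U1) (l3 : Z `<=` U3) (k : lh L l1 l3 x z) :
  forall T (t : T `<=` Z) (m1 : T `<=` U1) (m2 : T `<=` U2)
    (m3 : T `<=` U3) (g : lh L m2 m3 y z) (g' : lh L m1 m2 x y) (v : T `<=` W),
    g ⊚ g' = lr t m1 m3 k -> rs t m3 (comp_fun w k) = tf m v g * act g (tf n v g').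
Proof. exact: svalP (cid (eqmap_comp_ex w k)). Qed.

Lemma comp_fun_res Z T (w : Z `<=` W) (l1 : Z `<=` U1) (l3 : Z `<=` U3)
    (k : T `<=` Z) (t : T `<=` W) (m1 : T `<=` U1) (m3 : T `<=` U3)
    (g : lh L l1 l3 x z) : rs k m3 (comp_fun w g) = comp_fun t (lr k m1 m3 g).
Proof.
apply: tsep => v Tv.
have [V [u [n1 [n2 [Vv [g']]]]]] :=
  tloc D (incl_trans h1 t) (incl_trans h2 t) x y Tv.
exists V, u, (incl_trans m3 u); split=> //.
rewrite (ta_comp _ _ _ _ (incl_trans k u)).
pose f := lr u n1 (incl_trans m3 u) (lr k m1 m3 g) ⊚ inv g'.
have fE : f ⊚ g' = lr u n1 (incl_trans m3 u) (lr k m1 m3 g).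
  by rewrite /f (lcKr _ (tinvK D g')).
rewrite (comp_funP t (incl_trans t u) fE).
rewrite (lr_lr (incl_trans k u)) in fE.
by rewrite (comp_funP w (incl_trans t u) fE).
Qed.

Lemma comp_fun_eqv Z (w : Z `<=` W) (l1 : Z `<=` U1) (l3 : Z `<=` U3)
    (k : lh L l1 l3 x z) (phi : lh L l3 l3 z z) :
  comp_fun w (phi ⊚ k) * ell phi = comp_fun w k.
Proof.
apply: tsep => v Zv.
have [V [u [n1 [n2 [Vv [g']]]]]] :=
  tloc D (incl_trans h1 w) (incl_trans h2 w) x y Zv.
exists V, u, (incl_trans l3 u); split=> //.
pose p := incl_trans l3 u; pose phi' := lr u p p phi.
pose f := lr u n1 p k ⊚ inv g'.
have fE : f ⊚ g' = lr u n1 p k by rewrite /f (lcKr _ (tinvK D g')).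
have fE' : (phi' ⊚ f) ⊚ g' = lr u n1 p (phi ⊚ k) by rewrite -lcA fE -lr_lc.
rewrite rmorphM (comp_funP _ (incl_trans w u) fE) (comp_funP _ (incl_trans w u) fE').
rewrite -tell_res tm_comp tell_Ad -!mulrA ell_invl mulr1 mulrA.
by rewrite (tf_eqv m _ f phi').
Qed.

Definition eqmap_comp : eqmap W x z := @Eqmap W U1 U3 x z comp_fun comp_fun_res comp_fun_eqv.

Lemma tf_comp Z (w : Z `<=` W) (l1 : Z `<=` U1) (l2 : Z `<=` U2) (l3 : Z `<=` U3)
    (g : lh L l2 l3 y z) (g' : lh L l1 l2 x y) :
  tf eqmap_comp w (g ⊚ g') = tf m w g * act g (tf n w g').
Proof.
by rewrite -[LHS](ta_id incl_refl); apply: comp_funP; rewrite lr_id.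
Qed.

End Comp.

Lemma local_hom_ex W U1 U2 (h1 : W `<=` U1) (h2 : W `<=` U2) (x : B U1) (y : B U2) v :
  (W : set X) v -> exists Z (z : Z `<=` W) (l1 : Z `<=` U1) (l2 : Z `<=` U2)
    (g : lh L l1 l2 x y), (Z : set X) v.
Proof.
by move=> Wv; have [Z [z [l1 [l2 [Zv [g]]]]]] := tloc D h1 h2 x y Wv; exists Z, z, l1, l2, g.
Qed.

Lemma act1 W U1 U2 (h1 : W `<=` U1) (h2 : W `<=` U2) (x : B U1) (y : B U2)
  (g : lh L h1 h2 x y) : act g 1 = 1.
Proof. by rewrite -(rmorph1 (tstr D h1 x)) tm_str rmorph1. Qed.

Lemma comp_bracket W U1 U2 U3 (h1 : W `<=` U1) (h2 : W `<=` U2) (h3 : W `<=` U3)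
    (x : B U1) (y : B U2) (z : B U3) (a : Al h3 z) (f : lh L h2 h3 y z)
    (b : Al h2 y) (g : lh L h1 h2 x y) :
  eqmap_comp h1 h2 (bracket a f) (bracket b g) = bracket (a * act f b) (f ⊚ g).
Proof.
apply: (eqmap_inj (f := f ⊚ g)); rewrite tf_bracket1.
by rewrite (tf_comp _ _ _ _ _ f g) !tf_bracket1.
Qed.

Lemma eqmap_comp1m W U1 U2 (h1 : W `<=` U1) (h2 : W `<=` U2) (x : B U1) (y : B U2)
    (m : eqmap W x y) : eqmap_comp h1 h2 (bracket 1 (lid L h2 y)) m = m.
Proof.
apply: eqmap_ext => v /(local_hom_ex h1 h2 x y) [Z [z [l1 [l2 [g Zv]]]]].
exists Z, z, l1, l2, g; split=> //; rewrite -[X in tf (eqmap_comp _ _ _ _) _ X]lc1m.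
by rewrite tf_comp tm_id -(lr_lid L h2 z) tf_bracket rmorph1 mul1r.
Qed.

Lemma eqmap_compm1 W U1 U2 (h1 : W `<=` U1) (h2 : W `<=` U2) (x : B U1) (y : B U2)
    (m : eqmap W x y) : eqmap_comp h1 h1 m (bracket 1 (lid L h1 x)) = m.
Proof.
apply: eqmap_ext => v /(local_hom_ex h1 h2 x y) [Z [z [l1 [l2 [g Zv]]]]].
exists Z, z, l1, l2, g; split=> //; rewrite -[X in tf (eqmap_comp _ _ _ _) _ X]lcm1.
by rewrite tf_comp -(lr_lid L h1 z) tf_bracket rmorph1 act1 mulr1.
Qed.

Lemma eqmap_compA W U1 U2 U3 U4 (h1 : W `<=` U1) (h2 : W `<=` U2) (h3 : W `<=` U3)
    (h4 : W `<=` U4) (x : B U1) (y : B U2) (z : B U3) (t : B U4)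
    (m : eqmap W z t) (n : eqmap W y z) (p : eqmap W x y) :
  eqmap_comp h1 h3 m (eqmap_comp h1 h2 n p) = eqmap_comp h1 h2 (eqmap_comp h2 h3 m n) p.
Proof.
apply: eqmap_ext => v Wv.
have [Z1 [z1 [a1 [a2 [f Z1v]]]]] := local_hom_ex h1 h2 x y Wv.
have [Z2 [z2 [b2 [b3 [g Z2v]]]]] := local_hom_ex (incl_trans h2 z1) (incl_trans h3 z1) y z Z1v.
have [Z [z3 [c3 [c4 [e Zv]]]]] := local_hom_ex (incl_trans h3 (incl_trans z1 z2))
  (incl_trans h4 (incl_trans z1 z2)) z t Z2v.
pose w := incl_trans z1 (incl_trans z2 z3).
pose c2 := incl_trans b2 z3; pose c1 := incl_trans a1 (incl_trans z2 z3).
pose g' := lr z3 c2 c3 g; pose f' := lr (incl_trans z2 z3) c1 c2 f.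
exists Z, w, c1, c4, (e ⊚ (g' ⊚ f')); split=> //.
by rewrite 2!tf_comp lcA 2!tf_comp tmM tm_comp mulrA.
Qed.

(** The canonical isomorphisms are the classes [1, c] of those of P. *)
Definition eqmap_lcat : lcat B.
Proof.
refine (@Lcat X B (fun W U1 U2 h1 h2 x y => eqmap W x y)
  (fun W U h x => bracket 1 (lid L h x))
  (fun W U1 U2 U3 h1 h2 h3 x y z m n => eqmap_comp h1 h2 m n)
  (fun W Z U1 U2 h1 h2 k l1 l2 x y m => eqmap_res k m)
  _ _ _ _ _ _ _
  (fun U V W h k l x => bracket 1 (lcan L h k l x))
  (fun U V W h k l x => bracket 1 (lcanV L h k l x)) _ _ _).
- by move=> *; exact: eqmap_comp1m.
- by move=> W U1 U2 h1 h2 x y f; exact: eqmap_compm1.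
- by move=> *; exact: eqmap_compA.
- move=> W U1 U2 h1 h2 k x y m; apply: eqmap_eq => Z z l1 l2 g /=.
  by rewrite (Prop_irrelevance (incl_trans k z) z).
- move=> W Z T U1 U2 h1 h2 k l1 l2 m q1 q2 n x y f.
  apply: eqmap_eq => V v o1 o2 g /=.
  by rewrite (Prop_irrelevance (incl_trans k _) (incl_trans n v)).
- by move=> W Z U h k l x; rewrite (res_bracket k l l) lr_lid rmorph1.
- move=> W Z U1 U2 U3 h1 h2 h3 k l1 l2 l3 x y z m n.
  apply: eqmap_ext => v Zv.
  have [V1 [v1 [a1 [a2 [g V1v]]]]] := local_hom_ex l1 l2 x y Zv.
  have [V [v2 [b2 [b3 [f Vv]]]]] := local_hom_ex (incl_trans l2 v1) (incl_trans l3 v1) y z V1v.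
  exists V, (incl_trans v1 v2), (incl_trans a1 v2), b3, (f ⊚ lr v2 (incl_trans a1 v2) b2 g).
  by split=> //; rewrite tf_comp [LHS]tf_comp.
- by move=> U V W h k l x; rewrite comp_bracket lcanK mul1r act1.
- by move=> U V W h k l x; rewrite comp_bracket lcanVK mul1r act1.
- by move=> U V W Z h k l m k' l' x; rewrite (res_bracket m k' l') lr_lcan rmorph1.
Defined.

End Twist.

Section TwistSheaf.
Variables (X : topologicalType) (R : ring_sheaf X) (B : obj_family X).
Variables (L : lcat B) (D : twist_data R L).
Implicit Types U V W Z T : opens X.
Local Notation rs k l := (ta D _ k l _).

(** Equivariant functions inherit the sheaf condition from the algebras where they
    take their values. *)
Lemma eqmap_lcat_sheaf : lsheaf (eqmap_lcat D).
Proof.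
move=> U1 U2 x y V I C CV cov s sP.
have sE i j Z (zi : Z `<=` C i) (zj : Z `<=` C j) (l1 : Z `<=` U1) (l2 : Z `<=` U2)
    (g : lh L l1 l2 x y) : tf (s i) zi g = tf (s j) zj g.
  have := congr1 (fun m => tf m incl_refl g) (sP i j (SubOpen2 l1 l2) zi zj).
  by rewrite /= (Prop_irrelevance (incl_trans zi _) zi) (Prop_irrelevance (incl_trans zj _) zj).
have ex Z (z : Z `<=` V) (l1 : Z `<=` U1) (l2 : Z `<=` U2) (g : lh L l1 l2 x y) :
    exists e : tA D l2 y, forall i T (t : T `<=` Z) (m1 : T `<=` U1) (m2 : T `<=` U2)
      (ti : T `<=` C i), rs t m2 e = tf (s i) ti (lr t m1 m2 g).
  have [v Zv|T T' t t' l l' a a' [i [ti [m1 ->]]] [j [tj [n1 ->]]] Y q q' m|e eP] :=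
    @tglue _ _ _ _ D U2 y Z l2 (fun T t m2 a => exists i (ti : T `<=` C i)
      (m1 : T `<=` U1), a = tf (s i) ti (lr t m1 m2 g)).
  - have [i _ Cv] := cov v (z v Zv); pose T := meet_open Z (C i).
    exists T, (@incl_meetl _ Z (C i)), (incl_trans l2 (@incl_meetl _ Z (C i))).
    exists (tf (s i) (@incl_meetr _ Z (C i)) (lr (@incl_meetl _ Z (C i))
      (incl_trans l1 (@incl_meetl _ Z (C i))) (incl_trans l2 (@incl_meetl _ Z (C i))) g)).
    split=> //; exists i, (@incl_meetr _ Z (C i)).
    by exists (incl_trans l1 (@incl_meetl _ Z (C i))).
  - pose n := incl_trans l1 (incl_trans t q).
    rewrite (tf_res _ _ _ (incl_trans ti q) n) (tf_res _ _ _ (incl_trans tj q') n).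
    rewrite !(lr_lr (incl_trans t q)); exact: sE.
  by exists e => i T t m1 m2 ti; apply: eP; exists i, ti, m1.
pose F Z z l1 l2 g := sval (cid (ex Z z l1 l2 g)).
have FP Z (z : Z `<=` V) l1 l2 (g : lh L l1 l2 x y) i T (t : T `<=` Z) m1 m2
    (ti : T `<=` C i) : rs t m2 (F Z z l1 l2 g) = tf (s i) ti (lr t m1 m2 g).
  by rewrite /F; case: cid => e /= eP; exact: eP.
have loc Z (z : Z `<=` V) (l : Z `<=` U2) (a b : tA D l y) :
    (forall i T (t : T `<=` Z) (m2 : T `<=` U2), T `<=` C i -> rs t m2 a = rs t m2 b) ->
    a = b.
  move=> ab; apply: tsep => v Zv; have [i _ Cv] := cov v (z v Zv).
  exists (meet_open Z (C i)), (@incl_meetl _ Z (C i)), (incl_trans l (@incl_meetl _ Z (C i))).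
  by split=> //; apply: (ab i); exact: incl_meetr.
have Fres Z T (z : Z `<=` V) (l1 : Z `<=` U1) (l2 : Z `<=` U2) (k : T `<=` Z)
    (t : T `<=` V) (m1 : T `<=` U1) (m2 : T `<=` U2) (g : lh L l1 l2 x y) :
    rs k m2 (F Z z l1 l2 g) = F T t m1 m2 (lr k m1 m2 g).
  apply: (loc) => // i Y q m Yi; rewrite (ta_comp _ _ _ _ (incl_trans k q)).
  rewrite !(FP _ _ _ _ _ i _ _ (incl_trans m1 q) _ Yi).
  by rewrite (lr_lr (incl_trans k q)).
have Feqv Z (z : Z `<=` V) (l1 : Z `<=` U1) (l2 : Z `<=` U2) (g : lh L l1 l2 x y)
    (phi : lh L l2 l2 y y) :
    F Z z l1 l2 (phi ⊚ g) * tell D phi = F Z z l1 l2 g.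
  apply: (loc) => // i Y q m Yi; rewrite rmorphM -tell_res.
  rewrite !(FP _ _ _ _ _ i _ _ (incl_trans l1 q) _ Yi) (lr_lc q (incl_trans l1 q) m m).
  exact: tf_eqv.
exists (@Eqmap _ _ _ _ D V _ _ x y F Fres Feqv); split.
- move=> i; apply: eqmap_eq => Z z l1 l2 g /=.
  by rewrite -[LHS](ta_id incl_refl) (FP _ _ _ _ _ i _ _ l1 _ z) lr_id.
- move=> m mP; apply: eqmap_eq => Z z l1 l2 g /=.
  apply: (loc) => // i T t m2 ti; have m1 := incl_trans l1 t.
  rewrite (FP _ _ _ _ _ i _ _ m1 _ ti) (tf_res m _ _ (incl_trans (CV i) ti) m1).
  by rewrite -(mP i) /=.
Qed.

Section Ops.
Variables (W U1 U2 : opens X) (x : B U1) (y : B U2).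
Implicit Types m n : eqmap D W x y.

Definition eqmap_add m n : eqmap D W x y.
Proof.
refine (@Eqmap _ _ _ _ D W _ _ x y (fun Z z l1 l2 g => tf m z g + tf n z g) _ _).
- by move=> Z T z l1 l2 k t m1 m2 g; rewrite rmorphD !(tf_res _ _ _ t m1).
- by move=> Z z l1 l2 g phi; rewrite mulrDl !tf_eqv.
Defined.

Definition eqmap_zero : eqmap D W x y.
Proof.
refine (@Eqmap _ _ _ _ D W _ _ x y (fun Z z l1 l2 g => 0) _ _).
- by move=> Z T z l1 l2 k t m1 m2 g; rewrite rmorph0.
- by move=> Z z l1 l2 g phi; rewrite mul0r.
Defined.

Definition eqmap_scale (r : R W) m : eqmap D W x y.
Proof.
refine (@Eqmap _ _ _ _ D W _ _ x y
  (fun Z z l1 l2 g => tstr D l2 y (rres R z r) * tf m z g) _ _).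
- move=> Z T z l1 l2 k t m1 m2 g.
  by rewrite rmorphM ta_str (rres_comp z k t) (tf_res _ _ _ t m1).
- by move=> Z z l1 l2 g phi; rewrite -mulrA tf_eqv.
Defined.

Definition eqmap_lmodule : GRing.Lmodule (R W) (eqmap D W x y).
Proof.
apply: (@mk_lmodule (R W) (eqmap D W x y) eqmap_zero (eqmap_scale (-1)) eqmap_add eqmap_scale).
- by move=> m n p; apply: eqmap_eq => Z z l1 l2 g; rewrite /= addrA.
- by move=> m n; apply: eqmap_eq => Z z l1 l2 g; rewrite /= addrC.
- by move=> m; apply: eqmap_eq => Z z l1 l2 g; rewrite /= add0r.
- by move=> m; apply: eqmap_eq => Z z l1 l2 g; rewrite /= !rmorphN1 mulN1r addNr.
- by move=> a b m; apply: eqmap_eq => Z z l1 l2 g; rewrite /= !rmorphM mulrA.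
- by move=> m; apply: eqmap_eq => Z z l1 l2 g; rewrite /= !rmorph1 mul1r.
- by move=> a m n; apply: eqmap_eq => Z z l1 l2 g; rewrite /= mulrDr.
- by move=> m a b; apply: eqmap_eq => Z z l1 l2 g; rewrite /= !rmorphD mulrDl.
Defined.

Definition eqmap_lmodType : lmodType (R W) := GRing.Lmodule.Pack eqmap_lmodule.

Lemma eqmap_addE (m n : eqmap_lmodType) Z (z : Z `<=` W) (l1 : Z `<=` U1) (l2 : Z `<=` U2)
  (g : lh L l1 l2 x y) : tf (m + n : eqmap_lmodType) z g = tf m z g + tf n z g.
Proof. by []. Qed.

Lemma eqmap_scaleE r (m : eqmap_lmodType) Z (z : Z `<=` W) (l1 : Z `<=` U1) (l2 : Z `<=` U2)
  (g : lh L l1 l2 x y) :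
  tf (r *: m : eqmap_lmodType) z g = tstr D l2 y (rres R z r) * tf m z g.
Proof. by []. Qed.

End Ops.

Lemma eqmap_ext_comp U1 U2 U3 W (h1 : W `<=` U1) (h2 : W `<=` U2) (h3 : W `<=` U3)
    (x : B U1) (y : B U2) (z : B U3) (m n : eqmap D W x z) :
  (forall Z (w : Z `<=` W) (l1 : Z `<=` U1) (l2 : Z `<=` U2) (l3 : Z `<=` U3)
    (f : lh L l2 l3 y z) (g : lh L l1 l2 x y),
    tf m w (f ⊚ g) = tf n w (f ⊚ g)) -> m = n.
Proof.
move=> mn; apply: eqmap_ext => v Wv.
have [V1 [v1 [a1 [a2 [g V1v]]]]] := local_hom_ex D h1 h2 x y Wv.
have [V [v2 [b2 [b3 [f Vv]]]]] := local_hom_ex D (incl_trans h2 v1) (incl_trans h3 v1) y z V1v.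
by exists V, (incl_trans v1 v2), (incl_trans a1 v2), b3, (f ⊚ lr v2 (incl_trans a1 v2) b2 g).
Qed.

Definition eqmap_llin : llin R (eqmap_lcat D).
Proof.
refine (@Llin X R _ (eqmap_lcat D) (fun W U1 U2 h1 h2 x y => eqmap_lmodule W x y) _ _ _ _ _ _).
- move=> W U1 U2 U3 h1 h2 h3 x y z f1 f2 g; apply: (eqmap_ext_comp h1 h2 h3 (y := y)).
  move=> Z w l1 l2 l3 f f'; rewrite [RHS]eqmap_addE.
  by rewrite !(tf_comp h1 h2) eqmap_addE mulrDl.
- move=> W U1 U2 U3 h1 h2 h3 x y z f g1 g2; apply: (eqmap_ext_comp h1 h2 h3 (y := y)).
  move=> Z w l1 l2 l3 k k'; rewrite [RHS]eqmap_addE.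
  by rewrite !(tf_comp h1 h2) eqmap_addE tmD mulrDr.
- move=> W U1 U2 U3 h1 h2 h3 x y z r f g; apply: (eqmap_ext_comp h1 h2 h3 (y := y)).
  move=> Z w l1 l2 l3 k k'; rewrite [RHS]eqmap_scaleE.
  by rewrite !(tf_comp h1 h2) eqmap_scaleE mulrA.
- move=> W U1 U2 U3 h1 h2 h3 x y z r f g; apply: (eqmap_ext_comp h1 h2 h3 (y := y)).
  move=> Z w l1 l2 l3 k k'; rewrite [RHS]eqmap_scaleE.
  by rewrite !(tf_comp h1 h2) eqmap_scaleE tmM tm_str !mulrA tstrC.
- by move=> W Z U1 U2 h1 h2 k l1 l2 x y f g; apply: eqmap_eq.
- move=> W Z U1 U2 h1 h2 k l1 l2 x y r f; apply: eqmap_eq => V z m1 m2 g.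
  by rewrite [RHS]eqmap_scaleE (rres_comp k z (incl_trans k z)).
Defined.

End TwistSheaf.

(** * The groupoid and the algebras of an algebroid data *)

Section TwistOf.
Variables (X : topologicalType) (R : ring_sheaf X) (D : algebroid_data R).
Implicit Types U V W Z T : opens X.
Local Notation P := (ad_P D).
Local Notation Phi := (ad_Phi D).
Local Notation LP := (lcat_of (ad_P D)).

Definition alg_over W U (h : W `<=` U) (x : P U) : pzRingType :=
  alg_of Phi x (SubOpen h).

Definition alg_over_res W Z U (h : W `<=` U) (k : Z `<=` W) (l : Z `<=` U) (x : P U) :
  {rmorphism alg_over h x -> alg_over l x} := ares (alg_of Phi x) (V := SubOpen h) (W := SubOpen l) k.

Definition alg_act W U1 U2 (h1 : W `<=` U1) (h2 : W `<=` U2) (x : P U1) (y : P U2)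
  (g : lh LP h1 h2 x y) (a : alg_over h1 x) : alg_over h2 y :=
  (lfun Phi g : ralg_hom _ _) (stop W) a.

Definition ell_over W U (h : W `<=` U) (x : P U) (f : lh LP h h x x) : alg_over h x :=
  uval (ad_ell (p := x) (V := SubOpen h) f).

Lemma hom_inv_ex W U1 U2 (h1 : W `<=` U1) (h2 : W `<=` U2) (x : P U1) (y : P U2)
  (f : lh LP h1 h2 x y) : is_iso (C := pcat P W) f.
Proof. by have [_ gr _ _] := ad_gerbe D; exact: gr. Qed.

Definition hom_inv W U1 U2 (h1 : W `<=` U1) (h2 : W `<=` U2) (x : P U1) (y : P U2)
  (f : lh LP h1 h2 x y) : lh LP h2 h1 y x := sval (cid (hom_inv_ex f)).

Lemma hom_invK W U1 U2 (h1 : W `<=` U1) (h2 : W `<=` U2) (x : P U1) (y : P U2)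
  (f : lh LP h1 h2 x y) : hom_inv f ⊚ f = lid LP h1 x.
Proof. exact: (svalP (cid (hom_inv_ex f))).1. Qed.

Lemma hom_invVK W U1 U2 (h1 : W `<=` U1) (h2 : W `<=` U2) (x : P U1) (y : P U2)
  (f : lh LP h1 h2 x y) : f ⊚ hom_inv f = lid LP h2 y.
Proof. exact: (svalP (cid (hom_inv_ex f))).2. Qed.

Lemma local_hom W U1 U2 (h1 : W `<=` U1) (h2 : W `<=` U2) (x : P U1) (y : P U2) (v : X) :
  (W : set X) v ->
  exists (Z : opens X) (z : Z `<=` W) (l1 : Z `<=` U1) (l2 : Z `<=` U2),
    (Z : set X) v /\ inhabited (lh LP l1 l2 x y).
Proof.
have [_ _ _ li] := ad_gerbe D.
move=> /(li W (x ↾ h1) (y ↾ h2)) [Z [Zv [i]]].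
exists Z, (sincl Z), (incl_trans h1 (sincl Z)), (incl_trans h2 (sincl Z)).
by split=> //; constructor; exact: (lup (L := LP) _ _ (fwd i)).
Qed.

Lemma ell_over_mul W U (h : W `<=` U) (x : P U) (f g : lh LP h h x x) :
  ell_over (f ⊚ g) = ell_over f * ell_over g.
Proof. exact: ad_ell_mul. Qed.

(** An invertible idempotent is 1. *)
Lemma ell_over_id W U (h : W `<=` U) (x : P U) : ell_over (lid LP h x) = 1.
Proof.
pose e := ad_ell (p := x) (V := SubOpen h) (idm (x ↾ h)).
have ee : uval e * uval e = uval e.
  by rewrite -(ad_ell_mul (p := x) (V := SubOpen h) (idm (x ↾ h)) (idm (x ↾ h))) comp1m.
by rewrite -[LHS]mulr1 -[X in _ * X](uvalV e) mulrA ee uvalV.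
Qed.

Lemma alg_act_id W U (h : W `<=` U) (x : P U) (a : alg_over h x) : alg_act (lid LP h x) a = a.
Proof. by rewrite /alg_act [lfun _ _](lf_id (lfun_of Phi) h x). Qed.

Lemma alg_act_comp W U1 U2 U3 (h1 : W `<=` U1) (h2 : W `<=` U2) (h3 : W `<=` U3)
  (x : P U1) (y : P U2) (z : P U3) (f : lh LP h2 h3 y z) (g : lh LP h1 h2 x y)
  (a : alg_over h1 x) : alg_act (f ⊚ g) a = alg_act f (alg_act g a).
Proof. by rewrite /alg_act [lfun _ _](lf_comp (lfun_of Phi) f g). Qed.

Lemma alg_act_res W Z U1 U2 (h1 : W `<=` U1) (h2 : W `<=` U2) (k : Z `<=` W)
    (l1 : Z `<=` U1) (l2 : Z `<=` U2) (x : P U1) (y : P U2) (g : lh LP h1 h2 x y)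
    (a : alg_over h1 x) :
  alg_over_res h2 k l2 y (alg_act g a) = alg_act (lr k l1 l2 g) (alg_over_res h1 k l1 x a).
Proof.
rewrite /alg_act lfun_res; set G := lfun Phi g : ralg_hom _ _.
pose A1 := alg_of Phi x; pose A2 := alg_of Phi y.
pose T1 := widen h1 (widen k (stop Z)); pose T2 := widen h2 (widen k (stop Z)).
have e := amap_res G (V := stop W) (W := widen k (stop Z)) k a.
transitivity (ares A2 (V := T2) (W := SubOpen l2) incl_refl
  (G (widen k (stop Z)) (ares A1 (V := SubOpen h1) (W := T1) k a))).
  refine (etrans _ (congr1 (ares A2 (V := T2) (W := SubOpen l2) incl_refl) (esym e))).
  exact/esym/(@ares_comp _ _ _ A2 (SubOpen h2) T2 (SubOpen l2) k incl_refl k).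
congr (ares A2 _ (G _ _)).
exact/esym/(@ares_comp _ _ _ A1 (SubOpen h1) (SubOpen l1) T1 k incl_refl k).
Qed.

(** The canonical isomorphism from the restriction of x to x acts by the
    identification of Phi(x|V) with Phi(x)|V: this is the compatibility of Phi
    with composition of restrictions. *)
Lemma alg_act_can U V W (h : V `<=` U) (k : W `<=` V) (x : P U)
  (a : alg_over k (x ↾ h)) :
  alg_act (lcan LP h k (incl_trans h k) x) a = alg_out Phi h x (SubOpen k) a.
Proof.
rewrite /alg_act.
have -> : lfun Phi (lcan LP h k (incl_trans h k) x)
    = fwd (pcomp (RAlg R) h k (incl_trans h k) (Phi U x)) ∘ pres k (fwd (fun_res Phi h x)).
  rewrite /lfun -fun_res_comp.
  by rewrite -!compA bwdK compm1.
exact: (@ares_id _ _ _ (alg_of Phi x) (widen h (SubOpen k))).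
Qed.

Lemma ell_over_Ad W U (h : W `<=` U) (x : P U) (f : lh LP h h x x) (a : alg_over h x) :
  alg_act f a = ell_over f * a * ell_over (hom_inv f).
Proof.
have := ad_ell_Ad (p := x) (V := SubOpen h) f (W := stop W) a.
rewrite /Ad /= !(@ares_id _ _ _ (alg_of Phi x) (SubOpen h)) => e.
apply: etrans e _; congr (_ * _ * _).
rewrite -[LHS]mulr1 -(ell_over_id h x) -(hom_invVK f) ell_over_mul mulrA.
by rewrite uinvV mul1r.
Qed.

Lemma ell_over_res W Z U (h : W `<=` U) (k : Z `<=` W) (l : Z `<=` U) (x : P U)
  (f : lh LP h h x x) : ell_over (lr k l l f) = alg_over_res h k l x (ell_over f).
Proof.
have e := @ad_ell_res _ _ D U x (SubOpen h) (SubOpen l) k f.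
exact: (congr1 (@uval (alg_of Phi x (SubOpen l))) e).
Qed.

Lemma ell_over_can U V W (h : V `<=` U) (k : W `<=` V) (x : P U)
    (f : lh LP k k (x ↾ h) (x ↾ h)) :
  ell_over (lup (L := LP) (incl_trans h k) (incl_trans h k) f)
  = alg_act (lcan LP h k (incl_trans h k) x) (ell_over f).
Proof.
rewrite alg_act_can.
exact: (@ad_ell_pres _ _ D U V h x (SubOpen k) f).
Qed.

(** The axiom of conjugation is about objects over the same open subset; objects
    x over U1 and y over U2 are first restricted to W, where the compatibility
    of ell with restrictions applies. *)
Lemma ell_over_conj W U1 U2 (h1 : W `<=` U1) (h2 : W `<=` U2)
    (x : P U1) (y : P U2) (g : lh LP h1 h2 x y) (f : lh LP h1 h1 x x) :
  ell_over (g ⊚ f ⊚ hom_inv g) = alg_act g (ell_over f).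
Proof.
pose c1 := lcan LP h1 incl_refl h1 x; pose c2 := lcan LP h2 incl_refl h2 y.
pose g' : lh LP incl_refl incl_refl (x ↾ h1) (y ↾ h2) := ldown _ _ _ _ g.
pose f' : lh LP incl_refl incl_refl (x ↾ h1) (x ↾ h1) := ldown _ _ _ _ f.
pose gi : iso (pcat P (stop W)) (x ↾ h1 ↾ sincl (stop W)) (y ↾ h2 ↾ sincl (stop W)) :=
  @Iso _ (pcat P (stop W)) (x ↾ h1 ↾ sincl (stop W)) (y ↾ h2 ↾ sincl (stop W))
    g' (hom_inv g') (hom_invK g') (hom_invVK g').
have e : ell_over (g' ⊚ f' ⊚ hom_inv g') = alg_act g' (ell_over f').
  exact: (@ad_ell_conj _ _ D W (x ↾ h1) (y ↾ h2) (stop W) gi f').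
have gE : lup (L := LP) h1 h2 g' = g by exact: ldownK.
have fE : lup (L := LP) h1 h1 f' = f by exact: ldownK.
have iE : lup (L := LP) h2 h1 (hom_inv g') = hom_inv g.
  rewrite -[LHS]lc1m -(hom_invK g) -lcA -[X in _ ⊚ (X ⊚ _)]gE -lup_comp hom_invVK lup_id.
  by rewrite lcm1.
have -> : g ⊚ f ⊚ hom_inv g = lup (L := LP) h2 h2 (g' ⊚ f' ⊚ hom_inv g').
  rewrite (lup_comp (h2 := h1) (k2 := incl_refl) h2 h1 h2).
  by rewrite (lup_comp (h2 := h1) (k2 := incl_refl) h1 h1 h2) gE fE iE.
have p2 q : ell_over (lup (L := LP) h2 h2 q) = alg_act c2 (ell_over q) by exact: ell_over_can.
have p1 q : ell_over (lup (L := LP) h1 h1 q) = alg_act c1 (ell_over q) by exact: ell_over_can.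
rewrite p2 e -fE p1 -!alg_act_comp.
congr (alg_act _ _); rewrite /g' /ldown -!lcA.
exact: (lcanVKl (L := LP)).
Qed.

Definition twist_of : twist_data R LP.
Proof.
refine (@TwistData X R P LP hom_inv hom_invK hom_invVK local_hom (fun W U h x => alg_over h x)
  (fun W U h x => astr (alg_of Phi x) (SubOpen h)) _ alg_over_res _ _ _ _
  alg_act _ _ _ alg_act_id alg_act_comp alg_act_res
  (fun W U h x f => ell_over f) ell_over_id ell_over_mul ell_over_res ell_over_Ad ell_over_conj).
- by move=> W U h x r a; exact: astrC.
- by move=> W U h k x a; exact: ares_id.
- move=> W Z T U h k l m n q x a.
  exact: (@ares_comp _ _ _ (alg_of Phi x) (SubOpen h) (SubOpen l) (SubOpen n) k m q a).
- move=> W Z U h k l x r.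
  exact: (@ares_str _ _ _ (alg_of Phi x) (SubOpen h) (SubOpen l) k r).
- move=> U x; exact: (@ares_sheaf _ _ _ (alg_of Phi x)).
- move=> W U1 U2 h1 h2 x y g a b.
  exact: (@amapD _ _ _ _ _ (lfun Phi g : ralg_hom _ _) (stop W) a b).
- move=> W U1 U2 h1 h2 x y g a b.
  exact: (@amapM _ _ _ _ _ (lfun Phi g : ralg_hom _ _) (stop W) a b).
- move=> W U1 U2 h1 h2 x y g r.
  exact: (@amap_str _ _ _ _ _ (lfun Phi g : ralg_hom _ _) (stop W) r).
Defined.

End TwistOf.

(** * The prestack of classes [a, g] *)

(** A morphism to a sheaf T extends from F to S by gluing in T the values on the
    sections of F which represent a section of S locally; injectivity makes these
    values unambiguous. *)
Lemma associated_sheafP (X : topologicalType) (U : opens X) (F S : presheaf U)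
    (eta : presheaf_map F S) :
  is_sheaf S ->
  (forall V s t, eta V s = eta V t -> s = t) ->
  (forall (V : sub_open U) (s : S V) x, (V : set X) x ->
    exists (W : sub_open U) (k : W `<=` V) t, (W : set X) x /\ psres k s = eta W t) ->
  associated_sheaf eta.
Proof.
move=> Ssh inj surj; split=> // T f Tsh.
have ex (V : sub_open U) (s : S V) : exists t : T V, forall (W : sub_open U) (k : W `<=` V) u,
    psres k s = eta W u -> psres k t = f W u.
  have [v Vv|W W' k k' t t' [u [eu ->]] [u' [eu' ->]] Z z z'|t tP] :=
    @glue X _ _ _ _ Tsh V (fun (W : sub_open U) (k : W `<=` V) t =>
      exists u, psres k s = eta W u /\ t = f W u).
  - by have [W [k [u [Wv e]]]] := surj V s v Vv; exists W, k, (f W u); split=> //; exists u.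
  - rewrite -!pmap_res; congr (f Z _); apply: inj; rewrite !pmap_res -eu -eu'.
    have l : Z `<=` V by exact: incl_trans k z.
    by rewrite !(psres_comp _ _ l).
  by exists t => W k u e; apply: tP; exists u.
split.
  pose f' (V : sub_open U) s := sval (cid (ex V s)).
  have f'P (V : sub_open U) s (W : sub_open U) (k : W `<=` V) u : psres k s = eta W u -> psres k (f' V s) = f W u.
    by rewrite /f'; case: cid => t /= tP; exact: tP.
  unshelve eexists (@PresheafMap _ _ S T f' _) => [V W h s|V s] /=.
    apply: (@glue_uniq X _ _ _ _ Tsh) => [A B C k l m t|w Ww]; first exact: psres_comp.
    have [Z [k [u [Zw e]]]] := surj W (psres h s) w Ww.
    exists Z, k; split=> //; rewrite (f'P _ _ _ _ _ e) (psres_comp h k (incl_trans h k)).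
    by rewrite (f'P _ _ _ _ u) // -e (psres_comp h k (incl_trans h k)).
  by rewrite -[LHS](psres_id incl_refl) (f'P _ _ _ _ s) // psres_id.
move=> f1 f2 e V s.
apply: (@glue_uniq X _ _ _ _ Tsh) => [A B C k l m t|v Vv]; first exact: psres_comp.
have [Z [k [u [Zv eu]]]] := surj V s v Vv.
by exists Z, k; split=> //; rewrite -!pmap_res eu e.
Qed.

Section Bracket.
Variables (X : topologicalType) (R : ring_sheaf X) (B : obj_family X).
Variables (L : lcat B) (D : twist_data R L).
Implicit Types U V W Z T : opens X.

Lemma ldown_bracket W U1 U2 V1 V2 (h1 : V1 `<=` U1) (h2 : V2 `<=` U2)
    (k1 : W `<=` V1) (k2 : W `<=` V2) (l1 : W `<=` U1) (l2 : W `<=` U2)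
    (x : B U1) (y : B U2) (a : tA D l2 y) (f : lh L l1 l2 x y) :
  ldown (L := eqmap_lcat D) h1 h2 k1 k2 (bracket a f : lh (eqmap_lcat D) l1 l2 x y)
  = bracket (tm (lcanV L h2 k2 l2 y) a) (ldown h1 h2 k1 k2 f).
Proof. by rewrite /ldown /= !comp_bracket !act1 mul1r mulr1. Qed.

Lemma bracket_scale W U1 U2 (h1 : W `<=` U1) (h2 : W `<=` U2) (x : B U1) (y : B U2)
    (r : R W) (a : tA D h2 y) (f : lh L h1 h2 x y) :
  r *: (bracket a f : llm (eqmap_llin D) h1 h2 x y) = bracket (tstr D h2 y r * a) f.
Proof.
apply: eqmap_eq => Z z l1 l2 g.
rewrite -[LHS]/(tstr D l2 y (rres R z r) * tf (bracket a f) z g) /=.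
by rewrite rmorphM ta_str mulrA.
Qed.

(** Evaluation at f: the value at f of [b, g] is b ell(g f^-1). *)
Lemma bracket_add W U1 U2 (h1 : W `<=` U1) (h2 : W `<=` U2) (x : B U1) (y : B U2)
    (a b : tA D h2 y) (f g : lh L h1 h2 x y) :
  (bracket a f : llm (eqmap_llin D) h1 h2 x y) + bracket b g
  = bracket (a + b * tell D (g ⊚ tinv D f)) f.
Proof.
apply: (eqmap_inj (f := f)).
rewrite -[LHS]/(tf (bracket a f) incl_refl f + tf (bracket b g) incl_refl f) !tf_bracket1 /=.
by rewrite ta_id lr_id.
Qed.

Lemma tinv_uniq W U1 U2 (h1 : W `<=` U1) (h2 : W `<=` U2) (x : B U1) (y : B U2)
  (f : lh L h1 h2 x y) (g : lh L h2 h1 y x) : f ⊚ g = lid L h2 y -> tinv D f = g.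
Proof. by move=> fg; rewrite -[LHS]lcm1 -fg lcA tinvK lc1m. Qed.

Lemma tf_bracketE W U1 U2 (h1 : W `<=` U1) (h2 : W `<=` U2) (x : B U1) (y : B U2)
    (a : tA D h2 y) (f g : lh L h1 h2 x y) :
  tf (bracket a f) incl_refl g = a * tell D (f ⊚ tinv D g).
Proof. by rewrite /= ta_id lr_id. Qed.

Definition bracket_functor : lfunctor L (eqmap_lcat D).
Proof.
exists (fun U x => x) (fun W U1 U2 h1 h2 x y f => bracket (1 : tA D h2 y) f).
- by [].
- by move=> W U1 U2 U3 h1 h2 h3 x y z f g; rewrite /= comp_bracket act1 mulr1.
- by move=> W Z U1 U2 h1 h2 k l1 l2 x y f; rewrite [RHS](res_bracket k l1 l2) rmorph1.
Defined.

End Bracket.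

Section A0.
Variables (X : topologicalType) (R : ring_sheaf X) (D : algebroid_data R).
Implicit Types U V W Z T : opens X.
Local Notation P := (ad_P D).
Local Notation Phi := (ad_Phi D).
Local Notation LP := (lcat_of (ad_P D)).
Let T := twist_of D.

Definition A0 : prestack_on P := prestack_of (eqmap_lcat T).
Definition A0_linear : linear_structure R (Prestack A0) := linear_of (eqmap_llin T).

Definition A0_bracket U (p' p : P U) (a : alg_glob p) (g : 'Hom_P(p', p)) :
  hom_lmod A0_linear p' p :=
  bracket (D := T) (a : tA T incl_refl p) (pres incl_refl g : lh LP incl_refl incl_refl p' p).

Lemma act_pres U (p' p : P U) (g : 'Hom_P(p', p)) (a : alg_glob p') :
  tm (t := T) (pres incl_refl g : lh LP incl_refl incl_refl p' p) a = alg_glob_map g a.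
Proof. by rewrite [LHS]/(alg_act _ _) /alg_act lfun_pres. Qed.

Lemma act_canV U V W (h : V `<=` U) (k : W `<=` V) (p : P U)
    (a : tA T (incl_trans h k) p) :
  tm (t := T) (lcanV LP h k (incl_trans h k) p) a = alg_in Phi h p (SubOpen k) a.
Proof.
have e : alg_out Phi h p (SubOpen k) (alg_in Phi h p (SubOpen k) a) = a.
  pose B := ralg_res h (alg_of Phi p).
  exact: (congr1 (fun f : ralg_hom B B => f (SubOpen k) a) (bwdK (fun_res Phi h p))).
rewrite -[X in tm _ X]e -alg_act_can -[LHS]tm_comp lcanK; exact: tm_id.
Qed.

Lemma ldown_refl U V (h : V `<=` U) (p' p : P U) (g : lh LP h h p' p) :
  ldown (L := LP) h h incl_refl incl_refl g = pres incl_refl (g : 'Hom_P(p' ↾ h, p ↾ h)).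
Proof.
apply: (@fwd_inj _ _ _ _ _ (pcomp P h incl_refl h p)).
rewrite -[ldown _ _ _ _ _]/(bwd (pcomp P h incl_refl h p) ∘ g
  ∘ fwd (pcomp P h incl_refl h p')).
by rewrite -compA bwdKf !pcomp_unitr punit_nat.
Qed.

Lemma ldown_pres U V (h : V `<=` U) (p' p : P U) (g : 'Hom_P(p', p)) :
  ldown (L := LP) h h incl_refl incl_refl
    (lr h h h (pres incl_refl g : lh LP incl_refl incl_refl p' p))
  = pres incl_refl (pres h g).
Proof. by rewrite ldown_refl [lr _ _ _ _]lres_pres. Qed.

Lemma ldown_pcomp U V W (h : V `<=` U) (k : W `<=` V) (l : W `<=` U) (p : P U) :
  ldown (L := LP) k l incl_refl incl_refl (lcan LP h k l p)
  = pres incl_refl (fwd (pcomp P h k l p)).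
Proof.
apply: (@fwd_inj _ _ _ _ _ (pcomp P l incl_refl l p)).
rewrite -[ldown _ _ _ _ _]/(bwd (pcomp P l incl_refl l p) ∘ fwd (pcomp P h k l p)
  ∘ fwd (pcomp P k incl_refl k (p ↾ h))).
by rewrite -compA bwdKf (pcomp_assoc P h k incl_refl l k l).
Qed.

Lemma A0_separated : separated_prestack (Prestack A0).
Proof. exact/lsheaf_separated/eqmap_lcat_sheaf. Qed.

(** The function attached to a pair (a, g), defined on the pairs before passing
    to classes. *)
Definition cp_bracket U (p' p : P U) (V : sub_open U) (x : cp_pair p' p V) :
  eqmap T V p' p :=
  bracket (D := T) (h1 := sincl V) (h2 := sincl V) (x.1 : tA T (sincl V) p)
    (x.2 : lh LP (sincl V) (sincl V) p' p).

Lemma cp_bracket_rel U (p' p : P U) (V : sub_open U) (x y : cp_pair p' p V) :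
  clos_refl_sym_trans _ (@cp_rel _ _ _ _ p' p V) x y -> cp_bracket x = cp_bracket y.
Proof.
elim=> // [{}x {}y [phi [e1 e2]]|{}x {}y z _ -> _ ->] //.
apply: (eqmap_inj (f := (y.2 : lh LP (sincl V) (sincl V) p' p))).
rewrite /cp_bracket tf_bracket1 tf_bracketE e2 e1; congr (_ * tell T _).
exact: (lcKr (L := LP) phi (tinvVK T (y.2 : lh LP (sincl V) (sincl V) p' p))).
Qed.

(** Two pairs with the same function are related in one step, by
    phi = y.2 x.2^-1: equality of the values at x.2 is the relation between the
    first components. *)
Lemma cp_bracket_inj U (p' p : P U) (V : sub_open U) (x y : cp_pair p' p V) :
  cp_bracket x = cp_bracket y -> clos_refl_sym_trans _ (@cp_rel _ _ _ _ p' p V) x y.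
Proof.
move=> e; apply: rst_sym; apply: rst_step.
pose x2 : lh LP (sincl V) (sincl V) p' p := x.2.
pose y2 : lh LP (sincl V) (sincl V) p' p := y.2.
exists (y2 ⊚ tinv T x2); split.
  exact/esym/(lcKr (L := LP) y2 (tinvK T x2)).
have := congr1 (fun m => tf m incl_refl x2) e.
by rewrite /cp_bracket tf_bracket1 tf_bracketE => ->.
Qed.

Lemma cp_bracket_res U (p' p : P U) (V W : sub_open U) (h : W `<=` V) (x : cp_pair p' p V) :
  eqmap_res h (cp_bracket x) = cp_bracket (cp_pair_res h x).
Proof. exact: res_bracket. Qed.

Definition hom_of_eqmap U (p' p : P U) (V : sub_open U) (m : eqmap T V p' p) :
  hom_presheaf (C := Prestack A0) p' p V :=
  ldown (L := eqmap_lcat T) (sincl V) (sincl V) incl_refl incl_refl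
    (m : lh (eqmap_lcat T) (sincl V) (sincl V) p' p).

Definition eqmap_of_hom U (p' p : P U) (V : sub_open U)
  (f : hom_presheaf (C := Prestack A0) p' p V) : eqmap T V p' p :=
  lup (L := eqmap_lcat T) (k1 := incl_refl) (k2 := incl_refl) (sincl V) (sincl V) f.

Lemma hom_of_eqmapK U (p' p : P U) (V : sub_open U) : cancel (@hom_of_eqmap U p' p V) (@eqmap_of_hom U p' p V).
Proof. exact: ldownK. Qed.

Lemma eqmap_of_homK U (p' p : P U) (V : sub_open U) : cancel (@eqmap_of_hom U p' p V) (@hom_of_eqmap U p' p V).
Proof. exact: lupK. Qed.

Lemma hom_of_eqmap_res U (p' p : P U) (V W : sub_open U) (h : W `<=` V) (m : eqmap T V p' p) :
  psres h (hom_of_eqmap m) = hom_of_eqmap (eqmap_res h m).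
Proof. exact: lres_down. Qed.

Lemma cp_bracket_eta U (p' p : P U) (V : sub_open U) (x : cp_pair p' p V) :
  hom_of_eqmap (cp_bracket x) = A0_bracket (alg_in Phi (sincl V) p (stop V) x.1) x.2.
Proof.
rewrite /hom_of_eqmap /cp_bracket ldown_bracket ldown_refl; congr bracket.
exact: (act_canV (k := incl_refl)).
Qed.

(** The formulas for composition, scalars, sums and restrictions are computations
    with brackets.  A section of A0 is [m(g), g] near each point, for any local
    morphism g, so that the contracted product generates the sheaf. *)
Lemma A0_bracket_is_A0 : is_A0 A0_bracket.
Proof.
split.
- move=> U p' p.
  have rep (V : sub_open U) (S : contracted p' p V) : exists x, sval S = cp_class x.
    by case: S => S [x e]; exists x.
  pose eta (V : sub_open U) (S : contracted p' p V) : hom_presheaf (C := Prestack A0) p' p V :=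
    hom_of_eqmap (cp_bracket (sval (cid (rep V S)))).
  have etaE (V : sub_open U) S x : sval S = cp_class x -> eta V S = hom_of_eqmap (cp_bracket x).
    rewrite /eta; case: cid => y /= -> yx; congr hom_of_eqmap.
    apply: cp_bracket_rel; have : cp_class x x by exact: rst_refl.
    by rewrite -yx.
  have eta_res (V W : sub_open U) (h : W `<=` V) s : eta W (psres h s) = psres h (eta V s).
    have [x xs] := rep V s; rewrite (etaE V s x) //.
    rewrite (etaE W _ (cp_pair_res h x)); last first.
      by rewrite /= xs; exact: cp_res_class.
    by rewrite hom_of_eqmap_res cp_bracket_res.
  exists (PresheafMap eta_res) => [V a g|].
    by rewrite [LHS](etaE V _ (a, g)) // cp_bracket_eta.
  apply: associated_sheafP; first exact: A0_separated.
    move=> V s t; have [x xs] := rep V s; have [y yt] := rep V t.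
    rewrite [pmap_fun _ _]/= (etaE V s x) // [pmap_fun _ _]/= (etaE V t y) //.
    move=> /(can_inj (@hom_of_eqmapK _ _ _ _)) e.
    apply: cp_sec_eq; rewrite xs yt; apply: cp_class_eq; exact: cp_bracket_inj.
  move=> V s v Vv; pose m := eqmap_of_hom s.
  have [Z [z [l1 [l2 [g Zv]]]]] := local_hom_ex T (sincl V) (sincl V) p' p Vv.
  pose W := SubOpen l1.
  have Wl : l2 = sincl W by exact: Prop_irrelevance.
  move: g; rewrite Wl => g.
  exists W, z, (cp_mk (tf m z g) g); split=> //.
  rewrite [RHS](etaE W _ (tf m z g, g)) // -[s in LHS]eqmap_of_homK hom_of_eqmap_res.
  congr hom_of_eqmap; apply: (eqmap_inj (f := (g : lh LP (sincl W) (sincl W) p' p))).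
  rewrite /cp_bracket tf_bracket1 /=; congr (tf m _ g); exact: Prop_irrelevance.
- move=> U p'' p' p a g a' g'.
  rewrite [LHS](comp_bracket (D := T)) act_pres /A0_bracket pres_comp.
  by [].
- by move=> U p' p r a g; rewrite [LHS]bracket_scale.
- move=> U p' p a a' g g'; rewrite [LHS]bracket_add /A0_bracket; congr (bracket (_ + _ * _) _).
  rewrite /ell_glob pres_comp; congr (uval (ad_ell _)).
  congr (_ ∘ _).
  have e : pres incl_refl (fwd g) ∘ pres incl_refl (bwd g) = idm (p ↾ incl_refl).
    by rewrite -pres_comp bwdK pres_id.
  exact: (@tinv_uniq _ _ _ LP T U U U incl_refl incl_refl p' p (pres incl_refl (fwd g))
    (pres incl_refl (bwd g)) e).
- move=> U V h p' p a g.
  pose f : lh LP incl_refl incl_refl p' p := pres incl_refl g.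
  rewrite -[LHS]/(ldown (L := eqmap_lcat T) h h incl_refl incl_refl
    (eqmap_res h (bracket (D := T) (a : tA T incl_refl p) f) : lh (eqmap_lcat T) h h p' p)).
  rewrite (res_bracket h h h) ldown_bracket ldown_pres; congr bracket.
  exact: (act_canV (k := incl_refl)).
- by move=> U h p; rewrite /A0_bracket -pcomp_unitl.
- move=> U V W h k l p; rewrite /A0_bracket -ldown_pcomp.
  rewrite -[LHS]/(ldown (L := eqmap_lcat T) k l incl_refl incl_refl
    (bracket (D := T) (1 : tA T l p) (lcan LP h k l p) : lh (eqmap_lcat T) k l (p ↾ h) p)).
  by rewrite ldown_bracket act1.
Qed.

End A0.

(** * The algebroid *)

Section Transport.
Variables (X : topologicalType) (R : ring_sheaf X) (C A : prestack X).
Variables (i : functor C A).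
Hypothesis i_ff : forall (U : opens X) (x y : C U), bijective (@fun_hom X C A i U x y).

Variables (L0 : linear_structure R C) (L : linear_structure R A).
Hypothesis ilin : linear_functor L0 L i.

Lemma lfun_add (W U1 U2 : opens X) (h1 : W `<=` U1) (h2 : W `<=` U2) (x : C U1)
    (y : C U2) (f g : hom_lmod L0 (x ↾ h1) (y ↾ h2)) :
  lfun i (f + g : hom_lmod L0 (x ↾ h1) (y ↾ h2))
  = (lfun i f : hom_lmod L (i U1 x ↾ h1) (i U2 y ↾ h2)) + lfun i g.
Proof. by rewrite /lfun ilin.1 (comp_addr (l := L)) (comp_addl (l := L)). Qed.

Lemma lfun_scale (W U1 U2 : opens X) (h1 : W `<=` U1) (h2 : W `<=` U2) (x : C U1)
    (y : C U2) r (f : hom_lmod L0 (x ↾ h1) (y ↾ h2)) :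
  lfun i (r *: f : hom_lmod L0 (x ↾ h1) (y ↾ h2))
  = r *: (lfun i f : hom_lmod L (i U1 x ↾ h1) (i U2 y ↾ h2)).
Proof. by rewrite /lfun ilin.2 (comp_scaler (l := L)) (comp_scalel (l := L)). Qed.

(** Full faithfulness identifies the sheaves of endomorphisms of p and i(p). *)
Lemma end_iso_transport (U : opens X) (p : C U) (B : ralg R U) :
  end_iso L0 p B -> inhabited (end_iso L (i U p) B).
Proof.
move=> E; have ex (V : sub_open U) (f : hom_lmod L (i U p ↾ sincl V) (i U p ↾ sincl V)) :
    exists g : hom_lmod L0 (p ↾ sincl V) (p ↾ sincl V), lfun i (g : lh (lcat_of C) _ _ p p) = f.
  by have [j ij ji] := lfun_bij i_ff (sincl V) (sincl V) p p; exists (j f).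
pose j (V : sub_open U) f := sval (cid (ex V f)).
have jK (V : sub_open U) f : lfun i (j V f : lh (lcat_of C) _ _ p p) = f.
  exact: svalP (cid (ex V f)).
have iK (V : sub_open U) f : j V (lfun i (f : lh (lcat_of C) _ _ p p)) = f.
  by apply: (bij_inj (lfun_bij i_ff (sincl V) (sincl V) p p)); rewrite jK.
have jP (V : sub_open U) f g : lfun i (g : lh (lcat_of C) _ _ p p) = f -> j V f = g.
  by move=> <-; exact: iK.
constructor; exists (fun V f => ei_fun E (j V f)).
- move=> V; apply: bij_comp; first exact: ei_bij.
  by exists (fun f => lfun i (f : lh (lcat_of C) (sincl V) (sincl V) p p)) => f; [exact: jK|exact: iK].
- move=> V W h f; rewrite -ei_res; congr ei_fun; apply: jP.
  by rewrite [LHS](lfun_res i) jK.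
- move=> V f g; rewrite -ei_add; congr ei_fun; apply: jP.
  by rewrite [LHS]lfun_add !jK.
- move=> V r f; rewrite -ei_scale; congr ei_fun; apply: jP.
  by rewrite [LHS]lfun_scale jK.
- move=> V; rewrite -(ei_id E); congr ei_fun; apply: jP.
  exact: (lf_id (lfun_of i)).
- move=> V f g; rewrite -ei_comp; congr ei_fun; apply: jP.
  by rewrite [LHS](lf_comp (lfun_of i)) /= !jK.
Qed.

End Transport.

Lemma lup_linear (X : topologicalType) (R : ring_sheaf X) (B : obj_family X)
  (L : lcat B) (M : llin R L) (W U1 U2 V1 V2 : opens X) (h1 : V1 `<=` U1) (h2 : V2 `<=` U2)
  (k1 : W `<=` V1) (k2 : W `<=` V2) (l1 : W `<=` U1) (l2 : W `<=` U2)
  (x : B U1) (y : B U2) :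
  (forall f g : llm M k1 k2 (x ↾ h1) (y ↾ h2), lup l1 l2 (f + g : llm M k1 k2 _ _)
    = (lup l1 l2 f : llm M l1 l2 _ _) + lup l1 l2 g) /\
  (forall r (f : llm M k1 k2 (x ↾ h1) (y ↾ h2)), lup l1 l2 (r *: f : llm M k1 k2 _ _)
    = r *: (lup l1 l2 f : llm M l1 l2 _ _)).
Proof.
split=> [f g|r f]; rewrite /lup.
  by rewrite (ll_addr (l := M)) (ll_addl (l := M)).
by rewrite (ll_scaler (l := M)) (ll_scalel (l := M)).
Qed.

Section EndA0.
Variables (X : topologicalType) (R : ring_sheaf X) (D : algebroid_data R).
Local Notation P := (ad_P D).
Local Notation Phi := (ad_Phi D).
Local Notation LP := (lcat_of (ad_P D)).
Let T := twist_of D.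

Definition to_A0 : functor P (Prestack (A0 D)) := functor_to (bracket_functor T).

(** Evaluation at the identity: m n at 1 = 1 1 is m(1) n(1). *)
Lemma end_A0 (U : opens X) (p : P U) :
  end_iso (A0_linear D) (to_A0 U p) (alg_of Phi p).
Proof.
pose one (V : sub_open U) := lid LP (sincl V) p.
exists (fun V f => tf (eqmap_of_hom (p' := p) (p := p) f) incl_refl (one V)).
- move=> V; exists (fun a => hom_of_eqmap (bracket (D := T) (a : tA T (sincl V) p) (one V))) => [f|a].
    by rewrite bracket_tf eqmap_of_homK.
  by rewrite hom_of_eqmapK tf_bracket1.
- move=> V W h f; rewrite -[f in LHS]eqmap_of_homK [X in eqmap_of_hom X]hom_of_eqmap_res hom_of_eqmapK.
  rewrite [RHS](tf_res (eqmap_of_hom f) incl_refl h (incl_trans h incl_refl) (sincl W) (sincl W)).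
  by rewrite [lr _ _ _ _](lr_lid LP).
- move=> V f g.
  exact: (congr1 (fun m : eqmap T V p p => tf m incl_refl (one V))
    ((lup_linear (eqmap_llin T) (sincl V) (sincl V) incl_refl incl_refl
      (sincl V) (sincl V) p p).1 f g)).
- move=> V r f.
  apply: etrans (congr1 (fun m : eqmap T V p p => tf m incl_refl (one V))
    ((lup_linear (eqmap_llin T) (sincl V) (sincl V) incl_refl incl_refl
      (sincl V) (sincl V) p p).2 r f)) _.
  apply: etrans (eqmap_scaleE _ _ _ _) _.
  by rewrite rres_id.
- move=> V; rewrite [eqmap_of_hom _](lup_id (eqmap_lcat T)); exact: (tf_bracket1 (D := T)).
- move=> V f g.
  rewrite [eqmap_of_hom _](lup_comp (L := eqmap_lcat T) (h2 := sincl V) (k2 := incl_refl)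
    (sincl V) (sincl V) (sincl V)).
  have e := tf_comp (D := T) (sincl V) (sincl V) (eqmap_of_hom f) (eqmap_of_hom g) incl_refl (one V) (one V).
  rewrite [one V ⊚ one V](lc1m (l0 := LP)) in e.
  by apply: etrans e _; rewrite tm_id.
Defined.

End EndA0.

(** Both conditions are local and invariant under isomorphism, so they pass from P
    to A, whose objects are locally images of objects of P. *)
Lemma algebroidP (X : topologicalType) (R : ring_sheaf X) (P A : prestack X)
    (L : linear_structure R A) (J : functor P A) :
  stack A -> locally_nonempty P -> locally_isomorphic P ->
  (forall (U : opens X) (q : A U) x, (U : set X) x ->
    exists W : sub_open U, (W : set X) x /\
      exists p : P W, inhabited (iso (pcat A W) (J W p) (q ↾ sincl W))) ->
  algebroid L.
Proof.
move=> Ast Pne Piso Jess; split=> //.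
  by move=> x; have [U [Ux [p]]] := Pne x; exists U; split=> //; constructor; exact: J U p.
move=> U q' q x Ux.
have [W' [W'x [p' [t']]]] := Jess U q' x Ux; have [W [Wx [p [t]]]] := Jess U q x Ux.
have [c' cdom'E] := chart_of_iso t'; have [c cdomE] := chart_of_iso t.
rewrite -cdom'E in W'x; rewrite -cdomE in Wx.
pose M := meet_open (cdom c') (cdom c).
have [Z [Zx [s]]] := Piso M (cobj c' ↾ @incl_meetl _ _ _) (cobj c ↾ @incl_meetr _ _ _) x
  (conj W'x Wx).
pose k' := incl_trans (@incl_meetl _ (cdom c') (cdom c)) (sincl Z).
pose k := incl_trans (@incl_meetr _ (cdom c') (cdom c)) (sincl Z).
pose l := incl_trans (@cincl _ _ _ _ _ _ _ _ c) k.
pose g : lh (lcat_of P) k' k (cobj c') (cobj c) :=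
  lup (L := lcat_of P) (k1 := sincl Z) (k2 := sincl Z) _ _ (fwd s).
pose g' : lh (lcat_of P) k k' (cobj c) (cobj c') :=
  lup (L := lcat_of P) (k1 := sincl Z) (k2 := sincl Z) _ _ (bwd s).
have gK : g' ⊚ g = lid (lcat_of P) k' (cobj c').
  by rewrite /g /g' -(lup_comp (L := lcat_of P)) [_ ⊚ _](fwdK s) lup_id.
have gKV : g ⊚ g' = lid (lcat_of P) k (cobj c).
  by rewrite /g /g' -(lup_comp (L := lcat_of P)) [_ ⊚ _](bwdK s) lup_id.
have [e [e' [ee' e'e]]] := charts_iso l gK gKV.
exists (SubOpen l); split=> //; constructor.
exact: (@Iso _ (pcat A Z) (q' ↾ l) (q ↾ l) e e' ee' e'e).
Qed.

Theorem proposition1p2p4 (X : topologicalType) (R : ring_sheaf X)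
    (D : algebroid_data R) :
  exists (A0 : prestack_on (ad_P D)) (L0 : linear_structure R (Prestack A0)),
    (separated_prestack (Prestack A0) /\
     exists br : forall (U : opens X) (p' p : ad_P D U),
         alg_glob p -> chom (pcat (ad_P D) U) p' p -> hom_lmod L0 p' p,
       is_A0 br) /\
    exists (A : prestack X) (L : linear_structure R A)
        (i : functor (Prestack A0) A),
      [/\ associated_stack i, linear_functor L0 L i, algebroid L &
        exists J : functor (ad_P D) A,
          forall (U : opens X) (p : ad_P D U),
            inhabited (end_iso L (J U p) (alg_of (ad_Phi D) p))].
Proof.
have [_ _ Pne Piso] := ad_gerbe D.
exists (A0 D), (A0_linear D); split.
  by split; [exact: A0_separated|exists (@A0_bracket _ _ D); exact: A0_bracket_is_A0].
have [A [L [i [iA ilin i_ff i_ess]]]] := stackification (A0_linear D) (@A0_separated _ _ D).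
exists A, L, i; split=> //.
  by apply: (@algebroidP _ _ _ _ L (comp_functor i (to_A0 D))) => //; case: iA.
exists (comp_functor i (to_A0 D)) => U p.
exact: (end_iso_transport i_ff ilin (end_A0 p)).
Qed.
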